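(* Let $p>1$ and let $\mathcal{W}(r)$ be a positive monotone increasing function on $(0,+\infty)$ such that $$\int_0^\infty\frac{r\,|\ln r|^{\frac{p}{p-1}}\,dr}{\mathcal{W}(r)^{\frac1{p-1}}}<\infty .$$ Then there is a constant $C$ depending only on $p$ and $\mathcal{W}$ such that for every non-negative $V\in L^1_{loc}(\mathbb{R}^2)$ $$\mathrm{Neg}(V,\mathbb{R}^2)\le1+C\Big(\int_{\mathbb{R}^2}V^p(x)\,\mathcal{W}(|x|)\,dx\Big)^{1/p}.$$
   Context: A potential in an open set $\Omega\subset\mathbb{R}^2$ is a non-negative function $V\in L^1_{loc}(\Omega)$. For a potential $V$ in $\Omega$ put $$\mathcal{F}_{V,\Omega}=\Big\{f\in L^2_{loc}(\Omega):\ \int_\Omega|\nabla f|^2dx<\infty,\ \int_\Omega Vf^2dx<\infty\Big\}$$ (real-valued functions, $\nabla f$ the distributional gradient) and $\mathcal{E}_{V,\Omega}(f)=\int_\Omega|\nabla f|^2dx-\int_\Omega Vf^2dx$. Then $\mathrm{Neg}(V,\Omega)\in\{0,1,2,\dots,\infty\}$ is the supremum of $\dim\mathcal{V}$ over all linear subspaces $\mathcal{V}$ of $\mathcal{F}_{V,\Omega}$ such that $\mathcal{E}_{V,\Omega}(f)\le0$ for all $f\in\mathcal{V}$. The right-hand side of the inequality may be $+\infty$. *)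

(* Defs.v *)
From HB Require Import structures.
From mathcomp Require Import all_boot all_order all_algebra.
From mathcomp Require Import all_classical all_reals all_analysis.
Set Implicit Arguments.
Unset Strict Implicit.
Unset Printing Implicit Defensive.
Import Order.TTheory GRing.Theory Num.Theory.
Import numFieldNormedType.Exports.
Local Open Scope classical_set_scope.
Local Open Scope ring_scope.

(* The plane is [R * R]; its canonical norm is the sup norm, so the Euclidean
   norm is defined separately.  Elements of the function spaces over an open set
   [Om] are represented by functions on the whole plane that are Borel on [Om];
   only their values on [Om], up to almost everywhere equality, matter. *)

Section Plane.
Context {R : realType}.
Implicit Types (Om K : set (R * R)) (f V phi : R * R -> R)
  (S : set (R * R -> R)).

(* [R * R] with the sigma-algebra on which the product of the Lebesgue measures
   is declared as a measure; its carrier is convertible to [R * R], which carries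
   the topology. *)
Local Notation plane := (measurableTypeR R * measurableTypeR R)%type.

Definition leb2 : {measure set plane -> \bar R} :=
  (@lebesgue_measure R \x @lebesgue_measure R)%E.

Definition enorm (x : R * R) : R := Num.sqrt (x.1 ^+ 2 + x.2 ^+ 2).

Definition L1loc Om f : Prop := measurable_fun (Om : set plane) (f : plane -> R) /\
  forall K, compact K -> K `<=` Om ->
    (\int[leb2]_(x in K) `|f x|%:E < +oo)%E.

Definition L2loc Om f : Prop := measurable_fun (Om : set plane) (f : plane -> R) /\
  forall K, compact K -> K `<=` Om ->
    (\int[leb2]_(x in K) (f x ^+ 2)%:E < +oo)%E.

Definition unitv (i : 'I_2) : R * R := ((i == 0)%:R, (i == 1)%:R).

Definition partial (i : 'I_2) f : R * R -> R := fun x => 'D_(unitv i) f x.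

Definition smooth f : Prop := forall s : seq 'I_2,
  let g := foldr partial f s in
  continuous g /\ forall x i, derivable g x (unitv i).

Definition test_function Om phi : Prop :=
  [/\ smooth phi, compact (closure [set x | phi x != 0])
    & closure [set x | phi x != 0] `<=` Om].

Definition is_weak_gradient Om f (g : 'I_2 -> R * R -> R) : Prop :=
  forall i, L1loc Om (g i) /\ forall phi, test_function Om phi ->
    (\int[leb2]_(x in Om) (f x * partial i phi x) =
     - \int[leb2]_(x in Om) (g i x * phi x))%R.

Definition has_weak_gradient Om f : Prop := exists g, is_weak_gradient Om f g.

(* A weak gradient is unique up to almost everywhere equality on [Om]; one is
   chosen, and the value is arbitrary when there is none. *)
Definition gradient Om f : 'I_2 -> R * R -> R :=
  xget (fun _ _ => 0) [set g | is_weak_gradient Om f g].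

Definition dirichlet Om f : \bar R :=
  (\int[leb2]_(x in Om) (\sum_(i < 2) gradient Om f i x ^+ 2)%:E)%E.

Definition potential_energy V Om f : \bar R :=
  (\int[leb2]_(x in Om) (V x * f x ^+ 2)%:E)%E.

Definition potential Om V : Prop :=
  L1loc Om V /\ {ae leb2, forall x, Om x -> 0 <= V x}.

Definition form_domain V Om : set (R * R -> R) :=
  [set f | [/\ L2loc Om f, has_weak_gradient Om f,
      (dirichlet Om f < +oo)%E & (potential_energy V Om f < +oo)%E]].

Definition energy V Om f : \bar R :=
  (dirichlet Om f - potential_energy V Om f)%E.

Definition is_subspace S : Prop :=
  S 0 /\ forall (a : R) f g, S f -> S g -> S (a *: f + g).

Definition lin_indep Om n (u : 'I_n -> R * R -> R) : Prop :=
  forall c : 'I_n -> R,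
    {ae leb2, forall x, Om x -> \sum_(i < n) c i * u i x = 0} ->
    forall i, c i = 0.

(* The dimension, possibly [+oo], of the image of [S] in the space of functions
   modulo almost everywhere equality on [Om]. *)
Definition dimension Om S : \bar R :=
  ereal_sup [set n%:R%:E | n in [set n : nat |
    exists u : 'I_n -> R * R -> R, (forall i, S (u i)) /\ lin_indep Om u]].

Definition Neg V Om : \bar R :=
  ereal_sup [set dimension Om S | S in [set S |
    [/\ is_subspace S, S `<=` form_domain V Om
      & forall f, S f -> (energy V Om f <= 0)%E]]].

End Plane.

(* Main.v *)
Require Import Defs.
From HB Require Import structures.
From mathcomp Require Import all_boot all_order all_algebra.
From mathcomp Require Import all_classical all_reals all_analysis.
From mathcomp Require Import measurable_realfun ring lra.
Set Implicit Arguments.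
Unset Strict Implicit.
Unset Printing Implicit Defensive.
Import Order.TTheory GRing.Theory Num.Theory.
Import numFieldNormedType.Exports.
Local Open Scope classical_set_scope.
Local Open Scope ring_scope.

(** The number of negative directions is bounded by counting averages over
    squares.  Suppose that a finite list [L] of squares has the property that
    every [f] in the form domain whose averages over the members of [L] vanish
    satisfies [\int V f^2 <= 1/2 \int |grad f|^2], and that one of the members
    is a fixed square.  If moreover the energy of [f] is at most zero, then
    [grad f = 0], so [f] is constant, and the fixed square makes it zero.  Hence
    the averages over [L] separate the elements of a subspace on which the energy
    is nonpositive, and its dimension is at most the size of [L].  The theorem
    becomes: such an [L] exists with at most [1 + C J] members, where
    [J^p = \int V^p W].

    The only fact about the gradient that is used is that the averages of [f]
    over two adjacent squares of equal side differ, in square, by at most twice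
    the integral of [|grad f|^2] over their union ([adjacent_avg]); there is no
    dependence on the side.  It is obtained by testing the weak gradient against
    products of a tent in one variable and a bump in the other.  Following the
    averages down the dyadic tree of a square [Q] gives a Poincare inequality
    with weight [V] on [Q] as soon as the integral of [V] over a subsquare of
    side [s] is at most [T s^b] for some [b > 0] ([tree_bound]); to pass from the
    dyadic averages of [f] to [f] itself one needs their almost everywhere
    convergence ([tr_avg_ae_cvg]) and Fatou's lemma ([square_poincare]).  By
    Hoelder's inequality the assumption on [V] holds when [V^p] is integrable,
    with a constant governed by the scale invariant number
    [s^(2(p-1)) \int_Q V^p], called the excess of [Q] below.

    A square of large excess [e] is cut into dyadic subsquares of excess at most
    one.  Four children have together [4^(1-p)] times the excess of their parent,
    so [O(e^(1/p))] subsquares are enough ([subdivide]).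

    The plane without the origin is a union of square annuli of radii [2^k], each
    made of twelve squares of side [2^k].  Let [t_k] be the sum of the [e^(1/p)]
    over these twelve squares.  An annulus with [t_k <= 1] requires no square,
    but its potential energy involves the mean [m_k] of [f] through
    [t_k m_k^2].  These terms are controlled by the increments of [m_k],
    that is by the gradient, if [m_0 = 0] and if the means vanish in
    at most [\sum k t_k] further places ([chain]).  The condition [m_0 = 0] is the
    summand [1] in the theorem.  In total [1 + C \sum (1 + |k|) t_k] squares
    are used ([global_controls]).

    Finally [\sum (1 + |k|) t_k] is at most a constant times [J], by Hoelder's
    inequality: as [W] is increasing, [W(2^k)] times the integral of [V^p] over
    an annulus is at most that of [V^p W] ([tring_sum]), and the dual sum
    [\sum 4^k (1 + |k|)^(p/(p-1)) / W(2^k)^(1/(p-1))] is dominated by the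
    integral that is assumed to be finite, since [|ln r|] is comparable to [|k|]
    on the annulus of radius [2^k] ([Aterm_sum]). *)

(** * Smooth bump functions on the line *)

Section Bumps.
Context {R : realType}.
Implicit Types (f g : R -> R) (c s t x : R).

Fixpoint Ck (n : nat) f : Prop :=
  if n is m.+1 then
    exists2 g : R -> R, (forall x : R, is_derive x (1 : R) f (g x)) & Ck m g
  else continuous f.

Lemma CkS n f : Ck n.+1 f -> Ck n f.
Proof.
elim: n f => [|n IH] f [g fg Hg].
  move=> x; apply: differentiable_continuous; apply/derivable1_diffP.
  by have := fg x; case.
by exists g => //; exact: IH.
Qed.

Lemma Ck_cont n f : Ck n f -> continuous f.
Proof. by elim: n f => [//|n IH] f /CkS; exact: IH. Qed.

Lemma Ck_add n f g : Ck n f -> Ck n g -> Ck n (fun x => f x + g x).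
Proof.
elim: n f g => [|n IH] f g /=.
  by move=> cf cg x; apply: cvgD; [exact: cf|exact: cg].
move=> [f' ff' Hf] [g' gg' Hg]; exists (fun x => f' x + g' x); last exact: IH.
by move=> x; apply: is_deriveD.
Qed.

Lemma Ck_scale n (k : R) f : Ck n f -> Ck n (fun x => k * f x).
Proof.
elim: n f => [|n IH] f /=.
  by move=> cf x; apply: cvgMr; exact: cf.
move=> [f' ff' Hf]; exists (fun x => k * f' x); last exact: IH.
by move=> x; apply: is_deriveZ.
Qed.

Lemma Ck_mul n f g : Ck n f -> Ck n g -> Ck n (fun x => f x * g x).
Proof.
elim: n f g => [|n IH] f g.
  by move=> cf cg x; apply: cvgM; [exact: cf|exact: cg].
move=> Hf Hg; have [f' ff' Hf'] := Hf; have [g' gg' Hg'] := Hg.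
exists (fun x => f x * g' x + g x * f' x).
  by move=> x; apply: is_deriveM.
by apply: Ck_add; apply: IH => //; exact: CkS.
Qed.

Lemma Ck_affine n (u v : R) f : Ck n f -> Ck n (fun x => f (u * x + v)).
Proof.
elim: n f => [|n IH] f /=.
  move=> cf x; apply: (@continuous_comp _ _ _ (fun x => u * x + v) f).
    by apply: cvgD; [apply: cvgMr; exact: cvg_id|exact: cvg_cst].
  exact: cf.
move=> [f' ff' Hf]; exists (fun x => u * f' (u * x + v)); last first.
  exact/Ck_scale/IH.
move=> x.
have h : is_derive x 1 (fun x => u * x + v) u.
  rewrite -[X in is_derive _ _ _ X]addr0; apply: is_deriveD.
  by rewrite -[X in is_derive _ _ _ X]mulr1; apply: is_deriveZ.
by have := @is_derive1_comp _ f (fun x => u * x + v) x _ _ (ff' _) h;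
  rewrite mulrC.
Qed.

(** The index [k] makes the family stable: the derivative of a member is a
    linear combination of two others, so that all of them are smooth at once.
    *)
Definition flat (c : R) (k : nat) (t : R) : R :=
  if 0 < t then t ^- k * expR (- (c / t)) else 0.

(** The exponential dominates one term of its series, here the one of degree
    [k + 2]. The quadratic bound is what makes the derivative vanish at the
    origin. *)
Lemma flat_le c k t : 0 < c -> 0 <= flat c k t <=
  (k.+2)`!%:R / c ^+ k.+2 * t ^+ 2.
Proof.
move=> c0; rewrite /flat; case: ifPn => t0; last first.
  rewrite lexx /= mulr_ge0// ?sqr_ge0// divr_ge0// exprn_ge0//; exact: ltW.
rewrite mulr_ge0 ?expR_ge0 ?invr_ge0 ?exprn_ge0 ?(ltW t0)//=.
have e1 : (c / t) ^+ k.+2 / (k.+2)`!%:R <= expR (c / t).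
  have := @expR_ge1Dxn _ (c / t) k.+1 (ltW (divr_gt0 c0 t0)).
  by apply: le_trans; rewrite lerDr.
rewrite expRN.
have f0 : 0 < ((k.+2)`!%:R : R) by rewrite ltr0n fact_gt0.
have ct0 : 0 < c / t by rewrite divr_gt0.
have -> : (k.+2)`!%:R / c ^+ k.+2 * t ^+ 2 =
   t ^- k * ((c / t) ^+ k.+2 / (k.+2)`!%:R)^-1.
  rewrite expr_div_n -addn2 !exprD.
  by field; rewrite addn2 ?expf_neq0 ?(gt_eqF t0) ?(gt_eqF c0) ?(gt_eqF f0).
rewrite ler_wpM2l ?invr_ge0 ?exprn_ge0 ?(ltW t0) //.
by rewrite lef_pV2 ?posrE ?expR_gt0 // divr_gt0 // exprn_gt0.
Qed.

Lemma is_derive0_quadratic (f : R -> R) M :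
  (forall t, `|f t| <= M * t ^+ 2) -> is_derive (0 : R) 1 f 0.
Proof.
move=> fM.
have f0 : f 0 = 0.
  by apply/eqP; rewrite -normr_le0 (le_trans (fM 0))// expr0n mulr0.
have C : (fun h : R => h^-1 *: (f (h *: (1:R) + 0) - f 0)) @ 0^' --> (0 : R).
  apply/cvgr0Pnorm_le => e e0; near=> h.
  rewrite f0 subr0 addr0 /GRing.scale/= mulr1 normrM normfV.
  have h0 : 0 < `|h| by rewrite normr_gt0; near: h; exact: nbhs_dnbhs_neq.
  rewrite mulrC ler_pdivrMr//; apply: (le_trans (fM h)).
  rewrite -real_normK ?num_real// expr2 mulrA ler_wpM2r//.
  rewrite (le_trans (ler_norm _))// normrM normr_id.
  rewrite (@le_trans _ _ ((`|M| + 1) * `|h|)) ?ler_wpM2r// ?lerDl//.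
  rewrite -ler_pdivlMl ?ltr_wpDl//.
  by near: h; apply: dnbhs0_le; rewrite mulr_gt0// invr_gt0 ltr_wpDl.
apply: DeriveDef; first by apply/cvg_ex; exists 0.
exact/cvg_lim.
Unshelve. all: by end_near. Qed.

Lemma is_derive_flat c k (x : R) : 0 < c ->
  is_derive x (1:R) (flat c k) (- k%:R * flat c k.+1 x + c * flat c k.+2 x).
Proof.
move=> c0; have [x0|x0|->] := ltgtP x 0.
- rewrite /flat ltNge (ltW x0)/= !mulr0 addr0.
  apply: (@near_eq_is_derive _ _ _ (cst 0)).
  near=> y; rewrite /= ltNge; suff -> : y <= 0 by [].
  by apply: ltW; near: y; exact: lt_nbhsl.
- have x0' : x != 0 by rewrite gt_eqF.
  have E : is_derive x (1:R) (fun t => (t ^+ k)^-1 * expR (- (c * t^-1)))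
     (- k%:R * flat c k.+1 x + c * flat c k.+2 x).
    rewrite /flat x0.
    have d1 : is_derive x (1:R) (fun t : R => t ^+ k) (k%:R * x ^+ k.-1).
      have := @is_deriveX _ _ _ k x 1 _ (is_derive_id x 1).
      rewrite /GRing.scale/= mulr1; congr is_derive.
      by apply/funext => t; rewrite exprfctE.
    have d2 : is_derive x (1:R) (fun t : R => (t ^+ k)^-1)
        (- (x ^+ k) ^- 2 *: (k%:R * x ^+ k.-1)).
      have xk0 : x ^+ k != 0 by rewrite expf_neq0.
      exact: (@is_deriveV _ (fun t : R => t ^+ k) x _ _ xk0 d1).
    have d3 : is_derive x (1:R) (fun t : R => - (c * t^-1))
        (- (c *: (- x ^- 2 *: (1:R)))).
      by apply: is_deriveN; apply: is_deriveZ; apply: (@is_deriveV _ id).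
    have d4 := @is_derive1_comp _ expR (fun t : R => - (c * t^-1)) x _ _
      (is_derive_expR _) d3.
    have d5 := is_deriveM d2 d4.
    refine (@is_derive_eq _ _ _ (fun t => (t ^+ k)^-1 * expR (- (c * t^-1)))
      _ _ _ _ d5 _).
    rewrite /GRing.scale/=.
    set E := expR _.
    case: k {d1 d2 d5} => [|k] /=.
      by rewrite !expr0 !mul0r mulr0 mulr0 oppr0 mul0r addr0 add0r; field.
    rewrite !exprS !expr0; field.
    by rewrite x0' expf_neq0.
  apply: (near_eq_is_derive _ E).
  near=> y; rewrite /= /flat.
  suff -> : 0 < y by [].
  by near: y; apply: lt_nbhsr.
- rewrite /flat ltxx !mulr0 addr0.
  apply: (@is_derive0_quadratic _ ((k.+2)`!%:R / c ^+ k.+2)) => t.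
  by have /andP[f0 fM] := @flat_le c k t c0; rewrite (ger0_norm f0).
Unshelve. all: by end_near. Qed.

Lemma Ck_flat c k n : 0 < c -> Ck n (flat c k).
Proof.
move=> c0; elim: n k => [|n IH] k.
  move=> x; apply: differentiable_continuous; apply/derivable1_diffP.
  by have [] := is_derive_flat k x c0.
exists (fun x => - k%:R * flat c k.+1 x + c * flat c k.+2 x).
  by move=> x; exact: is_derive_flat.
by apply: Ck_add; apply: Ck_scale; exact: IH.
Qed.

(** bumpf on ]0, s[ *)
(** As [c] tends to zero this tends to the indicator of [ ]0, s[ ] from within
    [ [0, 1] ], so that a limit of test functions reaches indicators of
    squares. *)
Definition bumpf (c s t : R) : R := flat c 0 t * flat c 0 (s - t).

Lemma Ck_bump c s n : 0 < c -> Ck n (bumpf c s).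
Proof.
move=> c0; apply: Ck_mul; first exact: Ck_flat.
have := @Ck_affine n (-1) s _ (Ck_flat 0 n c0).
by congr (Ck n _); apply/funext => x; rewrite mulN1r addrC.
Qed.

Lemma flat0_le1 c t : 0 < c -> 0 <= flat c 0 t <= 1.
Proof.
move=> c0; rewrite /flat; case: ifPn => [t0|_]; last by rewrite lexx ler01.
by rewrite expr0 invr1 mul1r expR_ge0 -expR0 ler_expR oppr_le0 divr_ge0 ?ltW.
Qed.

Lemma bump_le1 c s t : 0 < c -> 0 <= bumpf c s t <= 1.
Proof.
move=> c0; have /andP[a0 a1] := flat0_le1 t c0.
have /andP[b0 b1] := flat0_le1 (s - t) c0.
by rewrite /bumpf mulr_ge0//= mulr_ile1.
Qed.

Lemma bump_out c s t : ~~ (0 < t < s) -> bumpf c s t = 0.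
Proof.
rewrite /bumpf /flat subr_gt0; case: (0 < t) => /=; last by rewrite mul0r.
by case: (t < s) => //= _; rewrite mulr0.
Qed.

Lemma bump_cvg s t : (bumpf (n.+1%:R^-1) s t) @[n --> \oo] -->
  ((0 < t < s)%R%:R : R).
Proof.
have [ts|ts] := boolP (0 < t < s); last first.
  rewrite (_ : (fun _ => _) = cst 0); first exact: cvg_cst.
  by apply/funext => n; rewrite bump_out.
have /andP[t0 st] := ts.
have F u : 0 < u -> flat (n.+1%:R^-1) 0 u @[n --> \oo] --> (1 : R).
  move=> u0; rewrite /flat u0.
  rewrite -[X in _ --> X](_ : expR (- (0 * u^-1)) = 1); last first.
    by rewrite mul0r oppr0 expR0.
  under eq_fun do rewrite expr0 invr1 mul1r.
  apply: continuous_cvg; first exact: continuous_expR.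
  apply: cvgN; apply: cvgMl; exact: cvg_harmonic.
rewrite -[X in _ --> X](mulr1 1).
by apply: cvgM; apply: F => //; rewrite subr_gt0.
Qed.

End Bumps.

(** * Smooth tents and tensor products *)

Section Tents.
Context {R : realType}.
Implicit Types (f g al be : R -> R) (c s t x : R).

Lemma bumpf_primitive c s : 0 < c ->
  exists F : R -> R, forall x, is_derive x (1:R) F (bumpf c s x).
Proof.
move=> c0.
have cb : continuous (bumpf c s) by exact: Ck_cont (Ck_bump s 0 c0).
have mb : measurable_fun setT (bumpf c s) by exact: continuous_measurable_fun.
have ib u : lebesgue_measure.-integrable `]-oo, u] (EFin \o bumpf c s).
  have I0 : lebesgue_measure.-integrable setT (EFin \o (\1_(`[0, s] : set R))).
    exact: integrable_indic_itv.
  apply: (@integrableS _ _ _ _ setT) => //.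
  apply: le_integrable I0 => //; first exact/measurable_EFinP.
  move=> t _ /=; rewrite lee_fin.
  have /andP[b0 b1] := bump_le1 s t c0.
  rewrite (ger0_norm b0) ger0_norm// indicE.
  have [|] := boolP (t \in _) => //; rewrite notin_setE/= in_itv/= => ts.
  rewrite bump_out//; apply/negP => /andP[t0 t1]; apply: ts.
  by rewrite !ltW.
exists (fun x => \int[lebesgue_measure]_(t in `]-oo, x]) bumpf c s t) => x.
have xx1 : x < x + 1 by rewrite ltrDl.
have ax : (-oo%O < BRight x)%E by rewrite ltNyr.
have [d e] := @continuous_FTC1 R (bumpf c s) -oo%O x (x + 1) xx1 (ib _) ax (cb x).
by rewrite -e derive1E; exact: derivableP.
Qed.

(** [al] is a primitive of a bump minus its translate by [s]. As the bump
    approaches an indicator, [al] approaches the tent of slopes 1 and -1 over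
    [ [0, 2 s] ]; the mean value theorem bounds it by [s] before the limit. *)
Lemma tent_exists c s : 0 < c -> 0 < s -> exists al : R -> R,
  [/\ forall n, Ck n al,
      forall x, is_derive x (1:R) al (bumpf c s x - bumpf c s (x - s)),
      forall x, `|al x| <= s &
      forall x, ~~ (0 < x < 2 * s) -> al x = 0].
Proof.
move=> c0 s0; have [F dF] := bumpf_primitive s c0.
pose al x := F x - F (x - s).
have dal x : is_derive x (1:R) al (bumpf c s x - bumpf c s (x - s)).
  apply: is_deriveB.
  rewrite -[X in is_derive _ _ _ X]mulr1.
  apply: (@is_derive1_comp _ F (fun x => x - s)).
  by rewrite -[X in is_derive _ _ _ X]subr0; apply: is_deriveB.
have M x : exists2 t : R, t \in `[x - s, x] & al x = bumpf c s t * s.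
  have le1 : x - s <= x by rewrite gerBl ltW.
  have cF : {within `[x - s, x], continuous F}.
    by apply: continuous_subspaceT => z; apply: differentiable_continuous;
      apply/derivable1_diffP; have [] := dF z.
  have [t tx e] := @MVT_segment _ F (bumpf c s) (x - s) x le1 (fun y _ => dF y) cF.
  by exists t => //; rewrite /al e; congr (_ * _); lra.
exists al; split => //.
- case=> [|n].
    move=> x; apply: differentiable_continuous; apply/derivable1_diffP.
    by have [] := dal x.
  exists (fun x => bumpf c s x - bumpf c s (x - s)) => //.
  have Cb := Ck_bump s n c0.
  have := Ck_add Cb (Ck_scale (-1) (Ck_affine 1 (- s) Cb)).
  by congr (Ck n _); apply/funext => x; rewrite mulN1r mul1r.
- move=> x; have [t _ ->] := M x.
  have /andP[b0 b1] := bump_le1 s t c0.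
  have s0' := ltW s0.
  by rewrite ger0_norm; [exact: ler_piMl|exact: mulr_ge0].
- move=> x xs; have [t + ->] := M x; rewrite in_itv/= => /andP[t1 t2].
  rewrite bump_out ?mul0r//; apply: contra xs => /andP[t3 t4].
  by apply/andP; split; lra.
Qed.

Definition tens (al be : R -> R) (x : R * R) : R := al x.1 * be x.2.

Lemma is_derive_tens0 al be (x : R * R) a :
  is_derive x.1 (1:R) al a ->
  is_derive x (unitv 0) (tens al be) (a * be x.2).
Proof.
move=> [dal eal].
have C : (fun h : R => h^-1 *: ((tens al be \o shift x) (h *: unitv 0) - tens al be x))
    @ 0^' --> a * be x.2.
  have -> : (fun h : R => h^-1 *: ((tens al be \o shift x) (h *: unitv 0) - tens al be x))
    = (fun h : R => h^-1 *: ((al \o shift x.1) (h *: (1:R)) - al x.1) * be x.2).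
    apply/funext => h; rewrite /tens/= /GRing.scale/= /unitv/=.
    by rewrite !mulr1 mulr0 add0r -[RHS]mulrA [in RHS]mulrBl.
  by apply: cvgMl; rewrite -eal; exact: dal.
apply: DeriveDef; first by apply/cvg_ex; eexists; exact: C.
exact/cvg_lim.
Qed.

Lemma is_derive_tens1 al be (x : R * R) b :
  is_derive x.2 (1:R) be b ->
  is_derive x (unitv 1) (tens al be) (al x.1 * b).
Proof.
move=> [dal eal].
have C : (fun h : R => h^-1 *: ((tens al be \o shift x) (h *: unitv 1) - tens al be x))
    @ 0^' --> al x.1 * b.
  have -> : (fun h : R => h^-1 *: ((tens al be \o shift x) (h *: unitv 1) - tens al be x))
    = (fun h : R => al x.1 * (h^-1 *: ((be \o shift x.2) (h *: (1:R)) - be x.2))).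
    apply/funext => h; rewrite /tens/= /GRing.scale/= /unitv/=.
    by rewrite !mulr1 mulr0 add0r [in RHS]mulrCA [in RHS]mulrBr.
  by apply: cvgMr; rewrite -eal; exact: dal.
apply: DeriveDef; first by apply/cvg_ex; eexists; exact: C.
exact/cvg_lim.
Qed.

(** Tensor products of smooth functions are stable under partial derivatives,
    so that smoothness of every order follows by induction. *)
Lemma partial_tens al be i : (forall n, Ck n al) -> (forall n, Ck n be) ->
  exists al' be' : R -> R, [/\ forall n, Ck n al', forall n, Ck n be' &
    forall x : R * R, is_derive x (unitv i) (tens al be) (tens al' be' x)].
Proof.
move=> Ca Cb.
have D (f : R -> R) : (forall n, Ck n f) ->
  exists2 g : R -> R, (forall n, Ck n g) & forall x : R, is_derive x (1:R) f (g x).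
  move=> Cf; have [g fg _] := Cf 1; exists g => // n.
  have [h fh Hh] := Cf n.+1; suff -> : g = h by [].
  apply/funext => x; have [_ <-] := fg x; by have [_ <-] := fh x.
have [-> | ->] : i = 0 \/ i = 1 by case: i => -[|[|//]] ?; [left|right]; exact/val_inj.
- have [g Cg ag] := D _ Ca; exists g, be; split => // x.
  exact: is_derive_tens0.
- have [g Cg bg] := D _ Cb; exists al, g; split => // x.
  exact: is_derive_tens1.
Qed.

Lemma smooth_tens al be : (forall n, Ck n al) -> (forall n, Ck n be) ->
  smooth (tens al be).
Proof.
move=> Ca Cb s.
have [al' [be' [Ca' Cb' ->]]] : exists al' be' : R -> R, [/\ forall n, Ck n al',
   forall n, Ck n be' & foldr partial (tens al be) s = tens al' be'].
  elim: s => [|i s [a1 [b1 [Ca1 Cb1 e1]]]]; first by exists al, be.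
  have [a2 [b2 [Ca2 Cb2 e2]]] := partial_tens i Ca1 Cb1.
  exists a2, b2; split => //=; rewrite e1; apply/funext => x.
  by rewrite /partial; have [_ ->] := e2 x.
split.
  move=> x; rewrite /tens; apply: cvgM.
    apply: (@continuous_comp _ _ _ fst al'); first exact: cvg_fst.
    exact: (Ck_cont (Ca' 0%N)).
  apply: (@continuous_comp _ _ _ snd be'); first exact: cvg_snd.
  exact: (Ck_cont (Cb' 0%N)).
move=> x i; have [a2 [b2 [_ _ e2]]] := partial_tens i Ca' Cb'.
by have [] := e2 x.
Qed.

End Tents.

(** * Testing a weak gradient *)

Section WeakGradient.
Context {R : realType}.
Local Notation plane := (measurableTypeR R * measurableTypeR R)%type.
Local Notation mu := (@leb2 R).
Implicit Types (f g : R * R -> R).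

(** Optimising [l] turns the bounds that come from [2 x y <= l x^2 + y^2 / l]
    into the Cauchy-Schwarz inequality. *)
Lemma amgm_sq (X a d : R) : 0 < a -> 0 <= d ->
  (forall l : R, 0 < l -> X <= (l * a + l^-1 * d) / 2) -> X ^+ 2 <= a * d \/ X <= 0.
Proof.
move=> a0 d0 H; have [X0|] := ltP 0 X; last by right.
left; have l0 : 0 < X / a by rewrite divr_gt0.
have := H _ l0; rewrite divfK ?gt_eqF// invf_div => H1.
have : X * X <= a * d.
  have : X * X <= X * ((X + a / X * d) / 2) by rewrite ler_wpM2l // ltW.
  have -> : X * ((X + a / X * d) / 2) = (X * X + a * d) / 2.
    by field; rewrite gt_eqF.
  by lra.
by rewrite expr2.
Qed.

(** If the derivatives of the test functions [phi n] converge to [\1_A -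
    \1_B], the left side of the weak identity converges to the difference of
    the integrals of [f] over [A] and [B]. The right side is at most [s] times
    the integral of [|g i|] over [U], hence at most [s * sqrt (u * d)]. *)
Lemma weak_gradient_cvg i (f : plane -> R) (g : 'I_2 -> plane -> R)
    (phi : nat -> plane -> R) (U A B : set plane) (s u d : R) :
  measurable_fun (setT : set plane) f ->
  is_weak_gradient setT f g ->
  0 < s -> 0 < u -> 0 <= d ->
  measurable U -> measurable A -> measurable B -> A `<=` U -> B `<=` U ->
  (mu U <= u%:E)%E ->
  mu.-integrable U (EFin \o f) ->
  (\int[mu]_(x in U) (g i x ^+ 2)%:E <= d%:E)%E ->
  (forall n, test_function setT (phi n)) ->
  (forall n, measurable_fun (setT : set plane) (phi n)) ->
  (forall n, measurable_fun (setT : set plane) (partial i (phi n) : plane -> R)) ->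
  (forall n x, `|phi n x| <= s * \1_U x) ->
  (forall n x, `|partial i (phi n) x| <= \1_U x) ->
  {ae mu, forall x, partial i (phi n) x @[n --> \oo] --> (\1_A x - \1_B x : R)} ->
  (\int[mu]_(x in A) f x - \int[mu]_(x in B) f x) ^+ 2 <= s ^+ 2 * (u * d).
Proof.
move=> mf wg s0 u0 d0 mU mA mB AU BU uU fU gd tphi mphi mdphi bphi bdphi cdphi.
have [[mg _] wgi] := wg i.
have bnd n : `|\int[mu]_x (f x * partial i (phi n) x)| ^+ 2 <= s ^+ 2 * (u * d).
  rewrite (wgi _ (tphi n)) normrN.
  set X := `|_|.
  have X0 : 0 <= X by rewrite normr_ge0.
  have HX : forall l : R, 0 < l -> X / s <= (l * u + l^-1 * d) / 2.
    move=> l l0; rewrite ler_pdivrMr//.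
    have mh : measurable_fun (setT : set plane) (EFin \o (fun x => g i x * phi n x)).
      by apply/measurable_EFinP; exact: measurable_funM.
    have H1 : (`| \int[mu]_x (g i x * phi n x)%:E | <=
       \int[mu]_(x in U) (l / 2 * s + l^-1 / 2 * s * g i x ^+ 2)%:E)%E.
      apply: (le_trans (le_abse_integral mu measurableT mh)).
      rewrite [leRHS]integral_mkcond.
      have mgU : measurable_fun (setT : set plane) (fun x => (g i x ^+ 2)%:E).
        by apply/measurable_EFinP; exact: measurable_funX.
      apply: ge0_le_integral => //.
      + exact: measurableT_comp.
      + refine ((measurable_restrictT (_ : plane -> \bar R) mU).1 _).
        apply/measurable_EFinP; apply: measurable_funD => //.
        apply: measurable_funM => //; apply: (@measurable_funS _ _ _ _ setT) => //.
        exact: measurable_funX.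
      + move=> x _; rewrite patchE; have := bphi n x; rewrite indicE.
        case: (x \in U) => /=; last first.
          by rewrite mulr0 normr_le0 => /eqP->; rewrite mulr0 normr0.
        rewrite mulr1 => bx.
        rewrite lee_fin normrM.
        have h1 : `|g i x| * `|phi n x| <= `|g i x| * s by rewrite ler_wpM2l.
        have h2 : `|g i x| <= l / 2 + l^-1 / 2 * g i x ^+ 2.
          rewrite -(real_normK (num_real (g i x))).
          have : 0 <= l^-1 / 2 * (`|g i x| - l) ^+ 2.
            by rewrite mulr_ge0 ?sqr_ge0 // divr_ge0 // invr_ge0 ltW.
          have -> : l^-1 / 2 * (`|g i x| - l) ^+ 2 =
            l / 2 + l^-1 / 2 * `|g i x| ^+ 2 - `|g i x|.
            by field; rewrite gt_eqF.
          by lra.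
        apply: (le_trans h1).
        have : `|g i x| * s <= (l / 2 + l^-1 / 2 * g i x ^+ 2) * s.
          by rewrite ler_wpM2r // ltW.
        by lra.
    have H2 : (\int[mu]_(x in U) (l / 2 * s + l^-1 / 2 * s * g i x ^+ 2)%:E
       <= (l / 2 * s)%:E * u%:E + (l^-1 / 2 * s)%:E * d%:E)%E.
      have a0 : 0 <= l / 2 * s by rewrite mulr_ge0 ?divr_ge0 ?(ltW l0) ?(ltW s0).
      have b0 : 0 <= l^-1 / 2 * s by rewrite mulr_ge0 ?divr_ge0 ?invr_ge0 ?(ltW l0) ?(ltW s0).
      have mgU : measurable_fun U (fun x => (g i x ^+ 2)%:E).
        apply/measurable_EFinP; apply: (@measurable_funS _ _ _ _ setT) => //.
        exact: measurable_funX.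
      rewrite (_ : (fun x => _) = (fun x => (l / 2 * s)%:E + (l^-1 / 2 * s)%:E * (g i x ^+ 2)%:E)%E) //.
      rewrite ge0_integralD//; first last.
      + exact: measurable_funeM.
      + by move=> x _; rewrite -EFinM lee_fin mulr_ge0 // sqr_ge0.
      rewrite integral_cst// ge0_integralZl//; first last.
      + by move=> x _; rewrite lee_fin sqr_ge0.
      by apply: leeD; apply: lee_pmul => //; apply: integral_ge0 => x _;
         rewrite lee_fin sqr_ge0.
    have := le_trans H1 H2.
    rewrite -!EFinM -EFinD => H3.
    have fn : (\int[mu]_x (g i x * phi n x)%:E)%E \is a fin_num.
      by rewrite fin_num_abs (le_lt_trans H3) // ltry.
    move: H3; rewrite -(fineK fn) /= lee_fin => H3.
    apply: (le_trans H3); lra.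
  have [H|H] := amgm_sq u0 d0 HX.
    move: H; rewrite expr_div_n ler_pdivrMr ?exprn_gt0 // => H.
    by rewrite mulrC.
  have -> : X = 0.
    apply/eqP; rewrite eq_le X0 andbT.
    by move: H; rewrite ler_pdivrMr // mul0r.
  by rewrite expr0n/= mulr_ge0 // ?sqr_ge0 // mulr_ge0 // ltW.
have mI (D : set plane) : measurable D -> measurable_fun setT (\1_D : plane -> R).
  by move=> mD; exact: measurable_indic.
have iU : mu.-integrable setT (fun x : plane => (`|f x| * \1_U x)%:E).
  have := (integrable_mkcond (fun x : plane => `|f x|%:E) mU).1 (integrable_norm fU).
  by congr (_.-integrable _ _); apply/funext => x; rewrite patchE indicE;
    case: (x \in U); rewrite ?mulr1 ?mulr0.
have fI (D : set plane) : measurable D -> D `<=` U ->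
    mu.-integrable setT (fun x : plane => (f x * \1_D x)%:E) /\
    \int[mu]_(x in D) f x = \int[mu]_x (f x * \1_D x).
  move=> mD DU; split.
    have := (integrable_mkcond (EFin \o f) mD).1 (integrableS mU mD DU fU).
    by congr (_.-integrable _ _); apply/funext => x; rewrite patchE indicE;
      case: (x \in D); rewrite ?mulr1 ?mulr0.
  rewrite Rintegral_mkcond; apply: eq_Rintegral => x _.
  by rewrite patchE indicE; case: (x \in D); rewrite ?mulr1 ?mulr0.
have mfE (h : plane -> R) : measurable_fun setT h ->
    measurable_fun setT (fun x : plane => (f x * h x)%:E).
  by move=> mh; apply/measurable_EFinP; apply: measurable_funM.
have cvE : {ae mu, forall x, setT x -> (f x * partial i (phi n) x)%:E @[n --> \oo] -->
    (f x * (\1_A x - \1_B x))%:E}.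
  apply: filterS cdphi; first exact: (ae_filter_ringOfSetsType mu).
  move=> x H _; apply: cvg_EFin; first exact: nearW.
  exact: cvgMr.
have fn0 n x : (`|(f x * partial i (phi n) x)%:E| <= (`|f x| * \1_U x)%:E)%E.
  by rewrite lee_fin normrM ler_wpM2l.
have [int_lim _ cv] := @dominated_convergence _ plane R mu setT measurableT
  (fun n (x : plane) => (f x * partial i (phi n) x)%:E)
  (fun x : plane => (f x * (\1_A x - \1_B x))%:E)
  (fun x : plane => (`|f x| * \1_U x)%:E)
  (fun n => mfE _ (mdphi n)) (mfE _ (measurable_funB (mI _ mA) (mI _ mB)))
  cvE iU (aeW _ (fun (x : plane) n _ => fn0 n x)).
have -> : \int[mu]_(x in A) f x - \int[mu]_(x in B) f x =
   \int[mu]_x (f x * (\1_A x - \1_B x)).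
  have [iA ->] := fI _ mA AU; have [iB ->] := fI _ mB BU.
  by rewrite -RintegralB//; apply: eq_Rintegral => x _; rewrite mulrBr.
have H : (\int[mu]_x (f x * partial i (phi n) x)) @[n --> \oo] -->
   \int[mu]_x (f x * (\1_A x - \1_B x)).
  apply: fine_cvg; rewrite fineK //.
  exact: integrable_fin_num.
rewrite -real_normK ?num_real //.
have H2 : (`|\int[mu]_x (f x * partial i (phi n) x)| ^+ 2) @[n --> \oo] -->
   `|\int[mu]_x (f x * (\1_A x - \1_B x))| ^+ 2.
  by rewrite expr2; apply: cvgM; apply: cvg_norm.
rewrite -(cvg_lim _ H2) //; apply: limr_le; first by apply/cvg_ex; eexists; exact: H2.
by near=> n; exact: bnd.
Unshelve. all: by end_near. Qed.

End WeakGradient.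

(** * Squares in the plane *)

Section Squares.
Context {R : realType}.
Local Notation plane := (measurableTypeR R * measurableTypeR R)%type.
Local Notation mu := (@leb2 R).

(** A square is given by its lower left corner and its side. *)
Record square := Sq {sqx : R; sqy : R; sqs : R}.

Implicit Types (Q : square).

(** Half-open, so that the four children of a square and the cells of an
    annulus are partitions and not just coverings. *)
Definition sset Q : set plane :=
  [set x | (sqx Q <= x.1 < sqx Q + sqs Q) && (sqy Q <= x.2 < sqy Q + sqs Q)].

Lemma ssetE Q : sset Q =
  (`[sqx Q, sqx Q + sqs Q[%classic : set (measurableTypeR R)) `*`
  (`[sqy Q, sqy Q + sqs Q[%classic : set (measurableTypeR R)).
Proof.
by apply/seteqP; split => x; rewrite /sset/= !in_itv/= => /andP.
Qed.

Lemma measurable_sset Q : measurable (sset Q).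
Proof. by rewrite ssetE; apply: measurableX; exact: measurable_itv. Qed.

Lemma measurable_EFin_sset Q (u : plane -> R) : measurable_fun setT u ->
  measurable_fun (sset Q) (fun x => (u x)%:E).
Proof.
by move=> mu'; apply/measurable_EFinP; exact: (@measurable_funS _ _ _ _ setT).
Qed.

Lemma leb2X (A B : set (measurableTypeR R)) : measurable A -> measurable B ->
  mu (A `*` B) = (@lebesgue_measure R A * @lebesgue_measure R B)%E.
Proof. by move=> mA mB; exact: product_measure1E. Qed.

Lemma leb2_sset Q : 0 <= sqs Q -> mu (sset Q) = (sqs Q ^+ 2)%:E.
Proof.
move=> s0; rewrite ssetE leb2X; [|exact: measurable_itv..].
have E (x : R) : lebesgue_measure `[x, x + sqs Q[%classic = (sqs Q)%:E.
  rewrite lebesgue_measure_itv /= lte_fin; case: ltP => [_|].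
    by rewrite -EFinB addrAC subrr add0r.
  by rewrite gerDl => s1; congr EFin; apply/eqP; rewrite eq_le s0 s1.
by rewrite !E -EFinM.
Qed.

Lemma compact_box (r : R) :
  compact [set x : R * R | (`|x.1| <= r) && (`|x.2| <= r)].
Proof.
rewrite (_ : mkset _ = `[-r, r]%classic `*` `[-r, r]%classic).
  by apply: compact_setX; exact: segment_compact.
by apply/seteqP; split => x /=; rewrite !in_itv/= !ler_norml => /andP.
Qed.

Lemma compact_closure (A K : set (R * R)) : compact K -> A `<=` K ->
  compact (closure A).
Proof.
move=> cK AK; apply: (@subclosed_compact _ _ K) => //; first exact: closed_closure.
have hT : hausdorff_space (R * R)%type by exact: norm_hausdorff.
have /closure_id -> : closed K := compact_closed hT cK.
exact: closureS.
Qed.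

Lemma null_line0 (a : R) : mu [set x : plane | x.1 = a] = 0%E.
Proof.
rewrite (_ : mkset _ = ([set a] : set (measurableTypeR R)) `*` setT).
  by rewrite leb2X// lebesgue_measure_set1 mul0e.
by apply/seteqP; split => x //= [].
Qed.

Lemma null_line1 (a : R) : mu [set x : plane | x.2 = a] = 0%E.
Proof.
rewrite (_ : mkset _ = setT `*` ([set a] : set (measurableTypeR R))).
  by rewrite leb2X// lebesgue_measure_set1 mule0.
by apply/seteqP; split => x //= [].
Qed.

Lemma sset_L2loc (f : plane -> R) Q : L2loc setT f -> 0 <= sqs Q ->
  (\int[mu]_(x in sset Q) (f x ^+ 2)%:E < +oo)%E /\
  mu.-integrable (sset Q) (EFin \o f).
Proof.
move=> [mf fK] s0.
have mf2 : measurable_fun setT (fun x : plane => (f x ^+ 2)%:E).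
  by apply/measurable_EFinP; exact: measurable_funX.
pose r := `|sqx Q| + `|sqy Q| + sqs Q.
have sub : sset Q `<=` [set x : R * R | (`|x.1| <= r) && (`|x.2| <= r)].
  move=> x /=; rewrite /sset/= !ler_norml => /andP[/andP[x1 x2] /andP[x3 x4]].
  have := ler_norm (sqx Q); have := ler_norm (sqy Q).
  have := ler_norm (- sqx Q); have := ler_norm (- sqy Q); rewrite !normrN /r.
  have := normr_ge0 (sqx Q); have := normr_ge0 (sqy Q).
  by move=> *; apply/andP; split; apply/andP; split; lra.
have mbox : measurable ([set x : plane | (`|x.1| <= r) && (`|x.2| <= r)]).
  rewrite (_ : mkset _ = (`[-r, r]%classic : set (measurableTypeR R)) `*` (`[-r, r]%classic : set (measurableTypeR R))).
    by apply: measurableX; exact: measurable_itv.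
  by apply/seteqP; split => x /=; rewrite !in_itv/= !ler_norml => /andP.
have I2 : (\int[mu]_(x in sset Q) (f x ^+ 2)%:E < +oo)%E.
  have fKr := fK _ (@compact_box r) (@subsetT _ _).
  refine (le_lt_trans _ fKr).
  apply: ge0_subset_integral => //; first exact: measurable_sset.
    by apply: (@measurable_funS _ _ _ _ setT).
  by move=> x _; rewrite lee_fin sqr_ge0.
split => //.
have mS := measurable_sset Q.
have i1 : mu.-integrable (sset Q) (cst 1%:E).
  apply/integrableP; split => //; rewrite /= integral_cst// leb2_sset//.
  by rewrite -EFinM ltry.
have i2 : mu.-integrable (sset Q) (fun x : plane => (f x ^+ 2)%:E).
  apply/integrableP; split; first exact: (@measurable_funS _ _ _ _ setT).
  by under eq_integral do rewrite gee0_abs ?lee_fin ?sqr_ge0//.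
apply: le_integrable (integrableD mS i1 i2) => //.
  by apply: measurable_EFin_sset.
move=> x _; rewrite /= lee_fin [leRHS]ger0_norm ?addr_ge0 ?sqr_ge0//.
rewrite -(real_normK (num_real (f x))).
have := sqr_ge0 (`|f x| - 2^-1); rewrite sqrrB; lra.
Qed.

End Squares.

(** * Averages over two adjacent squares *)

Section Adjacent.
Context {R : realType}.
Local Notation plane := (measurableTypeR R * measurableTypeR R)%type.
Local Notation mu := (@leb2 R).
Local Notation square := (@square R).

Implicit Types (Q : square).

Definition shiftq (i : 'I_2) Q : square :=
  if i == 0 then Sq (sqx Q + sqs Q) (sqy Q) (sqs Q)
  else Sq (sqx Q) (sqy Q + sqs Q) (sqs Q).

Definition avg (f : plane -> R) Q : R :=
  (sqs Q ^+ 2)^-1 * \int[mu]_(x in sset Q) f x.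

(** Coordinate along direction [i], and the transverse one; they allow both
    directions to be treated at once. *)
Let co (i : 'I_2) (x : R * R) : R := if i == 0 then x.1 else x.2.
Let cot (i : 'I_2) (x : R * R) : R := if i == 0 then x.2 else x.1.

Let prodfun i (al be : R -> R) (x : R * R) : R := al (co i x) * be (cot i x).

Let prodfunE i al be : prodfun i al be =
  if i == 0 then tens al be else tens be al.
Proof.
by apply/funext => x; rewrite /prodfun /co /cot /tens; case: (i == 0) => //; rewrite mulrC.
Qed.

Let smooth_prodfun i al be : (forall n, Ck n al) -> (forall n, Ck n be) ->
  smooth (prodfun i al be).
Proof.
by move=> Ca Cb; rewrite prodfunE; case: (i == 0); apply: smooth_tens.
Qed.

Let partial_prodfun i (al al' be : R -> R) :
  (forall x : R, is_derive x (1:R) al (al' x)) ->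
  partial i (prodfun i al be) = prodfun i al' be.
Proof.
move=> D; rewrite !prodfunE /partial; apply/funext => x.
have [-> | ->] : i = 0 \/ i = 1.
  by case: i => -[|[|//]] ?; [left|right]; exact/val_inj.
- by rewrite /=; have [_ ->] := @is_derive_tens0 _ al be x _ (D x.1).
- by rewrite /=; have [_ ->] := @is_derive_tens1 _ be al x _ (D x.2).
Qed.

Let mco i : measurable_fun setT (co i : plane -> measurableTypeR R).
Proof. by rewrite /co; case: (i == 0); [exact: measurable_fst|exact: measurable_snd]. Qed.
Let mcot i : measurable_fun setT (cot i : plane -> measurableTypeR R).
Proof. by rewrite /cot; case: (i == 0); [exact: measurable_snd|exact: measurable_fst]. Qed.

Let measurable_prodfun i (al be : R -> R) : continuous al -> continuous be ->
  measurable_fun setT (prodfun i al be : plane -> R).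
Proof.
move=> ca cb; apply: measurable_funM.
  by apply: (measurableT_comp (continuous_measurable_fun ca)); exact: mco.
by apply: (measurableT_comp (continuous_measurable_fun cb)); exact: mcot.
Qed.

Let null_co i a : mu [set x : plane | co i x = a] = 0%E.
Proof. by rewrite /co; case: (i == 0); [exact: null_line0|exact: null_line1]. Qed.
Let null_cot i a : mu [set x : plane | cot i x = a] = 0%E.
Proof. by rewrite /cot; case: (i == 0); [exact: null_line1|exact: null_line0]. Qed.

(** The test function is a tent along direction [i] times a bump across it:
    its derivative approaches [1] on [Q] and [-1] on the shifted square. The
    tent has height [s], the union has area [2 s^2], and the factor [s^4]
    disappears when integrals are replaced by averages. *)
Lemma adjacent_avg i (f : plane -> R) (g : 'I_2 -> plane -> R) Q (d : R) :
  L2loc setT f -> is_weak_gradient setT f g -> 0 < sqs Q ->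
  (\int[mu]_(x in sset Q `|` sset (shiftq i Q)) (\sum_(j < 2) g j x ^+ 2)%:E <= d%:E)%E ->
  (avg f Q - avg f (shiftq i Q)) ^+ 2 <= 2 * d.
Proof.
move=> fL wg s0 hd.
set s := sqs Q in s0 *.
pose a := if i == 0 then sqx Q else sqy Q.
pose b := if i == 0 then sqy Q else sqx Q.
pose Q' := shiftq i Q.
have QE x : sset Q x = (a <= co i x < a + s) && (b <= cot i x < b + s) :> Prop.
  by rewrite /sset/= /a /b /co /cot; case: (i == 0) => //; rewrite andbC.
have Q'E x : sset Q' x = (a + s <= co i x < a + s + s) && (b <= cot i x < b + s) :> Prop.
  by rewrite /sset/Q'/shiftq /= /a /b /co /cot; case: (i == 0) => //=; rewrite andbC.
have sQ' : sqs Q' = s by rewrite /Q' /shiftq; case: (i == 0).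
pose U := sset Q `|` sset Q'.
have mQ := measurable_sset Q; have mQ' := measurable_sset Q'.
have mU : measurable U by exact: measurableU.
have [mf _] := fL.
have [_ iQ] := sset_L2loc fL (ltW s0 : 0 <= sqs Q).
have [_ iQ'] : (\int[mu]_(x in sset Q') (f x ^+ 2)%:E < +oo)%E /\
    mu.-integrable (sset Q') (EFin \o f) by apply: sset_L2loc => //; rewrite sQ' ltW.
have iU : mu.-integrable U (EFin \o f).
  pose Q2 := Sq (sqx Q) (sqy Q) (2 * s).
  have [|_ iQ2] := @sset_L2loc R f Q2 fL; first by rewrite mulr_ge0// ltW.
  apply: integrableS iQ2 => //; first exact: measurable_sset.
  move=> x [|]; rewrite /sset/= /Q' /shiftq /Q2 /= -/s.
    by move=> /andP[/andP[? ?] /andP[? ?]]; apply/andP; split; apply/andP; split => //; lra.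
  by case: (i == 0) => /= /andP[/andP[? ?] /andP[? ?]]; apply/andP; split; apply/andP; split => //; lra.
have mg j : measurable_fun setT (g j) by have [[]] := wg j.
have d0 : 0 <= d.
  rewrite -lee_fin; apply: le_trans hd; apply: integral_ge0 => x _.
  by rewrite lee_fin sumr_ge0// => j _; rewrite sqr_ge0.
have gd : (\int[mu]_(x in U) (g i x ^+ 2)%:E <= d%:E)%E.
  apply: le_trans hd; apply: ge0_le_integral => //.
  - by move=> x _; rewrite lee_fin sqr_ge0.
  - apply/measurable_EFinP; apply: (@measurable_funS _ _ _ _ setT) => //.
    exact: measurable_funX.
  - apply/measurable_EFinP; apply: (@measurable_funS _ _ _ _ setT) => //.
    apply: measurable_sum => j; exact: measurable_funX.
  - by move=> x _; rewrite lee_fin (bigD1 i)//= lerDl sumr_ge0// => j _; rewrite sqr_ge0.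
have c0 n : 0 < n.+1%:R^-1 :> R by rewrite invr_gt0.
pose al n := projT1 (cid (tent_exists (c0 n) s0)).
have alP n := projT2 (cid (tent_exists (c0 n) s0)).
pose phi n := prodfun i (fun t => al n (t - a)) (fun t => bumpf n.+1%:R^-1 s (t - b)).
pose dal n t := bumpf n.+1%:R^-1 s (t - a) - bumpf n.+1%:R^-1 s (t - a - s).
have CA (h : R -> R) (v : R) n : (forall n, Ck n h) -> Ck n (fun t => h (t - v)).
  by move=> Ch; have := Ck_affine 1 (- v) (Ch n); congr (Ck n _); apply/funext => t; rewrite mul1r.
have Cal n k : Ck k (fun t => al n (t - a)).
  by apply: CA => m; have [/(_ m)] := alP n.
have Cbe n k : Ck k (fun t => bumpf n.+1%:R^-1 s (t - b)).
  by apply: CA => m; exact: Ck_bump.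
have dphi n : partial i (phi n) = prodfun i (dal n) (fun t => bumpf n.+1%:R^-1 s (t - b)).
  apply: partial_prodfun => x; have [_ Da _ _] := alP n.
  have D1 : is_derive x (1:R) (fun x : R => x - a) 1.
    by rewrite -[X in is_derive _ _ _ X]subr0; apply: is_deriveB.
  by have := @is_derive1_comp _ (al n) (fun x => x - a) x _ _ (Da _) D1; rewrite mulr1.
have inU x : 0 < co i x - a < 2 * s -> 0 < cot i x - b < s -> U x.
  move=> /andP[x1 x2] /andP[x3 x4]; rewrite /U /= QE Q'E.
  have [h|h] := ltP (co i x) (a + s).
    by left; apply/andP; split; apply/andP; split => //; lra.
  by right; apply/andP; split; apply/andP; split => //; lra.
have bphi n x : `|phi n x| <= s * \1_U x.
  have [_ _ b1 b2] := alP n.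
  have [h1|h1] := boolP (0 < co i x - a < 2 * s); last first.
    by rewrite /phi /prodfun /al b2// mul0r normr0 mulr_ge0// ltW.
  have [h2|h2] := boolP (0 < cot i x - b < s); last first.
    by rewrite /phi /prodfun bump_out// mulr0 normr0 mulr_ge0// ltW.
  rewrite indicE mem_set ?mulr1; last exact: inU.
  have /andP[c1 c2] := bump_le1 s (cot i x - b) (c0 n).
  rewrite /phi /prodfun normrM (ger0_norm c1).
  by rewrite -[leRHS]mulr1; apply: ler_pM => //; exact: b1.
have bdphi n x : `|partial i (phi n) x| <= \1_U x.
  rewrite dphi /prodfun /dal.
  have [h2|h2] := boolP (0 < cot i x - b < s); last first.
    by rewrite (bump_out _ h2) mulr0 normr0.
  have [h1|h1] := boolP (0 < co i x - a < 2 * s); last first.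
    rewrite (bump_out _ (t := co i x - a)); last first.
      by apply: contra h1 => /andP[? ?]; apply/andP; split; lra.
    rewrite bump_out ?subr0 ?mul0r ?normr0//.
    by apply: contra h1 => /andP[? ?]; apply/andP; split; lra.
  rewrite indicE mem_set; last exact: inU.
  rewrite (_ : true%:R = 1 :> R)//.
  have /andP[c1 c2] := bump_le1 s (cot i x - b) (c0 n).
  have /andP[c3 c4] := bump_le1 s (co i x - a) (c0 n).
  have /andP[c5 c6] := bump_le1 s (co i x - a - s) (c0 n).
  rewrite normrM (ger0_norm c1) -[leRHS]mulr1; apply: ler_pM => //.
  by rewrite ler_norml; apply/andP; split; lra.
have sphi n : smooth (phi n) by apply: smooth_prodfun => k.
have tphi n : test_function setT (phi n).
  split; [exact: sphi| |exact: subsetT].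
  apply: (compact_closure (@compact_box R (`|a| + `|b| + 2 * s))) => x /= phix.
  have : U x.
    have := bphi n x; rewrite indicE; have [/set_mem//|_] := boolP (x \in U).
    by rewrite mulr0 normr_le0 (negbTE phix).
  rewrite /U/= QE Q'E => xU.
  suff : (`|co i x| <= `|a| + `|b| + 2 * s) && (`|cot i x| <= `|a| + `|b| + 2 * s).
    by rewrite /co /cot; case: (i == 0) => //; rewrite andbC.
  have := ler_norm a; have := ler_norm b; have := ler_norm (- a).
  have := ler_norm (- b); rewrite !normrN => a1 a2 a3 a4.
  have := normr_ge0 a; have := normr_ge0 b => a5 a6.
  rewrite !ler_norml.
  by case: xU => /andP[/andP[? ?] /andP[? ?]]; apply/andP; split; apply/andP; split => //; lra.
have mline v : measurable [set x : plane | co i x = v].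
  by rewrite -[X in measurable X]setTI; exact: (@mco i measurableT _ (measurable_set1 v)).
have mline' v : measurable [set x : plane | cot i x = v].
  by rewrite -[X in measurable X]setTI; exact: (@mcot i measurableT _ (measurable_set1 v)).
(* The open bumps miss the left and lower edges of the half-open squares;
   these lie on three lines. *)
have cdphi : {ae mu, forall x, partial i (phi n) x @[n --> \oo] -->
    (\1_(sset Q) x - \1_(sset Q') x : R)}.
  have nl v : mu.-negligible [set x : plane | co i x = v].
    by apply/negligibleP; [exact: mline|exact: null_co].
  have nl' v : mu.-negligible [set x : plane | cot i x = v].
    by apply/negligibleP; [exact: mline'|exact: null_cot].
  apply: (negligibleS _ (negligibleU (negligibleU (nl a) (nl (a + s))) (nl' b))).
  move=> x; apply: contra_notP => /=; rewrite /setU/=.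
    move=> /not_orP[/not_orP[n1 n2] n3].
    have -> : \1_(sset Q) x - \1_(sset Q') x =
      ((0 < co i x - a < s)%R%:R - (0 < co i x - a - s < s)%R%:R) *
      (0 < cot i x - b < s)%R%:R :> R.
    have st (u v : R) : v <> u -> (u < v) = (u <= v).
      by move=> /eqP; rewrite lt_neqAle eq_sym => ->.
    have e1 : (x \in sset Q) = (0 < co i x - a < s) && (0 < cot i x - b < s).
      rewrite !subr_gt0 (st _ _ n1) (st _ _ n3) !ltrBlDl.
      by apply/idP/idP => [/set_mem|H]; [|apply/mem_set]; rewrite QE.
    have e2 : (x \in sset Q') = (0 < co i x - a - s < s) && (0 < cot i x - b < s).
      rewrite -addrA -opprD !subr_gt0 (st _ _ n2) (st _ _ n3) !ltrBlDl.
      by apply/idP/idP => [/set_mem|H]; [|apply/mem_set]; rewrite Q'E.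
    by rewrite !indicE e1 e2 mulrBl; congr (_ - _); rewrite -natrM mulnb.
    under eq_fun do rewrite dphi /prodfun /dal.
    by apply: cvgM; [apply: cvgB|]; exact: bump_cvg.
have Uu : (mu U <= (2 * s ^+ 2)%:E)%E.
  have H : (mu U <= mu (sset Q) + mu (sset Q'))%E by exact: measureU2.
  apply: (le_trans H); rewrite (leb2_sset (ltW s0 : 0 <= sqs Q)) leb2_sset sQ' ?(ltW s0)//.
  by rewrite -EFinD lee_fin -/s; lra.
have u0 : 0 < 2 * s ^+ 2 by rewrite mulr_gt0// exprn_gt0.
have := @weak_gradient_cvg R i f g phi U (sset Q) (sset Q') s (2 * s ^+ 2) d
  mf wg s0 u0 d0 mU mQ mQ' (@subsetUl _ _ _) (@subsetUr _ _ _) Uu iU gd tphi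
  _ _ bphi bdphi cdphi.
have H1 n : measurable_fun setT (phi n).
  by apply: measurable_prodfun; [exact: (Ck_cont (Cal n 0%N))|exact: (Ck_cont (Cbe n 0%N))].
have H2 n : measurable_fun setT (partial i (phi n) : plane -> R).
  rewrite dphi; apply: measurable_prodfun; last exact: (Ck_cont (Cbe n 0%N)).
  have -> : dal n = fun t => bumpf n.+1%:R^-1 s (t - a) - bumpf n.+1%:R^-1 s (t - (a + s)).
    by apply/funext => t; rewrite /dal opprD addrA.
  move=> t; apply: cvgB.
    exact: (Ck_cont (CA _ a 0%N (fun m => Ck_bump s m (c0 n)))).
  exact: (Ck_cont (CA _ (a + s) 0%N (fun m => Ck_bump s m (c0 n)))).
move=> /(_ H1 H2) H.
rewrite /avg sQ' -/s -mulrBr exprMn.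
rewrite exprVn ler_pdivrMl ?exprn_gt0// -exprM.
apply: (le_trans H); rewrite -/s.
suff -> : s ^+ 2 * (2 * s ^+ 2 * d) = s ^+ 4 * (2 * d) by [].
by ring.
Qed.

End Adjacent.

(** * The dyadic tree of a square *)

Section Tree.
Context {R : realType}.
Local Notation plane := (measurableTypeR R * measurableTypeR R)%type.
Local Notation mu := (@leb2 R).
Local Notation square := (@square R).

Implicit Types (Q : square) (k : bool * bool).

Definition child Q k : square :=
  Sq (sqx Q + k.1%:R * (sqs Q / 2)) (sqy Q + k.2%:R * (sqs Q / 2)) (sqs Q / 2).

Definition kids : seq (bool * bool) :=
  [:: (false, false); (true, false); (false, true); (true, true)].

Definition which Q (x : plane) : bool * bool :=
  (sqx Q + sqs Q / 2 <= x.1, sqy Q + sqs Q / 2 <= x.2).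

Lemma mem_child Q k x : sset (child Q k) x = (sset Q x /\ which Q x = k) :> Prop.
Proof.
apply/propext; case: k => [[] []]; rewrite /sset /which /child /= ?mul1r ?mul0r ?addr0;
 (split => [/andP[/andP[? ?] /andP[? ?]]|[/andP[/andP[? ?] /andP[? ?]] [+ +]]]).
- split; first by apply/andP; split; apply/andP; split; lra.
  by congr pair; apply/idP; lra.
- by move=> /idP ? /idP ?; apply/andP; split; apply/andP; split; lra.
- split; first by apply/andP; split; apply/andP; split; lra.
  by congr pair; [apply/idP|apply/negbTE; rewrite -ltNge]; lra.
- by move=> /idP ? /negbT; rewrite -ltNge => ?; apply/andP; split; apply/andP; split; lra.
- split; first by apply/andP; split; apply/andP; split; lra.
  by congr pair; [apply/negbTE; rewrite -ltNge|apply/idP]; lra.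
- by move=> /negbT; rewrite -ltNge => ? /idP ?; apply/andP; split; apply/andP; split; lra.
- split; first by apply/andP; split; apply/andP; split; lra.
  by congr pair; apply/negbTE; rewrite -ltNge; lra.
- by move=> /negbT + /negbT; rewrite -!ltNge => ? ?; apply/andP; split; apply/andP; split; lra.
Qed.

Lemma child_sub Q k : sset (child Q k) `<=` sset Q.
Proof. by move=> x; rewrite mem_child => -[]. Qed.

Lemma sset_kids Q : sset Q = \big[setU/set0]_(k <- kids) sset (child Q k).
Proof.
rewrite /kids !big_cons big_nil setU0.
apply/seteqP; split => x; last by move=> [|[|[|]]]; exact: child_sub.
move=> Qx; rewrite /setU /= !mem_child.
by case E : (which Q x) => [[] []]; tauto.
Qed.

Lemma trivIset_kids Q : trivIset [set` kids] (fun k => sset (child Q k)).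
Proof.
by move=> j k _ _ [x []]; rewrite !mem_child => -[_ <-] [_ <-].
Qed.

Lemma integral_kids Q (h : plane -> R) : measurable_fun setT h ->
  (\int[mu]_(x in sset Q) (h x)%:E =
   \sum_(k <- kids) \int[mu]_(x in sset (child Q k)) (h x)%:E)%E.
Proof.
move=> mh; rewrite {1}sset_kids.
apply: (@integral_bigsetU_EFin _ _ _ mu _ (fun k => sset (child Q k))) => //.
- by move=> k; exact: measurable_sset.
- exact: trivIset_kids.
by apply/measurable_EFinP; exact: (@measurable_funS _ _ _ _ setT).
Qed.

Lemma Rintegral_kids Q (h : plane -> R) : measurable_fun setT h ->
  mu.-integrable (sset Q) (EFin \o h) ->
  \int[mu]_(x in sset Q) h x = \sum_(k <- kids) \int[mu]_(x in sset (child Q k)) h x.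
Proof.
move=> mh ih; rewrite /Rintegral integral_kids// sum_fine// => k _.
apply: integrable_fin_num; first exact: measurable_sset.
by apply: integrableS ih; [exact: measurable_sset|exact: measurable_sset|exact: child_sub].
Qed.

(** Value of [Phi] at the descendant of [Q] of generation [n] that contains
    [x]. The recursion goes through the child of [x], so that an induction on
    [n] follows the tree from its root. *)
Fixpoint tr (T : Type) (Phi : square -> T) n Q (x : plane) : T :=
  if n is m.+1 then tr Phi m (child Q (which Q x)) x else Phi Q.

Lemma trS T (Phi : square -> T) n Q k x : sset (child Q k) x ->
  tr Phi n.+1 Q x = tr Phi n (child Q k) x.
Proof. by rewrite mem_child => -[_ /= ->]. Qed.

Lemma measurable_tr (Phi : square -> R) n Q : measurable_fun setT (tr Phi n Q).
Proof.
elim: n Q => [|n IH] Q /=; first exact: measurable_cst.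
have -> : (fun x => tr Phi n (child Q (which Q x)) x) =
  (fun x => if (which Q x).1 then if (which Q x).2 then tr Phi n (child Q (true, true)) x
      else tr Phi n (child Q (true, false)) x
    else if (which Q x).2 then tr Phi n (child Q (false, true)) x
      else tr Phi n (child Q (false, false)) x).
  by apply/funext => x; case: (which Q x) => [[] []].
have m1 : measurable_fun setT (fun x : plane => (which Q x).1).
  by apply: measurable_fun_ler => //; exact: measurable_fst.
have m2 : measurable_fun setT (fun x : plane => (which Q x).2).
  by apply: measurable_fun_ler => //; exact: measurable_snd.
by apply: measurable_fun_ifT => //; apply: measurable_fun_ifT.
Qed.

Lemma tr_bounded (Phi : square -> R) n Q : exists M, forall x, `|tr Phi n Q x| <= M.
Proof.
elim: n Q => [|n IH] Q /=; first by exists `|Phi Q|.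
have /choice[M HM] := fun k => IH (child Q k).
exists (\sum_(k <- kids) `|M k|) => x.
apply: (le_trans (HM _ x)); rewrite (le_trans (ler_norm _))//.
rewrite (perm_big (which Q x :: rem (which Q x) kids))/=; last first.
  by apply: perm_to_rem; case: (which Q x) => [[] []].
by rewrite big_cons lerDl sumr_ge0.
Qed.

Lemma integrable_tr (Phi : square -> R) n Q Q' : 0 <= sqs Q' ->
  mu.-integrable (sset Q') (EFin \o tr Phi n Q).
Proof.
move=> s0; apply: measurable_bounded_integrable.
- exact: measurable_sset.
- by rewrite leb2_sset// ltry.
- by apply: (@measurable_funS _ _ _ _ setT) => //; exact: measurable_tr.
have [M HM] := tr_bounded Phi n Q; exists `|M|; split; first exact: num_real.
move=> y My x _; apply: (le_trans (HM x)); apply: (le_trans (ler_norm M)).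
exact: ltW.
Qed.

End Tree.

(** * Functions seen through their averages *)

Section SobolevPair.
Context {R : realType}.
Local Notation plane := (measurableTypeR R * measurableTypeR R)%type.
Local Notation mu := (@leb2 R).
Local Notation square := (@square R).

Implicit Types (Q : square) (k : bool * bool).

Definition mass (G : plane -> R) Q : R := \int[mu]_(x in sset Q) G x.

(** All that is used of [f] and of the density [G] of its Dirichlet integral.
    With the inequality on adjacent squares as the only link between them, the
    gradient can be forgotten. *)
Record sobolev_pair (f G : plane -> R) : Prop := SobolevPair {
  sp_mf : measurable_fun setT f ;
  sp_if : forall Q, 0 <= sqs Q -> mu.-integrable (sset Q) (EFin \o f) ;
  sp_f2 : forall Q, 0 <= sqs Q -> (\int[mu]_(x in sset Q) (f x ^+ 2)%:E < +oo)%E ;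
  sp_mG : measurable_fun setT G ;
  sp_G0 : forall x, 0 <= G x ;
  sp_iG : mu.-integrable setT (EFin \o G) ;
  sp_adj : forall i Q, 0 < sqs Q ->
    (avg f Q - avg f (shiftq i Q)) ^+ 2 <= 2 * (mass G Q + mass G (shiftq i Q)) }.

Lemma form_domain_sobolev_pair V (f : plane -> R) :
  form_domain V setT f ->
  sobolev_pair f (fun x => \sum_(i < 2) gradient setT f i x ^+ 2).
Proof.
move=> [fL fw fD _].
have wg : is_weak_gradient setT f (gradient setT f).
  by apply: xgetPex; exact: fw.
set G := fun _ => _.
have mG : measurable_fun setT (G : plane -> R).
  by apply: measurable_sum => i; apply: measurable_funX; have [[]] := wg i.
have G0 x : 0 <= G x by rewrite sumr_ge0// => i _; rewrite sqr_ge0.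
have iG : mu.-integrable setT (EFin \o (G : plane -> R)).
  apply/integrableP; split; first exact/measurable_EFinP.
  by under eq_integral do rewrite gee0_abs ?lee_fin ?G0//.
split => //.
- by case: fL.
- by move=> Q s0; have [] := sset_L2loc fL s0.
- by move=> Q s0; have [] := sset_L2loc fL s0.
move=> i Q s0; apply: adjacent_avg => //.
have mQ := measurable_sset Q; have mQ' := measurable_sset (shiftq i Q).
rewrite ge0_integral_setU//; last 3 first.
- by apply/measurable_EFinP; apply: (@measurable_funS _ _ _ _ setT) => //; exact: measurableU.
- by move=> x _; rewrite lee_fin; exact: G0.
- apply/disj_setPS => x []; rewrite /sset /shiftq /=.
  by case: (i == 0) => /= /andP[/andP[? a1] /andP[? a2]] /andP[/andP[b1 ?] /andP[b2 ?]];
    [move: (le_lt_trans b1 a1)|move: (le_lt_trans b2 a2)]; rewrite ltxx.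
rewrite EFinD /mass /Rintegral !fineK//.
  exact: integrable_fin_num (integrableS _ mQ' (@subsetT _ _) iG).
exact: integrable_fin_num (integrableS _ mQ (@subsetT _ _) iG).
Qed.

Section Pair.
Context (f G : plane -> R) (fG : sobolev_pair f G).

Let mf := sp_mf fG.
Let mG := sp_mG fG.

Lemma mass_ge0 Q : 0 <= mass G Q.
Proof. by apply: Rintegral_ge0 => x _; exact: (sp_G0 fG). Qed.

Lemma integrable_mass Q : mu.-integrable (sset Q) (EFin \o G).
Proof. exact: (integrableS measurableT (measurable_sset Q) (@subsetT _ _) (sp_iG fG)). Qed.

Lemma mass_kids Q : mass G Q = \sum_(k <- kids) mass G (child Q k).
Proof. by apply: Rintegral_kids => //; exact: integrable_mass. Qed.

Lemma avg_kids Q : 0 < sqs Q -> avg f Q = (\sum_(k <- kids) avg f (child Q k)) / 4.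
Proof.
move=> s0; rewrite /avg Rintegral_kids//; last exact/(sp_if fG)/ltW.
rewrite /child /= -big_distrr /=; set S := \sum_(k <- _) _.
by field; rewrite gt_eqF.
Qed.

(** The average over [Q] is the mean of the averages over its children; its
    difference with one of them is a combination of three differences of
    adjacent children. *)
Lemma child_avg Q k : 0 < sqs Q ->
  (avg f (child Q k) - avg f Q) ^+ 2 <= 8 * mass G Q.
Proof.
move=> s0; rewrite (avg_kids s0).
have s20 : 0 < sqs Q / 2 by rewrite divr_gt0.
have adj i c : (avg f (child Q c) - avg f (shiftq i (child Q c))) ^+ 2 <=
   2 * (mass G (child Q c) + mass G (shiftq i (child Q c))) by exact: (sp_adj fG).
have := mass_kids Q; rewrite /kids !big_cons !big_nil !addr0.
have sh1 c : shiftq 0 (child Q (false, c)) = child Q (true, c).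
  by rewrite /shiftq /child /= mul0r mul1r addr0.
have sh2 c : shiftq 1 (child Q (c, false)) = child Q (c, true).
  by rewrite /shiftq /child /= mul0r mul1r addr0.
have := adj 0 (false, false); have := adj 0 (false, true).
have := adj 1 (false, false); have := adj 1 (true, false).
rewrite !sh1 !sh2.
have := mass_ge0 (child Q (false, false)); have := mass_ge0 (child Q (false, true)).
have := mass_ge0 (child Q (true, false)); have := mass_ge0 (child Q (true, true)).
set d00 := mass G (child Q (false, false)); set d01 := mass G (child Q (false, true)).
set d10 := mass G (child Q (true, false)); set d11 := mass G (child Q (true, true)).
set a00 := avg f (child Q (false, false)); set a01 := avg f (child Q (false, true)).
set a10 := avg f (child Q (true, false)); set a11 := avg f (child Q (true, true)).
move=> p1 p2 p3 p4 h1 h2 h3 h4 ->.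
have -> : avg f (child Q k) = if k.1 then (if k.2 then a11 else a10) else if k.2 then a01 else a00.
  by case: k => [[] []].
set D := d00 + (d10 + (d01 + d11)).
have DE : D = d00 + (d10 + (d01 + d11)) by [].
have [g1 g2 g3 g4] : [/\ (a10 - a11) ^+ 2 <= 2 * D, (a00 - a01) ^+ 2 <= 2 * D,
  (a01 - a11) ^+ 2 <= 2 * D & (a00 - a10) ^+ 2 <= 2 * D] by split; lra.
(* Cauchy-Schwarz on the three differences; [4 / 3] bounds the squared norm of
   the coefficients for each of the four children, and [6 D] the sum of the
   squares. *)
have sq (x y z al be ga : R) : x ^+ 2 <= 2 * D -> y ^+ 2 <= 2 * D -> z ^+ 2 <= 2 * D ->
  al ^+ 2 + be ^+ 2 + ga ^+ 2 <= 4 / 3 -> (al * x + be * y + ga * z) ^+ 2 <= 8 * D.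
  move=> hx hy hz hc.
  have D0 : 0 <= D by lra.
  have c1 : (al * x + be * y + ga * z) ^+ 2 <=
     (al ^+ 2 + be ^+ 2 + ga ^+ 2) * (x ^+ 2 + y ^+ 2 + z ^+ 2).
    have := sqr_ge0 (al * y - be * x); have := sqr_ge0 (al * z - ga * x).
    by have := sqr_ge0 (be * z - ga * y); lra.
  apply: (le_trans c1).
  have -> : 8 * D = (4 / 3) * (6 * D) by field.
  by apply: ler_pM => //; [rewrite !addr_ge0 ?sqr_ge0|rewrite !addr_ge0 ?sqr_ge0|lra].
case: k => [[] []] /=.
- suff -> : a11 - (a00 + (a10 + (a01 + a11))) / 4 =
    - 2 / 4 * (a10 - a11) + - 1 / 4 * (a01 - a11) + - 1 / 4 * (a00 - a10).
    by apply: sq => //; lra.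
  by field.
- suff -> : a10 - (a00 + (a10 + (a01 + a11))) / 4 =
    2 / 4 * (a10 - a11) + - 1 / 4 * (a01 - a11) + - 1 / 4 * (a00 - a10).
    by apply: sq => //; lra.
  by field.
- suff -> : a01 - (a00 + (a10 + (a01 + a11))) / 4 =
    - 2 / 4 * (a10 - a11) + 3 / 4 * (a01 - a11) + - 1 / 4 * (a00 - a10).
    by apply: sq => //; lra.
  by field.
- suff -> : a00 - (a00 + (a10 + (a01 + a11))) / 4 =
    2 / 4 * (a10 - a11) + - 1 / 4 * (a01 - a11) + 3 / 4 * (a00 - a10).
    by apply: sq => //; lra.
  by field.
Qed.

End Pair.
End SobolevPair.

(** * A weighted bound along the dyadic tree *)

Section TreeBound.
Context {R : realType}.
Local Notation plane := (measurableTypeR R * measurableTypeR R)%type.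
Local Notation mu := (@leb2 R).
Local Notation square := (@square R).

Implicit Types (Q : square) (k : bool * bool).

(** The square root of the factor by which [s^b] decreases when the side is
    halved. In an induction along the tree half of this gain pays for
    splitting the square of a sum, and the other half makes the constants
    summable. *)
Definition ratio (b : R) : R := 2^-1 `^ (b / 2).
(** The fixed point of the recursion [K = ratio b * K + 8 / (1 - ratio b)] met
    in the induction of [tree_bound]. *)
Definition Ktree (b : R) : R := 8 / (1 - ratio b) ^+ 2.

Lemma ratio_gt0 b : 0 < ratio b. Proof. by rewrite powR_gt0// invr_gt0. Qed.

Lemma ratio_lt1 b : 0 < b -> ratio b < 1.
Proof.
move=> b0; rewrite /ratio; have b20 : 0 < b / 2 by rewrite divr_gt0.
have h : (2^-1 : R) < 1 by lra.
have := @gt0_ltr_powR R (b / 2) b20 2^-1 1.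
by rewrite powR1; apply => //; rewrite nnegrE.
Qed.

Lemma powR_half (s b : R) : 0 < s -> (s / 2) `^ b = s `^ b * ratio b ^+ 2.
Proof.
move=> s0; rewrite powRM ?(ltW s0)// /ratio -powR_mulrn ?powR_ge0// -powRrM.
by congr (_ * _ `^ _); field.
Qed.

Lemma Ktree_gt0 b : 0 < b -> 0 < Ktree b.
Proof. by move=> /ratio_lt1 h; rewrite divr_gt0// exprn_gt0// subr_gt0. Qed.

Section Pair.
Context (f G : plane -> R) (fG : sobolev_pair f G).
Local Notation avg := (avg f).
Local Notation mass := (mass G).

Lemma sqr_split_le (x y q : R) : 0 < q -> q < 1 ->
  (x + y) ^+ 2 <= q^-1 * x ^+ 2 + (1 - q)^-1 * y ^+ 2.
Proof.
move=> q0 q1; have q10 : 0 < 1 - q by rewrite subr_gt0.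
have : 0 <= ((1 - q) * x - q * y) ^+ 2 / (q * (1 - q)).
  by rewrite divr_ge0 ?sqr_ge0// mulr_ge0// ltW.
have -> : ((1 - q) * x - q * y) ^+ 2 / (q * (1 - q)) =
  q^-1 * x ^+ 2 + (1 - q)^-1 * y ^+ 2 - (x + y) ^+ 2.
  by field; rewrite !gt_eqF.
by rewrite subr_ge0.
Qed.

(** On a child [k] write [e - avg Q] as [(e - avg k) + (avg k - avg Q)], where
    [e] is the dyadic average. The first part is the induction hypothesis on
    the child, the second is at most [8 mass Q] and is multiplied by the
    integral of [V] over the child. The splitting costs a factor [1 / ratio b]
    on the first part, and [s^b] has gained [ratio b ^ 2]. *)
Lemma tree_bound (V : plane -> R) (b T : R) n Q :
  measurable_fun setT V -> (forall x, 0 <= V x) -> 0 < b -> 0 <= T -> 0 < sqs Q ->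
  (forall Q', sset Q' `<=` sset Q -> 0 < sqs Q' ->
    (\int[mu]_(x in sset Q') (V x)%:E <= (T * sqs Q' `^ b)%:E)%E) ->
  (\int[mu]_(x in sset Q) (V x * (tr avg n Q x - avg Q) ^+ 2)%:E <=
    (Ktree b * T * sqs Q `^ b * mass Q)%:E)%E.
Proof.
move=> mV V0 b0 T0.
have q0 := ratio_gt0 b; have q1 := ratio_lt1 b0; set q := ratio b in q0 q1 *.
have K0 := Ktree_gt0 b0.
elim: n Q => [|n IH] Q s0 HV.
  have -> : (\int[mu]_(x in sset Q) (V x * (tr avg 0 Q x - avg Q) ^+ 2)%:E = 0)%E.
    by apply: integral0_eq => x _; rewrite /= subrr expr0n mulr0.
  rewrite lee_fin; apply: mulr_ge0; last exact: (mass_ge0 fG).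
  by apply: mulr_ge0; [apply: mulr_ge0 => //; exact: ltW|exact: powR_ge0].
have mtr m Q' : measurable_fun setT (tr avg m Q') by exact: measurable_tr.
have mh m Q' (c : R) : measurable_fun setT (fun x => V x * (tr avg m Q' x - c) ^+ 2).
  by apply: measurable_funM => //; apply: measurable_funX; apply: measurable_funB.
rewrite integral_kids//.
have s20 : 0 < sqs Q / 2 by rewrite divr_gt0.
have sub k : sset (child Q k) `<=` sset Q by exact: child_sub.
have vfin k : (\int[mu]_(x in sset (child Q k)) (V x)%:E)%E \is a fin_num.
  rewrite ge0_fin_numE; last by apply: integral_ge0 => x _; rewrite lee_fin.
  by apply: (le_lt_trans (HV _ (sub k) s20)); rewrite ltry.
pose v k : R := \int[mu]_(x in sset (child Q k)) V x.
have vE k : (\int[mu]_(x in sset (child Q k)) (V x)%:E)%E = (v k)%:E.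
  by rewrite /v /Rintegral fineK.
have vsum : \sum_(k <- kids) v k <= T * sqs Q `^ b.
  have := HV Q (@subset_refl _ _) s0; rewrite integral_kids//.
  by rewrite (eq_bigr (fun k => (v k)%:E)) ?sumEFin ?lee_fin// => k _.
have kid k : (\int[mu]_(x in sset (child Q k)) (V x * (tr avg n.+1 Q x - avg Q) ^+ 2)%:E
  <= (q^-1 * (Ktree b * T * (sqs Q / 2) `^ b * mass (child Q k)) +
      (1 - q)^-1 * (8 * mass Q) * v k)%:E)%E.
  have mc := measurable_sset (child Q k).
  have mV' : measurable_fun (sset (child Q k)) (fun x => (V x)%:E).
    by apply: measurable_EFin_sset.
  have mh' : measurable_fun (sset (child Q k))
     (fun x => (V x * (tr avg n (child Q k) x - avg (child Q k)) ^+ 2)%:E).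
    by apply: measurable_EFin_sset.
  have q1' : 0 < 1 - q by rewrite subr_gt0.
  have c0 : 0 <= (1 - q)^-1 * (8 * mass Q).
    by rewrite !mulr_ge0 ?(mass_ge0 fG)// invr_ge0 ltW.
  apply: (@le_trans _ _ (\int[mu]_(x in sset (child Q k))
     (q^-1%:E * (V x * (tr avg n (child Q k) x - avg (child Q k)) ^+ 2)%:E +
      ((1 - q)^-1 * (8 * mass Q))%:E * (V x)%:E))%E).
    apply: ge0_le_integral => //.
    - by move=> x _; rewrite lee_fin mulr_ge0// sqr_ge0.
    - by apply: measurable_EFin_sset.
    - by apply: emeasurable_funD; exact: measurable_funeM.
    - move=> x xc; rewrite -!EFinM -EFinD lee_fin (trS _ _ xc).
      set e := tr _ _ _ _.
      have E : e - avg Q = (e - avg (child Q k)) + (avg (child Q k) - avg Q) by ring.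
      have h1 := sqr_split_le (e - avg (child Q k)) (avg (child Q k) - avg Q) q0 q1.
      have h2 : (1 - q)^-1 * (avg (child Q k) - avg Q) ^+ 2 <= (1 - q)^-1 * (8 * mass Q).
        by rewrite ler_wpM2l ?invr_ge0 ?(ltW q1')//; exact: (child_avg fG).
      rewrite E.
      have h3 := le_trans h1 (lerD (lexx _) h2).
      have := ler_wpM2l (V0 x) h3; lra.
  have q0' : 0 <= q^-1 by rewrite invr_ge0 ltW.
  rewrite ge0_integralD//; last first.
  - exact: measurable_funeM.
  - by move=> x _; rewrite -EFinM lee_fin mulr_ge0.
  - exact: measurable_funeM.
  - move=> x _; rewrite -EFinM lee_fin; apply: mulr_ge0 => //.
    by apply: mulr_ge0 => //; exact: sqr_ge0.
  rewrite !ge0_integralZl//; last 2 first.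
  - by move=> x _; rewrite lee_fin.
  - by move=> x _; rewrite lee_fin mulr_ge0 ?sqr_ge0.
  rewrite vE -EFinM EFinD; apply: leeD => //.
  rewrite EFinM; apply: lee_pmul => //.
    by apply: integral_ge0 => x _; rewrite lee_fin mulr_ge0 ?sqr_ge0.
  by apply: IH => // Q' sQ' sQ'0; apply: HV => //; exact: subset_trans sQ' (sub k).
apply: (le_trans (lee_sum _ (fun k _ => kid k))).
rewrite sumEFin lee_fin big_split /= -!big_distrr /= -(mass_kids fG).
rewrite powR_half//.
set S := \sum_(i <- kids) _ in vsum *; set m := mass Q; set P := sqs Q `^ b in vsum *.
have m0 : 0 <= m by exact: (mass_ge0 fG).
have h : (1 - q)^-1 * (8 * m) * S <= (1 - q)^-1 * (8 * m) * (T * P).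
  by rewrite ler_wpM2l// !mulr_ge0// invr_ge0 subr_ge0 ltW.
apply: (le_trans (lerD (lexx _) h)).
rewrite /Ktree -/q le_eqVlt; apply/orP; left; apply/eqP.
by field; rewrite !gt_eqF// subr_gt0.
Qed.

End Pair.
End TreeBound.

(** * Dyadic averages as projections *)

Section DyadicAverages.
Context {R : realType}.
Local Notation plane := (measurableTypeR R * measurableTypeR R)%type.
Local Notation mu := (@leb2 R).
Local Notation square := (@square R).
Implicit Types (Q : square) (k : bool * bool).

Lemma trE T (Phi : square -> T) n Q x : tr Phi n Q x = Phi (tr id n Q x).
Proof. by elim: n Q => [|n IH] Q //=. Qed.

Lemma tr_id_mem n Q x : sset Q x -> sset (tr id n Q x) x.
Proof. by elim: n Q => [|n IH] Q //= Qx; apply: IH; rewrite mem_child. Qed.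

Lemma tr_id_side n Q x : sqs (tr id n Q x) = sqs Q / 2 ^+ n.
Proof.
elim: n Q => [|n IH] Q /=; first by rewrite expr0 divr1.
by rewrite IH /= exprS invfM mulrA.
Qed.

Section Pair.
Context (f G : plane -> R) (fG : sobolev_pair f G).
Local Notation avg := (avg f).
Local Notation mass := (mass G).

Let mf := sp_mf fG.

Lemma integrable_trM Q Q' (Phi : square -> R) n (h : plane -> R) : 0 <= sqs Q' ->
  mu.-integrable (sset Q') (EFin \o h) ->
  mu.-integrable (sset Q') (EFin \o (fun x => tr Phi n Q x * h x)).
Proof.
move=> s0 ih.
have [M HM] := tr_bounded Phi n Q.
have mQ := measurable_sset Q'.
have mt : measurable_fun (sset Q') (tr Phi n Q).
  by apply: (@measurable_funS _ _ _ _ setT) => //; exact: measurable_tr.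
have bt : [bounded tr Phi n Q x | x in sset Q'].
  exists `|M|; split; first exact: num_real.
  by move=> y My x _; apply: (le_trans (HM x)); apply: (le_trans (ler_norm M)); exact: ltW.
exact: (integrableMr mQ mt bt ih).
Qed.

Lemma integral_tr_avg n Q : 0 < sqs Q ->
  \int[mu]_(x in sset Q) tr avg n Q x = \int[mu]_(x in sset Q) f x.
Proof.
elim: n Q => [|n IH] Q s0.
  rewrite /= Rintegral_cst; last exact: measurable_sset.
  rewrite leb2_sset ?ltW//= /avg mulrAC mulVf ?mul1r//.
  by rewrite expf_neq0// gt_eqF.
rewrite !Rintegral_kids//.
- apply: eq_bigr => k _; rewrite -(IH (child Q k)) ?divr_gt0//.
  by apply: eq_Rintegral => x /set_mem xk; rewrite (trS _ _ xk).
- exact/(sp_if fG)/ltW.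
- exact: measurable_tr.
- exact/integrable_tr/ltW.
Qed.

(** The dyadic average is the orthogonal projection onto functions constant on
    the squares of generation [n]. *)
Lemma integral_trM (Phi : square -> R) n Q : 0 < sqs Q ->
  \int[mu]_(x in sset Q) (tr Phi n Q x * f x) =
  \int[mu]_(x in sset Q) (tr Phi n Q x * tr avg n Q x).
Proof.
elim: n Q => [|n IH] Q s0.
  change (\int[mu]_(x in sset Q) (Phi Q * f x) =
    \int[mu]_(x in sset Q) (Phi Q * tr avg 0 Q x)).
  have mQ := measurable_sset Q.
  rewrite (RintegralZl _ mQ (sp_if fG (ltW s0))).
  rewrite (RintegralZl _ mQ (integrable_tr avg 0 Q (ltW s0))).
  by rewrite (integral_tr_avg 0 s0).
rewrite !Rintegral_kids//.
- apply: eq_bigr => k _.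
  transitivity (\int[mu]_(x in sset (child Q k)) (tr Phi n (child Q k) x * f x)).
    by apply: eq_Rintegral => x /set_mem xk; rewrite (trS _ _ xk).
  rewrite IH ?divr_gt0//.
  by apply: eq_Rintegral => x /set_mem xk; rewrite !(trS _ _ xk).
- by apply: measurable_funM => //; exact: measurable_tr.
- exact: (@integrable_trM Q Q Phi n.+1 (tr avg n.+1 Q) (ltW s0) (integrable_tr avg n.+1 Q (ltW s0))).
- by apply: measurable_funM => //; exact: measurable_tr.
- exact: (@integrable_trM Q Q Phi n.+1 f (ltW s0) (sp_if fG (ltW s0))).
Qed.

Lemma tr_avg_L2 n Q : 0 < sqs Q ->
  (\int[mu]_(x in sset Q) ((tr avg n Q x - avg Q) ^+ 2)%:E <=
    (Ktree 2 * sqs Q ^+ 2 * mass Q)%:E)%E.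
Proof.
move=> s0.
have := @tree_bound R f G fG (cst 1) 2 1 n Q.
move=> /(_ (measurable_cst _) (fun _ => ler01) (ltr0n _ 2) ler01 s0).
rewrite mulr1 powR_mulrn ?(ltW s0)// => H.
rewrite (eq_integral (fun x => (1 * (tr avg n Q x - avg Q) ^+ 2)%:E)) => [|x _]; last first.
  by rewrite mul1r.
apply: H => Q' _ s'0; rewrite (eq_integral (cst 1%:E))// integral_cst; last first.
  exact: measurable_sset.
by rewrite mul1e leb2_sset ?(ltW s'0)// mul1r powR_mulrn// ltW.
Qed.

Lemma tr_avg_L2_diff n m Q : 0 < sqs Q ->
  (\int[mu]_(x in sset Q) ((tr avg (n + m) Q x - tr avg n Q x) ^+ 2)%:E <=
    (Ktree 2 * (sqs Q / 2 ^+ n) ^+ 2 * mass Q)%:E)%E.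
Proof.
elim: n Q => [|n IH] Q s0.
  by rewrite add0n expr0 divr1; exact: tr_avg_L2.
rewrite addSn integral_kids//; last first.
  by apply: measurable_funX; apply: measurable_funB; exact: measurable_tr.
apply: (@le_trans _ _ (\sum_(k <- kids)
    (Ktree 2 * (sqs (child Q k) / 2 ^+ n) ^+ 2 * mass (child Q k))%:E)%E).
  apply: lee_sum => k _; apply: le_trans (IH (child Q k) _); last by rewrite divr_gt0.
  rewrite le_eqVlt; apply/orP; left; apply/eqP.
  by apply: eq_integral => x /set_mem xk; rewrite !(trS _ _ xk).
rewrite sumEFin lee_fin (mass_kids fG) big_distrr /=.
by rewrite le_eqVlt [2 ^+ n.+1]exprS [(2 * _)^-1]invfM [_ * (2^-1 * _)]mulrA eqxx.
Qed.

(** Uniform square integrability of the residuals: it makes their integrals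
    over small sets uniformly small. *)
Lemma tr_avg_residual Q : 0 < sqs Q -> exists2 K : R, 0 < K &
  forall n, (\int[mu]_(x in sset Q) ((f x - tr avg n Q x) ^+ 2)%:E <= K%:E)%E.
Proof.
move=> s0; have mQ := measurable_sset Q.
have mT n : measurable_fun setT (tr avg n Q) by exact: measurable_tr.
have mS := @measurable_EFin_sset R Q.
have i2 := sp_f2 fG (ltW s0).
have fin : (\int[mu]_(x in sset Q) (f x ^+ 2)%:E)%E \is a fin_num.
  by rewrite ge0_fin_numE// integral_ge0// => x _; rewrite lee_fin sqr_ge0.
pose F := fine (\int[mu]_(x in sset Q) (f x ^+ 2)%:E)%E.
have F0 : 0 <= F by rewrite fine_ge0// integral_ge0// => x _; rewrite lee_fin sqr_ge0.
pose E := Ktree 2 * sqs Q ^+ 2 * mass Q.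
have E0 : 0 <= E.
  apply: mulr_ge0; last exact: (mass_ge0 fG).
  by apply: mulr_ge0; [apply/ltW/Ktree_gt0|exact: sqr_ge0].
pose A := avg Q ^+ 2 * sqs Q ^+ 2.
have A0 : 0 <= A by rewrite mulr_ge0 ?sqr_ge0.
(* Write the residual as [f - (e - a) - a], with [e] the dyadic average and
   [a] the average over [Q]; the integrals of the three squares are at most
   [F], [E] and [A], and the added [1] only ensures positivity. *)
exists (1 + (3 * F + (3 * E + 3 * A))) => [|n].
  by move: F0 E0 A0; clear; move: F E A => F E A; lra.
apply: (@le_trans _ _ (\int[mu]_(x in sset Q) (3%:E * (f x ^+ 2)%:E +
   (3%:E * ((tr avg n Q x - avg Q) ^+ 2)%:E + 3%:E * (avg Q ^+ 2)%:E)))%E).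
  apply: ge0_le_integral => //.
  - by move=> x _; rewrite lee_fin sqr_ge0.
  - by apply: mS; apply: measurable_funX; apply: measurable_funB.
  - apply: emeasurable_funD.
      by apply: measurable_funeM; apply: mS; exact: measurable_funX.
    apply: emeasurable_funD; last exact: measurable_cst.
    by apply: measurable_funeM; apply: mS; apply: measurable_funX; apply: measurable_funB.
  - move=> x _; rewrite -!EFinM -!EFinD lee_fin.
    set e := tr _ _ _ _; set a := avg Q.
    have := sqr_ge0 (f x + (e - a)); have := sqr_ge0 (f x + a).
    have := sqr_ge0 (e - a - a); lra.
have n3 (y : R) : (0 <= 3%:E * (y ^+ 2)%:E)%E by rewrite mule_ge0// lee_fin sqr_ge0.
have me : measurable_fun (sset Q) (fun x => (3%:E * ((tr avg n Q x - avg Q) ^+ 2)%:E)%E).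
  by apply: measurable_funeM; apply: mS; apply: measurable_funX; apply: measurable_funB.
rewrite ge0_integralD//; last first.
- by apply: emeasurable_funD.
- by move=> x _; apply: adde_ge0; exact: n3.
- by apply: measurable_funeM; apply: mS; exact: measurable_funX.
rewrite ge0_integralD//.
rewrite integral_cst// leb2_sset ?(ltW s0)//.
rewrite !ge0_integralZl//; last first.
- by move=> x _; rewrite lee_fin sqr_ge0.
- by apply: mS; exact: measurable_funX.
- by move=> x _; rewrite lee_fin sqr_ge0.
- by apply: mS; apply: measurable_funX; apply: measurable_funB.
rewrite -(fineK fin) -/F -!EFinM.
apply: (@le_trans _ _ ((3 * F)%:E + (3%:E * E%:E + (3 * A)%:E))%E).
  apply: leeD => //; apply: leeD; last by rewrite lee_fin /A; lra.
  apply: lee_pmul => //; first by apply: integral_ge0 => x _; rewrite lee_fin sqr_ge0.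
  exact: tr_avg_L2.
by rewrite -EFinM -!EFinD lee_fin; lra.
Qed.

End Pair.
End DyadicAverages.

(** * Almost everywhere convergence of dyadic averages *)

Section Quadrants.
Context {R : realType}.
Local Notation plane := (measurableTypeR R * measurableTypeR R)%type.

(** An intersection-stable family that generates the Borel sets and whose
    members are, up to a thin set, unions of dyadic squares. *)
Definition quadrant (al be : R) : set plane := [set x | (x.1 < al) && (x.2 < be)].

Definition quadrants : set (set plane) := [set A | exists al be, A = quadrant al be].

Lemma quadrants_setI : setI_closed quadrants.
Proof.
move=> A B [a [b ->]] [c [d ->]]; exists (Num.min a c), (Num.min b d).
apply/seteqP; split => x; rewrite /quadrant /= !lt_min.
  by move=> [/andP[-> ->] /andP[-> ->]].
by move=> /andP[/andP[-> ->] /andP[-> ->]].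
Qed.

Lemma measurable_sub_quadrants : (measurable : set (set plane)) `<=` <<s quadrants >>.
Proof.
rewrite measurable_prod_measurableType.
apply: smallest_sub; first exact: smallest_sigma_algebra.
pose T' := g_sigma_algebraType quadrants.
have m1 : measurable_fun (setT : set T') (fst : T' -> measurableTypeR R).
  apply: (measurability _ (RGenInftyO.measurableE R)) => _ [_ [a ->] <-].
  rewrite (_ : _ `&` _ = \bigcup_n (quadrant a n%:R : set T')).
    apply: bigcupT_measurable => n; apply: sub_sigma_algebra.
    by exists a, n%:R.
  apply/seteqP; split => x; rewrite /quadrant /= in_itv/=.
    move=> [_ xa]; exists (Num.bound `|x.2|) => //=; rewrite xa /=.
    by rewrite (le_lt_trans (ler_norm _))// archi_boundP.
  by move=> [n _ /= /andP[-> _]].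
have m2 : measurable_fun (setT : set T') (snd : T' -> measurableTypeR R).
  apply: (measurability _ (RGenInftyO.measurableE R)) => _ [_ [a ->] <-].
  rewrite (_ : _ `&` _ = \bigcup_n (quadrant n%:R a : set T')).
    apply: bigcupT_measurable => n; apply: sub_sigma_algebra.
    by exists n%:R, a.
  apply/seteqP; split => x; rewrite /quadrant /= in_itv/=.
    move=> [_ xa]; exists (Num.bound `|x.1|) => //=; rewrite xa andbT.
    by rewrite (le_lt_trans (ler_norm _))// archi_boundP.
  by move=> [n _ /= /andP[_ ->]].
move=> _ [A1 mA1 [A2 mA2 <-]].
rewrite (_ : A1 `*` A2 = (setT `&` fst @^-1` A1) `&` (setT `&` snd @^-1` A2)).
  apply: (@measurableI _ T').
    exact: m1.
  exact: m2.
by rewrite !setTI.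
Qed.

End Quadrants.

Section DyadicConvergence.
Context {R : realType}.
Local Notation plane := (measurableTypeR R * measurableTypeR R)%type.
Local Notation mu := (@leb2 R).
Local Notation square := (@square R).
Implicit Types (n k : nat).
Context (f G : plane -> R) (fG : sobolev_pair f G) (Q : square) (s0 : 0 < sqs Q).
Local Notation avg := (avg f).
Local Notation mass := (mass G).
Local Notation e := (fun n => tr avg n Q).

Let mf := sp_mf fG.
Let mQ := measurable_sset Q.
Let me n : measurable_fun setT (e n). Proof. exact: measurable_tr. Qed.

Let r n (x : plane) := f x - e n x.

Let mr n : measurable_fun setT (r n). Proof. exact: measurable_funB. Qed.

Let ir n : mu.-integrable (sset Q) (EFin \o r n).
Proof.
exact: (integrableB mQ (sp_if fG (ltW s0)) (integrable_tr avg n Q (ltW s0))).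
Qed.

Let int01 (h : plane -> R) : measurable_fun setT h -> (forall x, 0 <= h x <= 1) ->
  mu.-integrable (sset Q) (EFin \o h).
Proof.
move=> mh h01; apply: measurable_bounded_integrable => //.
- by rewrite leb2_sset ?(ltW s0)// ltry.
- exact: (@measurable_funS _ _ _ _ setT).
exists 1; split; first exact: num_real.
move=> y y1 x _; have /andP[h0 h1] := h01 x.
have hx : `|h x| <= 1 by rewrite ger0_norm.
exact: (le_trans hx (ltW y1)).
Qed.

Let int01M (h : plane -> R) n : measurable_fun setT h -> (forall x, `|h x| <= 1) ->
  mu.-integrable (sset Q) (EFin \o (fun x => h x * r n x)).
Proof.
move=> mh h01.
have mt : measurable_fun (sset Q) h by exact: (@measurable_funS _ _ _ _ setT).
have bt : [bounded h x | x in sset Q].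
  exists 1; split; first exact: num_real.
  by move=> y y1 x _; exact: (le_trans (h01 x) (ltW y1)).
exact: (integrableMr mQ mt bt (ir n)).
Qed.

(** From [|r| <= M + r^2 / M]: a set of small measure carries a small integral
    of the residual, uniformly in [n]. *)
Lemma residual_small K (h : plane -> R) M n :
  (forall n, (\int[mu]_(x in sset Q) ((r n x) ^+ 2)%:E <= K%:E)%E) ->
  measurable_fun setT h -> (forall x, 0 <= h x <= 1) -> 0 < M ->
  `|\int[mu]_(x in sset Q) (h x * r n x)| <= M * \int[mu]_(x in sset Q) h x + K / M.
Proof.
move=> HK mh h01 M0.
have mS := @measurable_EFin_sset R Q.
have hn x : `|h x| <= 1 by have /andP[h0 h1] := h01 x; rewrite ger0_norm.
have h0 x : 0 <= h x by have /andP[] := h01 x.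
have K0 : 0 <= K.
  rewrite -lee_fin; apply: le_trans (HK 0%N); apply: integral_ge0 => x _.
  by rewrite lee_fin sqr_ge0.
rewrite -lee_fin EFin_normr_Rintegral//; last exact: int01M.
apply: le_trans (le_abse_integral _ mQ _) _; first by apply: mS; exact: measurable_funM.
have hfin : (\int[mu]_(x in sset Q) (h x)%:E)%E \is a fin_num.
  by apply: integrable_fin_num => //; exact: int01.
apply: (@le_trans _ _ (\int[mu]_(x in sset Q) (M%:E * (h x)%:E + M^-1%:E * (r n x ^+ 2)%:E))%E).
  apply: ge0_le_integral => //.
  - by apply: measurableT_comp => //; apply: mS; exact: measurable_funM.
  - by apply: emeasurable_funD; apply: measurable_funeM; apply: mS => //; exact: measurable_funX.
  - move=> x _; rewrite -!EFinM -EFinD lee_fin normrM (ger0_norm (h0 x)).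
    rewrite -(real_normK (num_real (r n x))); set y := `|r n x|.
    have h1 : h x * y <= h x * (M + M^-1 * y ^+ 2).
      rewrite ler_wpM2l//.
      have : 0 <= M^-1 * (y - M) ^+ 2 + y.
        by rewrite addr_ge0 ?normr_ge0// mulr_ge0 ?invr_ge0 ?sqr_ge0// ltW.
      have -> : M^-1 * (y - M) ^+ 2 + y = M + M^-1 * y ^+ 2 - y.
        by field; rewrite gt_eqF.
      by rewrite subr_ge0.
    apply: (le_trans h1); rewrite mulrDr mulrC lerD2l.
    have /andP[_ hle] := h01 x.
    by rewrite ler_piMl// mulr_ge0 ?sqr_ge0// invr_ge0 ltW.
have Mi0 : 0 <= M^-1 by rewrite invr_ge0 ltW.
have M0' := ltW M0.
have sq0 x : (0 <= (r n x ^+ 2)%:E)%E by rewrite lee_fin sqr_ge0.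
have hE x : (0 <= (h x)%:E)%E by rewrite lee_fin.
have mr2 : measurable_fun (sset Q) (fun x => (r n x ^+ 2)%:E).
  by apply: mS; exact: measurable_funX.
have mhS : measurable_fun (sset Q) (fun x => (h x)%:E) by exact: mS.
rewrite ge0_integralD//; last first.
- exact: measurable_funeM.
- by move=> x _; rewrite mule_ge0.
- exact: measurable_funeM.
- by move=> x _; rewrite mule_ge0.
rewrite !ge0_integralZl//.
rewrite EFinD; apply: leeD.
  by rewrite /Rintegral EFinM fineK.
rewrite mulrC EFinM; apply: lee_pmul => //.
by apply: integral_ge0.
Qed.

Lemma tradeoff_cvg0 (u a : nat -> R) K : 0 <= K ->
  (forall M, 0 < M -> forall n, `|u n| <= M * a n + K / M) ->
  a n @[n --> \oo] --> 0 -> u n @[n --> \oo] --> 0.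
Proof.
move=> K0 H a0; apply/cvgr0Pnorm_le => eps eps0.
have eps20 : 0 < eps / 2 by rewrite divr_gt0.
pose M := (K + 1) / (eps / 2).
have M0 : 0 < M by rewrite divr_gt0// ltr_wpDl.
have KM : K / M <= eps / 2.
  rewrite /M invf_div mulrC -mulrA ler_piMr ?(ltW eps20)//.
  by rewrite mulrC ler_pdivrMr ?ltr_wpDl// mul1r lerDl.
near=> n; apply: (le_trans (H _ M0 n)).
rewrite (splitr eps) lerD// -ler_pdivlMl//.
rewrite (le_trans (ler_norm _))//; near: n.
by move/cvgr0Pnorm_le : a0; apply; rewrite mulr_gt0// invr_gt0.
Unshelve. all: by end_near. Qed.

Lemma int01_cvg (h : nat -> plane -> R) :
  (forall n, measurable_fun setT (h n)) -> (forall n x, 0 <= h n x <= 1) ->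
  (forall x, sset Q x -> h n x @[n --> \oo] --> 0) ->
  \int[mu]_(x in sset Q) h n x @[n --> \oo] --> 0.
Proof.
move=> mh h01 hc.
have mS n : measurable_fun (sset Q) (fun x => (h n x)%:E).
  by apply: measurable_EFin_sset.
have cE : {ae mu, forall x, sset Q x -> (h n x)%:E @[n --> \oo] --> 0%E}.
  apply: aeW => x Qx; apply: cvg_EFin; first exact: nearW.
  exact: hc.
have i1 : mu.-integrable (sset Q) (cst 1%E).
  by apply: (int01 (h := cst 1)) => //; move=> x; rewrite ler01 lexx.
have bE : {ae mu, forall x n, sset Q x -> (`|(h n x)%:E| <= cst 1 x)%E}.
  apply: aeW => x n _; have /andP[h0 h1] := h01 n x.
  by rewrite gee0_abs ?lee_fin.
have [_ _] := @dominated_convergence _ plane R mu _ mQ (fun n x => (h n x)%:E)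
  (cst 0%E) (cst 1%E) mS (measurable_cst _) cE i1 bE.
rewrite integral0 => H.
by apply: fine_cvg.
Qed.

(** The residual is orthogonal to functions constant on the squares of
    generation [n]. *)
Lemma residual_tr0 (Phi : square -> R) n :
  \int[mu]_(x in sset Q) (tr Phi n Q x * r n x) = 0.
Proof.
have E x : x \in sset Q -> tr Phi n Q x * r n x = tr Phi n Q x * f x - tr Phi n Q x * e n x.
  by rewrite mulrBr.
rewrite (eq_Rintegral mu E) RintegralB//.
- by rewrite (integral_trM fG)// subrr.
- exact: (integrable_trM Q Phi n (ltW s0) (sp_if fG (ltW s0))).
- exact: (integrable_trM Q Phi n (ltW s0) (integrable_tr avg n Q (ltW s0))).
Qed.

Let mI (A : set plane) : measurable A -> measurable_fun setT (\1_A : plane -> R).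
Proof. by move=> mA; exact: measurable_indic. Qed.

Let I01 (A : set plane) (x : plane) : 0 <= (\1_A x : R) <= 1.
Proof. by rewrite indicE; case: (x \in A); rewrite /= ?lexx ?ler01. Qed.

Let nI01 (A : set plane) (x : plane) : `|\1_A x : R| <= 1.
Proof. by have /andP[a b] := I01 A x; rewrite ger0_norm. Qed.

(** The sets on which the residuals tend weakly to zero form a lambda-system;
    the aim is to show that it contains all Borel sets. *)
Definition residual_null (A : set plane) : Prop := measurable A /\
  \int[mu]_(x in sset Q) (\1_A x * r n x) @[n --> \oo] --> 0.

(** The residual is orthogonal to the indicator of the union of the dyadic
    squares contained in the quadrant. What is left of the quadrant shrinks to
    a null set, and [residual_small] applies to it. *)
Lemma residual_null_quadrant al be : residual_null (quadrant al be).
Proof.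
set A := quadrant al be.
have mA : measurable A.
  rewrite (_ : A = (`]-oo, al[%classic : set (measurableTypeR R)) `*`
                   (`]-oo, be[%classic : set (measurableTypeR R))).
    by apply: measurableX; exact: measurable_itv.
  by apply/seteqP; split => x; rewrite /A /quadrant /= !in_itv/= => /andP.
split => //.
have [K K0 HK] := tr_avg_residual fG s0.
pose Phi (Q' : square) : R :=
  ((sqx Q' + sqs Q' <= al) && (sqy Q' + sqs Q' <= be))%:R.
pose h n x : R := \1_A x * (1 - tr Phi n Q x).
have mh n : measurable_fun setT (h n).
  apply: measurable_funM; first exact: mI.
  by apply: measurable_funB => //; exact: measurable_tr.
have h01 n x : 0 <= h n x <= 1.
  rewrite /h trE /Phi indicE; case: (x \in A); case: ((_ <= al) && _);
  by rewrite /= ?mulr1n ?mulr0n ?subrr ?subr0 ?mul1r ?mul0r ?mulr0 ?lexx ?ler01.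
have PhiA n x : sset Q x -> ~ A x -> tr Phi n Q x = 0.
  move=> Qx nA; rewrite trE /Phi; case E : (_ && _) => //; move/andP : E => [h1 h2].
  exfalso; apply: nA; have := tr_id_mem n Qx; rewrite /sset /A /quadrant /=.
  by move=> /andP[/andP[_ x1] /andP[_ x2]]; rewrite (lt_le_trans x1)// (lt_le_trans x2).
apply: (@tradeoff_cvg0 _ (fun n => \int[mu]_(x in sset Q) h n x) K).
- exact: ltW.
- move=> M M0 n.
  have -> : \int[mu]_(x in sset Q) (\1_A x * r n x) =
      \int[mu]_(x in sset Q) (h n x * r n x).
    have tr01 x : `|tr Phi n Q x| <= 1.
      by rewrite trE /Phi; case: (_ && _); rewrite ?normr1 ?normr0.
    have E x : x \in sset Q -> \1_A x * r n x = h n x * r n x + tr Phi n Q x * r n x.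
      move=> /set_mem Qx; rewrite -mulrDl /h indicE; congr (_ * _).
      have [_|/negP nA] := boolP (x \in A); first by rewrite mul1r subrK.
      rewrite mul0r add0r PhiA// => Ax; apply: nA; exact: mem_set.
    rewrite (eq_Rintegral mu E) RintegralD//.
    + by rewrite residual_tr0 addr0.
    + by apply: int01M => // x; have /andP[a b] := h01 n x; rewrite ger0_norm.
    + by apply: int01M => //; exact: measurable_tr.
  exact: residual_small.
- apply: int01_cvg => // x Qx; rewrite /h indicE.
  have [/set_mem|_] := boolP (x \in A); last first.
    by rewrite (_ : (fun _ => _) = cst 0) ?mul0r//; [exact: cvg_cst|apply/funext => n; rewrite mul0r].
  rewrite /A /quadrant /= => /andP[x1 x2].
  pose d := Num.min (al - x.1) (be - x.2).
  have d0 : 0 < d by rewrite lt_min !subr_gt0 x1.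
  apply/cvgr0Pnorm_le => eps eps0; near=> n.
  suff -> : tr Phi n Q x = 1 by rewrite subrr mulr0 normr0 ltW.
  rewrite trE /Phi.
  have := tr_id_mem n Qx; rewrite /sset /= => /andP[/andP[y1 _] /andP[y2 _]].
  have : sqs (tr id n Q x) <= d.
    rewrite tr_id_side -exprVn.
    rewrite (le_trans (ler_norm _))//; near: n.
    have h2 : `|2^-1 : R| < 1 by rewrite ger0_norm ?invr_ge0// invf_lt1// ltr1n.
    have := @cvg_geometric R (sqs Q) 2^-1 h2.
    by move/cvgr0Pnorm_le; apply.
  rewrite le_min => /andP[z1 z2].
  suff -> : (sqx (tr id n Q x) + sqs (tr id n Q x) <= al) &&
            (sqy (tr id n Q x) + sqs (tr id n Q x) <= be) by [].
  by apply/andP; split; lra.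
Unshelve. all: by end_near. Qed.

(** Dynkin's theorem: for an increasing union the remainder has small measure,
    where the integrals of the residuals are uniformly small. *)
Lemma residual_null_measurable A : measurable A -> residual_null A.
Proof.
move=> mA.
suff : <<s quadrants >> `<=` residual_null by apply; exact: measurable_sub_quadrants.
apply: lambda_system_subset => //.
- exact: quadrants_setI.
- split => //.
  + split => //; rewrite (_ : (fun n => _) = cst 0); first exact: cvg_cst.
    apply/funext => n.
    have E x : x \in sset Q -> \1_(setT : set plane) x * r n x = tr (cst 1) n Q x * r n x.
      by rewrite indicT [in RHS]trE.
    by rewrite (eq_Rintegral mu E) residual_tr0.
  + move=> X Y YX [mX cX] [mY cY]; split; first exact: measurableD.
    have E n : \int[mu]_(x in sset Q) (\1_(X `\` Y) x * r n x) =
       \int[mu]_(x in sset Q) (\1_X x * r n x) - \int[mu]_(x in sset Q) (\1_Y x * r n x).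
      rewrite -RintegralB//; [|by apply: int01M => //; exact: mI..].
      apply: eq_Rintegral => x _; rewrite -mulrBl; congr (_ * _).
      rewrite !indicE in_setD; have [/set_mem Yx|_] := boolP (x \in Y).
        by rewrite (mem_set (YX _ Yx)) /= subrr.
      by rewrite andbT subr0.
    have H := cvgB cX cY; rewrite subr0 in H.
    by have -> := funext E; exact: H.
  + move=> F ndF HF.
    have mF j : measurable (F j) by have [] := HF j.
    have mU : measurable (\bigcup_j F j) by exact: bigcupT_measurable.
    split => //.
    have [K K0 HK] := tr_avg_residual fG s0.
    pose h j : plane -> R := \1_(\bigcup_i F i `\` F j).
    have mh j : measurable_fun setT (h j) by apply: mI; exact: measurableD.
    have h01 j x : 0 <= h j x <= 1 by exact: I01.
    have hc : \int[mu]_(x in sset Q) h j x @[j --> \oo] --> 0.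
      apply: int01_cvg => // x _.
      have [[i _ Fix]|nx] := pselect ((\bigcup_i F i) x).
        apply/cvgr0Pnorm_le => eps eps0; near=> j.
        rewrite /h indicE (_ : (x \in _) = false) ?normr0 ?ltW//.
        apply/negbTE/negP => /set_mem [_]; apply.
        have ij : (i <= j)%N by near: j; exact: nbhs_infty_ge.
        by have /subsetPset := ndF _ _ ij; apply.
      rewrite (_ : (fun j => _) = cst 0); first exact: cvg_cst.
      apply/funext => j; rewrite /h indicE (_ : (x \in _) = false)//.
      by apply/negbTE/negP => /set_mem [].
    have bnd j M n : 0 < M -> `|\int[mu]_(x in sset Q) (\1_(\bigcup_i F i) x * r n x)| <=
      `|\int[mu]_(x in sset Q) (\1_(F j) x * r n x)| +
      (M * (\int[mu]_(x in sset Q) h j x) + K / M).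
      move=> M0.
      have E x : x \in sset Q -> \1_(\bigcup_i F i) x * r n x =
          \1_(F j) x * r n x + h j x * r n x.
        move=> _; rewrite -mulrDl; congr (_ * _).
        rewrite /h !indicE in_setD; have [/set_mem Fx|_] := boolP (x \in F j).
          by rewrite mem_set ?andbF ?addr0//; exists j.
        by rewrite andbT add0r.
      rewrite (eq_Rintegral mu E) RintegralD//; last 2 first.
        by apply: int01M => //; exact: mI.
        by apply: int01M => // x; have /andP[a b] := h01 j x; rewrite ger0_norm.
      apply: (le_trans (ler_normD _ _)); rewrite lerD2l.
      exact: residual_small.
    apply/cvgr0Pnorm_le => eps eps0.
    have e30 : 0 < eps / 3 by rewrite divr_gt0.
    pose M := K / (eps / 3).
    have M0 : 0 < M by rewrite divr_gt0.
    have KM : K / M = eps / 3 by rewrite /M invf_div mulrCA divff ?mulr1// gt_eqF.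
    have [j _ Hj] : \forall j \near \oo, `|\int[mu]_(x in sset Q) h j x| <= M^-1 * (eps / 3).
      by move/cvgr0Pnorm_le : hc; apply; rewrite mulr_gt0// invr_gt0.
    have {}Hj := Hj j (leqnn j).
    have [_ cj] := HF j.
    near=> n; apply: (le_trans (bnd j M n M0)).
    have H1 : `|\int[mu]_(x in sset Q) (\1_(F j) x * r n x)| <= eps / 3.
      by near: n; move/cvgr0Pnorm_le : cj; apply.
    have H2 : M * (\int[mu]_(x in sset Q) h j x) <= eps / 3.
      by rewrite -ler_pdivlMl// (le_trans (ler_norm _)).
    by rewrite KM; lra.
- by move=> X [al [be ->]]; exact: residual_null_quadrant.
Unshelve. all: by end_near. Qed.

(** From [|y| <= 2^-k + 2^k y^2], as the integral of the square is of order
    [4^-k]. *)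
Lemma tr_avg_L1_diff n k : (k <= n)%N ->
  \int[mu]_(x in sset Q) `|e n x - e k x| <=
  (sqs Q ^+ 2 + Ktree 2 * sqs Q ^+ 2 * mass Q) / 2 ^+ k.
Proof.
move=> kn.
have mS := @measurable_EFin_sset R Q.
have mekn : measurable_fun setT (fun x => e n x - e k x) by exact: measurable_funB.
rewrite -lee_fin /Rintegral fineK; last first.
  apply: integrable_fin_num => //; apply: integrable_norm.
  exact: (integrableB mQ (integrable_tr avg n Q (ltW s0)) (integrable_tr avg k Q (ltW s0))).
have p0 : 0 < 2 ^+ k :> R by rewrite exprn_gt0.
apply: (@le_trans _ _ (\int[mu]_(x in sset Q)
   ((2 ^+ k)^-1%:E + (2 ^+ k)%:E * ((e n x - e k x) ^+ 2)%:E))%E).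
  apply: ge0_le_integral => //.
  - by apply: mS; exact: measurableT_comp.
  - apply: emeasurable_funD => //; apply: measurable_funeM; apply: mS.
    exact: measurable_funX.
  - move=> x _; rewrite -EFinM -EFinD lee_fin -(real_normK (num_real (e n x - e k x))).
    set y := `|_|.
    have : 0 <= 2 ^+ k * (y - (2 ^+ k)^-1) ^+ 2 + y.
      by rewrite addr_ge0 ?normr_ge0// mulr_ge0 ?sqr_ge0// ltW.
    have -> : 2 ^+ k * (y - (2 ^+ k)^-1) ^+ 2 + y = (2 ^+ k)^-1 + 2 ^+ k * y ^+ 2 - y.
      by field; rewrite gt_eqF.
    by rewrite subr_ge0.
have sq0 x : (0 <= ((e n x - e k x) ^+ 2)%:E)%E by rewrite lee_fin sqr_ge0.
have p0' := ltW p0.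
have m2 : measurable_fun (sset Q) (fun x => ((e n x - e k x) ^+ 2)%:E).
  by apply: mS; exact: measurable_funX.
rewrite ge0_integralD//; last first.
- exact: measurable_funeM.
- by move=> x _; rewrite mule_ge0.
rewrite integral_cst// leb2_sset ?(ltW s0)// ge0_integralZl//.
have H : ((2 ^+ k)%:E * \int[mu]_(x in sset Q) ((e n x - e k x) ^+ 2)%:E <=
   (2 ^+ k)%:E * (Ktree 2 * (sqs Q / 2 ^+ k) ^+ 2 * mass Q)%:E)%E.
  apply: lee_pmul => //; first by apply: integral_ge0.
  by have := tr_avg_L2_diff fG k (n - k) s0; rewrite subnKC.
apply: (le_trans (leeD (lexx _) H)).
rewrite -!EFinM -EFinD lee_fin le_eqVlt; apply/orP; left; apply/eqP.
by field; rewrite gt_eqF.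
Qed.

(** The residual [r k] has mean zero, so its norm in [L^1] is twice its
    integral over [A = {r k >= 0}]. There [r k] is [r n] plus the difference
    of two dyadic averages; the first part tends to zero with [n], the second
    is [tr_avg_L1_diff]. *)
Lemma residual_L1 k : \int[mu]_(x in sset Q) `|r k x| <=
  2 * ((sqs Q ^+ 2 + Ktree 2 * sqs Q ^+ 2 * mass Q) / 2 ^+ k).
Proof.
set C := _ / _.
pose A : set plane := [set x | 0 <= r k x].
have mA : measurable A.
  have : measurable_fun setT (fun x => (0 : R) <= r k x) by exact: measurable_fun_ler.
  by move=> /(_ measurableT [set true] Logic.I); rewrite setTI.
have iA n : mu.-integrable (sset Q) (EFin \o (fun x => \1_A x * r n x)).
  by apply: int01M => //; exact: mI.
have E1 : \int[mu]_(x in sset Q) `|r k x| = 2 * \int[mu]_(x in sset Q) (\1_A x * r k x).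
  have E x : x \in sset Q -> `|r k x| = 2 * (\1_A x * r k x) - tr (cst 1) k Q x * r k x.
    move=> _; rewrite trE indicE /=; have [/set_mem|/negP nA] := boolP (x \in A).
      by move=> h; rewrite ger0_norm// !mul1r; lra.
    have : r k x < 0 by rewrite ltNge; apply/negP => h; apply: nA; exact: mem_set.
    by move=> h; rewrite ltr0_norm// mul0r mulr0 mul1r sub0r.
  rewrite (eq_Rintegral mu E) RintegralB//.
  - by rewrite residual_tr0 subr0 RintegralZl.
  - exact: (integrableZl mQ 2 (iA k)).
  - apply: int01M => [|x]; first exact: measurable_tr.
    by rewrite trE normr1.
rewrite E1 ler_wpM2l//.
have H n : (k <= n)%N -> \int[mu]_(x in sset Q) (\1_A x * r k x) <=
    \int[mu]_(x in sset Q) (\1_A x * r n x) + C.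
  move=> kn.
  have ie : mu.-integrable (sset Q) (EFin \o (fun x => e n x - e k x)).
    exact: (integrableB mQ (integrable_tr avg n Q (ltW s0)) (integrable_tr avg k Q (ltW s0))).
  apply: le_trans (lerD (lexx _) (tr_avg_L1_diff kn)).
  rewrite -RintegralD//; last exact: integrable_norm.
  apply: le_Rintegral => //.
    exact: (integrableD mQ (iA n) (integrable_norm ie)).
  move=> x _; have /andP[a b] := I01 A x.
  have -> : r k x = r n x + (e n x - e k x) by rewrite /r; ring.
  rewrite mulrDr lerD2l; apply: (le_trans (ler_norm _)); rewrite normrM.
  have := ler_wpM2r (normr_ge0 (e n x - e k x)) (nI01 A x).
  by rewrite mul1r.
have [_ cA] := residual_null_measurable mA.
have cAC : (\int[mu]_(x in sset Q) (\1_A x * r n x) + C) @[n --> \oo] --> 0 + C.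
  by apply: cvgD => //; exact: cvg_cst.
rewrite -[leRHS]add0r -(cvg_lim _ cAC)//.
apply: limr_ge; first by apply/cvg_ex; eexists; exact: cAC.
by near=> n; apply: H; near: n; exact: nbhs_infty_ge.
Unshelve. all: by end_near. Qed.

(** The norms of the residuals are summable, so that the series of the
    absolute values of the residuals converges almost everywhere. *)
Lemma tr_avg_ae_cvg : {ae mu, forall x, sset Q x -> e n x @[n --> \oo] --> f x}.
Proof.
set C := 2 * (sqs Q ^+ 2 + Ktree 2 * sqs Q ^+ 2 * mass Q).
have mS n : measurable_fun (sset Q) (fun x => (`|r n x|)%:E).
  apply: measurable_EFin_sset.
  exact: measurableT_comp.
pose S x : \bar R := (\sum_(0 <= n <oo) (`|r n x|)%:E)%E.
have iS : mu.-integrable (sset Q) S.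
  apply/integrableP; split; first exact: ge0_emeasurable_sum.
  have C0 : 0 <= C.
    rewrite mulr_ge0// addr_ge0 ?sqr_ge0//; apply: mulr_ge0; last exact: (mass_ge0 fG).
    by apply: mulr_ge0; [apply/ltW/Ktree_gt0|exact: sqr_ge0].
  have S0 x : (0 <= S x)%E by apply: nneseries_ge0 => n _ _; rewrite lee_fin.
  under eq_integral do rewrite gee0_abs//.
  rewrite integral_nneseries//.
  apply: (@le_lt_trans _ _ (2 * C)%:E); last exact: ltry.
  apply: lime_le.
    by apply: is_cvg_nneseries => n _ _; apply: integral_ge0.
  apply: nearW => n.
  apply: (@le_trans _ _ (\sum_(0 <= k < n) (C / 2 ^+ k)%:E)%E).
    apply: lee_sum => k _; have := residual_L1 k; rewrite mulrA -/C.
    rewrite -lee_fin /Rintegral fineK//.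
    by apply: integrable_fin_num => //; exact: (integrable_norm (ir k)).
  rewrite sumEFin lee_fin.
  have -> : \sum_(0 <= k < n) C / 2 ^+ k = 2 * C - 2 * C / 2 ^+ n.
    elim: n => [|n IH]; first by rewrite big_geq// expr0 divr1 subrr.
    rewrite big_nat_recr//= IH exprS; field.
    by rewrite expf_neq0.
  by rewrite gerBl divr_ge0 ?exprn_ge0// mulr_ge0.
have Hae := integrable_ae mQ iS.
apply: negligibleS Hae => x; apply: contra_not => /= + Qx => /(_ Qx) Sfin.
have S0 x' : (0 <= S x')%E by apply: nneseries_ge0 => n _ _; rewrite lee_fin.
have cs : cvgn (series (fun n => `|r n x|)).
  apply: nondecreasing_is_cvgn.
    by apply: nondecreasing_series => n _ _; exact: normr_ge0.
  exists (fine (S x)) => _ [n _ <-].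
  rewrite -lee_fin fineK// /series /= -sumEFin.
  exact: nneseries_lim_ge.
have r0 : r n x @[n --> \oo] --> 0.
  by apply/norm_cvg0P; exact: cvg_series_cvg_0 cs.
have -> : (fun n => e n x) = (fun n => f x - r n x).
  by apply/funext => n; rewrite /r subKr.
have H : (f x - r n x) @[n --> \oo] --> f x - 0 by apply: cvgB => //; exact: cvg_cst.
by rewrite subr0 in H.
Qed.

End DyadicConvergence.

(** * A weighted Poincare inequality on a square *)

Section SquarePoincare.
Context {R : realType}.
Local Notation plane := (measurableTypeR R * measurableTypeR R)%type.
Local Notation mu := (@leb2 R).
Local Notation square := (@square R).
Implicit Types (Q : square).

(** [tree_bound] does not depend on the generation, and Fatou's lemma passes
    to the limit. *)
Lemma square_poincare (f G V : plane -> R) (b T : R) Q :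
  sobolev_pair f G ->
  measurable_fun setT V -> (forall x, 0 <= V x) -> 0 < b -> 0 <= T -> 0 < sqs Q ->
  (forall Q', sset Q' `<=` sset Q -> 0 < sqs Q' ->
    (\int[mu]_(x in sset Q') (V x)%:E <= (T * sqs Q' `^ b)%:E)%E) ->
  (\int[mu]_(x in sset Q) (V x * (f x - avg f Q) ^+ 2)%:E <=
    (Ktree b * T * sqs Q `^ b * mass G Q)%:E)%E.
Proof.
move=> fG mV V0 b0 T0 s0 HV.
have mQ := measurable_sset Q.
have mf := sp_mf fG.
have mS := @measurable_EFin_sset R Q.
pose h n (x : plane) := (V x * (tr (avg f) n Q x - avg f Q) ^+ 2)%:E.
have mh n : measurable_fun (sset Q) (h n).
  apply: mS; apply: measurable_funM => //; apply: measurable_funX.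
  by apply: measurable_funB => //; exact: measurable_tr.
have h0 n x : sset Q x -> (0 <= h n x)%E.
  by move=> _; rewrite lee_fin mulr_ge0 ?sqr_ge0.
have Hae := tr_avg_ae_cvg fG s0.
have E : (\int[mu]_(x in sset Q) (V x * (f x - avg f Q) ^+ 2)%:E =
    \int[mu]_(x in sset Q) limn_einf (h^~ x))%E.
  apply: ge0_ae_eq_integral => //.
  - apply: mS; apply: measurable_funM => //; apply: measurable_funX.
    exact: measurable_funB.
  - have mN n : measurable_fun (sset Q) (fun x => - h n x)%E.
      by apply: (@measurableT_comp _ _ _ _ _ _ (@oppe R)).
    have mL : measurable_fun (sset Q) (fun x => limn_esup (fun n => - h n x)%E).
      exact: measurable_fun_limn_esup.
    have mO : measurable_fun setT (@oppe R) by exact: oppe_measurable.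
    exact: measurableT_comp mO mL.
  - by move=> x _; rewrite lee_fin mulr_ge0 ?sqr_ge0.
  - move=> x Qx; rewrite limn_einf_lim; apply: lime_ge; first exact: is_cvg_einfs.
    apply: nearW => n; apply: le_ereal_inf_tmp => _ [m _ <-].
    exact: h0.
  - apply: negligibleS Hae => x; apply: contra_not => /= H Qx.
    have {}H := H Qx.
    have C : h n x @[n --> \oo] --> (V x * (f x - avg f Q) ^+ 2)%:E.
      apply: cvg_EFin; first exact: nearW.
      apply: cvgMr; rewrite expr2.
      by apply: cvgM; apply: cvgB => //; exact: cvg_cst.
    by have [-> _] := cvg_limn_einf_sup C.
rewrite E; apply: (le_trans (fatou mu mQ mh h0)).
rewrite limn_einf_lim; apply: lime_le; first exact: is_cvg_einfs.
apply: nearW => n; have H := @tree_bound R f G fG V b T n Q mV V0 b0 T0 s0 HV.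
refine (le_trans _ H).
by apply: ereal_inf_lbound; exists n => /=.
Qed.

(** A pointwise substitute for Hoelder's inequality: the first term dominates
    where [v <= l], the second elsewhere. *)
Lemma le_cut_powR (p l v : R) : 1 < p -> 0 < l -> 0 <= v ->
  v <= l + l `^ (1 - p) * v `^ p.
Proof.
move=> p1 l0 v0; have [vl|lv] := leP v l.
  by rewrite (le_trans vl)// lerDl mulr_ge0// powR_ge0.
have v0' : 0 < v by exact: lt_trans lv.
rewrite (@le_trans _ _ (l `^ (1 - p) * v `^ p))// ?lerDr ?(ltW l0)//.
have E : v = v `^ (1 - p) * v `^ p.
  by rewrite -powRD ?subrK ?powRr1// (gt_eqF v0') implybT.
rewrite {1}E.
rewrite ler_wpM2r ?powR_ge0//.
have -> : 1 - p = - (p - 1) by rewrite opprB.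
rewrite !powRN lef_pV2 ?posrE ?powR_gt0//.
by apply: ge0_ler_powR; rewrite ?nnegrE ?subr_ge0 ?(ltW p1)// ltW.
Qed.

Lemma square_holder (V : plane -> R) (p X : R) Q :
  1 < p -> measurable_fun setT V -> (forall x, 0 <= V x) -> 0 < sqs Q -> 0 <= X ->
  (\int[mu]_(x in sset Q) (V x `^ p)%:E <= X%:E)%E ->
  (\int[mu]_(x in sset Q) (V x)%:E <=
    (2 * X `^ (1 / p) * sqs Q `^ (2 * (1 - 1 / p)))%:E)%E.
Proof.
move=> p1 mV V0 s0 X0 HX.
have p0 : 0 < p by exact: lt_trans p1.
have pn0 : p != 0 by rewrite gt_eqF.
set s := sqs Q in s0 *.
have mQ := measurable_sset Q.
have mS := @measurable_EFin_sset R Q.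
have mVp : measurable_fun setT (fun x => V x `^ p).
  exact: (measurableT_comp (measurable_powR p)).
have bnd l : 0 < l -> (\int[mu]_(x in sset Q) (V x)%:E <=
    (l * s ^+ 2 + l `^ (1 - p) * X)%:E)%E.
  move=> l0.
  have l1 : 0 <= l `^ (1 - p) by rewrite powR_ge0.
  apply: (@le_trans _ _ (\int[mu]_(x in sset Q) (l%:E + (l `^ (1 - p))%:E * (V x `^ p)%:E))%E).
    apply: ge0_le_integral => //.
    - by move=> x _; rewrite lee_fin.
    - exact: mS.
    - by apply: emeasurable_funD => //; apply: measurable_funeM; exact: mS.
    - by move=> x _; rewrite -EFinM -EFinD lee_fin; exact: le_cut_powR.
  have V0p x : (0 <= (V x `^ p)%:E)%E by rewrite lee_fin powR_ge0.
  rewrite ge0_integralD//; last first.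
  - by apply: measurable_funeM; exact: mS.
  - by move=> x _; rewrite mule_ge0.
  - by move=> x _; rewrite lee_fin ltW.
  rewrite integral_cst// leb2_sset ?(ltW s0)// -/s ge0_integralZl//; last exact: mS.
  rewrite -EFinM EFinD leeD//= EFinM; apply: lee_pmul => //.
  by apply: integral_ge0.
have [X0'|X0'] := ltP 0 X; last first.
  have XE : X = 0 by apply/eqP; rewrite eq_le X0 X0'.
  rewrite XE powR0 ?div1r ?invr_eq0// mulr0 mul0r.
  apply/lee_addgt0Pr => eps eps0; rewrite add0e.
  have := bnd (eps / s ^+ 2); rewrite XE mulr0 addr0 divfK ?expf_neq0 ?gt_eqF//.
  by apply; rewrite divr_gt0// exprn_gt0.
have s20 : 0 < s ^+ 2 by rewrite exprn_gt0.
(* This level makes the two terms of the bound equal. *)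
pose l := (X / s ^+ 2) `^ (1 / p).
have l0 : 0 < l by rewrite powR_gt0// divr_gt0.
apply: (le_trans (bnd l l0)); rewrite lee_fin.
set Z := X `^ (1 / p) * s `^ (2 * (1 - 1 / p)).
have spE : s `^ (2 * (1 - 1 / p)) = (s ^+ 2) `^ (1 - 1 / p).
  by rewrite powRrM powR_mulrn ?ltW.
have lE : l = X `^ (1 / p) * (s ^+ 2) `^ (- (1 / p)).
  rewrite /l powRM ?(ltW X0') ?invr_ge0 ?(ltW s20)//.
  by rewrite -[(s ^+ 2)^-1]powR_inv1 ?(ltW s20)// -powRrM mulN1r.
have -> : l * s ^+ 2 = Z.
  rewrite /Z spE lE -mulrA; congr (_ * _).
  rewrite -{2}[s ^+ 2](@powRr1 R) ?(ltW s20)// -powRD ?(gt_eqF s20) ?implybT//.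
  by congr (_ `^ _); rewrite addrC.
have -> : l `^ (1 - p) * X = Z.
  have -> : l `^ (1 - p) = (X / s ^+ 2) `^ (1 / p - 1).
    by rewrite /l -powRrM; congr (_ `^ _); field.
  rewrite powRM ?(ltW X0') ?invr_ge0 ?(ltW s20)//.
  rewrite -[(s ^+ 2)^-1]powR_inv1 ?(ltW s20)// -powRrM.
  rewrite mulrAC -{2}[X](@powRr1 R) ?(ltW X0')//.
  rewrite -powRD ?(gt_eqF X0') ?implybT// /Z spE subrK; congr (_ * _ `^ _).
  by ring.
by rewrite -mulrA -/Z; lra.
Qed.

(** The exponent that Hoelder's inequality gives to the side of a square. *)
Definition expo (p : R) : R := 2 * (1 - 1 / p).

Lemma expo_gt0 p : 1 < p -> 0 < expo p.
Proof.
move=> p1; rewrite mulr_gt0// subr_gt0 div1r invf_lt1//.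
exact: lt_trans p1.
Qed.

Lemma potential_poincare (f G V : plane -> R) (p X : R) Q :
  sobolev_pair f G -> 1 < p ->
  measurable_fun setT V -> (forall x, 0 <= V x) -> 0 < sqs Q -> 0 <= X ->
  (\int[mu]_(x in sset Q) (V x `^ p)%:E <= X%:E)%E ->
  (\int[mu]_(x in sset Q) (V x * (f x - avg f Q) ^+ 2)%:E <=
    (2 * Ktree (expo p) * (X `^ (1 / p) * sqs Q `^ expo p) * mass G Q)%:E)%E.
Proof.
move=> fG p1 mV V0 s0 X0 HX.
have -> : 2 * Ktree (expo p) * (X `^ (1 / p) * sqs Q `^ expo p) * mass G Q =
   Ktree (expo p) * (2 * X `^ (1 / p)) * sqs Q `^ expo p * mass G Q by ring.
apply: square_poincare => //; first exact: expo_gt0.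
  by rewrite mulr_ge0// powR_ge0.
move=> Q' Q'Q s'0; apply: square_holder => //.
apply: le_trans HX; apply: ge0_subset_integral => //.
- exact: measurable_sset.
- exact: measurable_sset.
- apply: measurable_EFin_sset.
  exact: (measurableT_comp (measurable_powR p)).
- by move=> x _; rewrite lee_fin powR_ge0.
Qed.

End SquarePoincare.

(** * Subdividing a square where the potential is large *)

Section Subdivision.
Context {R : realType}.
Local Notation plane := (measurableTypeR R * measurableTypeR R)%type.
Local Notation mu := (@leb2 R).
Local Notation square := (@square R).
Implicit Types (Q : square).
Context (V : plane -> R) (p c : R) (p1 : 1 < p) (c0 : 0 < c).
Context (mV : measurable_fun setT V) (V0 : forall x, 0 <= V x).

Definition pmass Q : R := \int[mu]_(x in sset Q) (V x `^ p).

Definition pfinite Q : Prop := (\int[mu]_(x in sset Q) (V x `^ p)%:E < +oo)%E.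

(** A quantity invariant under dilations, measured in units of [c^p]: where it
    is at most one, the Poincare inequality with weight [V] holds with a
    constant proportional to [c]. *)
Definition excess Q : R := pmass Q * sqs Q `^ (2 * (p - 1)) / c `^ p.

(** The factor by which one subdivision reduces the total excess. *)
Definition kappa : R := 4^-1 `^ (p - 1).

Definition controls (L : seq square) Q : Prop :=
  forall f G : plane -> R, sobolev_pair f G ->
  (forall Q', List.In Q' L -> avg f Q' = 0) ->
  (\int[mu]_(x in sset Q) (V x * f x ^+ 2)%:E <=
     (2 * Ktree (expo p) * c * mass G Q)%:E)%E.

Let mVp : measurable_fun setT (fun x => V x `^ p).
Proof. exact: (measurableT_comp (measurable_powR p)). Qed.

Lemma pmass_ge0 Q : 0 <= pmass Q.
Proof. by apply: Rintegral_ge0 => x _; exact: powR_ge0. Qed.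

Lemma pfinite_integrable Q : pfinite Q ->
  mu.-integrable (sset Q) (EFin \o (fun x => V x `^ p)).
Proof.
move=> fQ; apply/integrableP; split.
  by apply: measurable_EFin_sset.
by under eq_integral do rewrite gee0_abs ?lee_fin ?powR_ge0//.
Qed.

Lemma pmassE Q : pfinite Q ->
  (\int[mu]_(x in sset Q) (V x `^ p)%:E)%E = (pmass Q)%:E.
Proof.
move=> fQ; rewrite /pmass /Rintegral fineK// ge0_fin_numE//.
by apply: integral_ge0 => x _; rewrite lee_fin powR_ge0.
Qed.

Lemma pfinite_child Q k : pfinite Q -> pfinite (child Q k).
Proof.
apply: le_lt_trans; apply: ge0_subset_integral => //.
- exact: measurable_sset.
- exact: measurable_sset.
- by apply: measurable_EFin_sset.
- by move=> x _; rewrite lee_fin powR_ge0.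
- exact: child_sub.
Qed.

Lemma kappa_gt0 : 0 < kappa. Proof. by rewrite powR_gt0// invr_gt0. Qed.

Lemma kappa_lt1 : kappa < 1.
Proof.
have h : (4^-1 : R) < 1 by lra.
have p10 : 0 < p - 1 by rewrite subr_gt0.
have := @gt0_ltr_powR R (p - 1) p10 4^-1 1.
by rewrite powR1; apply => //; rewrite nnegrE.
Qed.

Lemma excess_kids Q : 0 < sqs Q -> pfinite Q ->
  \sum_(k <- kids) excess (child Q k) = kappa * excess Q.
Proof.
move=> s0 fQ; rewrite /excess.
have -> : pmass Q = \sum_(k <- kids) pmass (child Q k).
  by apply: Rintegral_kids => //; exact: pfinite_integrable.
rewrite /child /= -!big_distrl /=.
have -> : (sqs Q / 2) `^ (2 * (p - 1)) = kappa * sqs Q `^ (2 * (p - 1)).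
  rewrite powRM ?(ltW s0)// mulrC; congr (_ * _).
  rewrite powRrM /kappa; congr (_ `^ _); rewrite powR_mulrn//.
  by rewrite exprVn; congr (_^-1); ring.
set S := \sum_(k <- kids) _; ring.
Qed.

Lemma excess_ge0 Q : 0 <= excess Q.
Proof. by rewrite divr_ge0 ?powR_ge0// mulr_ge0 ?powR_ge0// pmass_ge0. Qed.

Lemma scale_excess Q : 0 < sqs Q ->
  pmass Q `^ (1 / p) * sqs Q `^ expo p = c * excess Q `^ (1 / p).
Proof.
move=> s0; have pn0 : p != 0 by rewrite gt_eqF// (lt_trans _ p1).
have S0 := powR_ge0 (sqs Q) (2 * (p - 1)).
rewrite /excess powRM ?mulr_ge0 ?pmass_ge0 ?invr_ge0 ?powR_ge0//.
rewrite powRM ?pmass_ge0// -!powRN -!powRrM.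
have -> : - p * (1 / p) = - 1 by field.
have -> : 2 * (p - 1) * (1 / p) = expo p by rewrite /expo; field.
by rewrite powR_inv1 ?(ltW c0)//; field; rewrite gt_eqF.
Qed.

Lemma excess_le1_poincare Q (f G : plane -> R) : 0 < sqs Q -> pfinite Q ->
  excess Q <= 1 -> sobolev_pair f G ->
  (\int[mu]_(x in sset Q) (V x * (f x - avg f Q) ^+ 2)%:E <=
     (2 * Ktree (expo p) * c * mass G Q)%:E)%E.
Proof.
move=> s0 fQ e1 fG.
have H : (\int[mu]_(x in sset Q) (V x `^ p)%:E <= (pmass Q)%:E)%E by rewrite pmassE.
apply: (le_trans (potential_poincare fG p1 mV V0 s0 (pmass_ge0 Q) H)).
rewrite lee_fin scale_excess// ler_wpM2r ?(mass_ge0 fG)//.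
have K0 : 0 <= 2 * Ktree (expo p).
  by apply: mulr_ge0 => //; exact: ltW (Ktree_gt0 (expo_gt0 p1)).
apply: ler_wpM2l => //; rewrite ler_piMr ?(ltW c0)//.
have p0 : 0 < p by exact: lt_trans p1.
have := @ge0_ler_powR R (1 / p) (divr_ge0 ler01 (ltW p0)) (excess Q) 1.
by rewrite powR1; apply => //; rewrite nnegrE// excess_ge0.
Qed.

Lemma excess_le1_controls Q : 0 < sqs Q -> pfinite Q ->
  excess Q <= 1 -> controls [:: Q] Q.
Proof.
move=> s0 fQ e1 f G fG H; have := excess_le1_poincare s0 fQ e1 fG.
by rewrite H; [under eq_integral do rewrite subr0|left].
Qed.

Lemma kids_controls Q (L : bool * bool -> seq square) :
  (forall k, controls (L k) (child Q k)) ->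
  controls (flatten [seq L k | k <- kids]) Q.
Proof.
move=> HL f G fG H.
rewrite integral_kids; last first.
  by apply: measurable_funM => //; apply: measurable_funX; exact: (sp_mf fG).
rewrite (mass_kids fG) big_distrr /= -sumEFin.
apply: lee_sum => k _; apply: HL => // Q' Q'L; apply: H.
by case: k Q'L => [[] []] Q'L; rewrite /= !List.in_app_iff; tauto.
Qed.

Lemma size_kids (L : bool * bool -> seq square) :
  (size (flatten [seq L k | k <- kids]))%:R = \sum_(k <- kids) (size (L k))%:R :> R.
Proof. by rewrite size_flatten /shape -map_comp sumnE big_map natr_sum. Qed.

Definition Csub : R := 3 / (1 - kappa).

Lemma Csub_gt0 : 0 < Csub.
Proof. by rewrite divr_gt0// subr_gt0 kappa_lt1. Qed.

(** Subdivide only squares of excess larger than one. The four children have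
    together at most [4 + Csub * kappa * e] squares; this is at most [1 + Csub
    * e] because [3 <= 3 * e = Csub * (1 - kappa) * e]. *)
Lemma subdivide_deep n Q : 0 < sqs Q -> pfinite Q -> kappa ^+ n * excess Q <= 1 ->
  exists2 L, (size L)%:R <= 1 + Csub * excess Q & controls L Q.
Proof.
have C0 := Csub_gt0; have k1 := kappa_lt1; have k0 := kappa_gt0.
elim: n Q => [|n IH] Q s0 fQ.
  rewrite expr0 mul1r => e1; exists [:: Q]; last exact: excess_le1_controls.
  by rewrite lerDl mulr_ge0 ?excess_ge0// ltW.
move=> en; have [e1|e1] := leP (excess Q) 1.
  exists [:: Q]; last exact: excess_le1_controls.
  by rewrite lerDl mulr_ge0 ?excess_ge0// ltW.
have ek := excess_kids s0 fQ.
have Hk k : exists L, (size L)%:R <= 1 + Csub * excess (child Q k) /\ controls L (child Q k).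
  have [|||L L1 L2] := IH (child Q k); last by exists L.
  - by rewrite divr_gt0.
  - exact: pfinite_child.
  - apply: le_trans en; rewrite exprSr -mulrA ler_wpM2l ?exprn_ge0 ?(ltW k0)//.
    rewrite -ek (perm_big (k :: rem k kids))/=; last first.
      by apply: perm_to_rem; case: k => [[] []].
    by rewrite big_cons lerDl sumr_ge0// => j _; exact: excess_ge0.
have /choice[L HL] := Hk.
exists (flatten [seq L k | k <- kids]); last first.
  by apply: kids_controls => k; have [] := HL k.
rewrite size_kids.
apply: (@le_trans _ _ (\sum_(k <- kids) (1 + Csub * excess (child Q k)))).
  by apply: ler_sum => k _; have [] := HL k.
rewrite big_split /= -big_distrr /= ek.
have -> : \sum_(k <- kids) 1 = 4 :> R by rewrite /kids !big_cons big_nil; ring.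
have : 3 * 1 <= Csub * (1 - kappa) * excess Q.
  by rewrite /Csub divfK ?gt_eqF ?subr_gt0// ler_pM2l// ltW.
lra.
Qed.

(** Cutting [k] times in any case before applying [subdivide_deep] reduces the
    total excess first. *)
Lemma subdivide_uniform k Q : 0 < sqs Q -> pfinite Q ->
  exists2 L, (size L)%:R <= 4 ^+ k + Csub * (kappa ^+ k * excess Q) & controls L Q.
Proof.
have C0 := Csub_gt0; have k1 := kappa_lt1; have k0 := kappa_gt0.
elim: k Q => [|k IH] Q s0 fQ.
  rewrite !expr0 mul1r.
  have [n Hn] : exists n, kappa ^+ n * excess Q <= 1.
    have h2 : `|kappa| < 1 by rewrite ger0_norm// ltW.
    have := @cvg_geometric R (excess Q) kappa h2.
    move/cvgr0Pnorm_le => /(_ _ ltr01) [n _ /(_ n (leqnn n))].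
    by rewrite /geometric /= => H; exists n; rewrite mulrC (le_trans (ler_norm _)).
  exact: subdivide_deep Hn.
have ek := excess_kids s0 fQ.
have Hk j : exists L, (size L)%:R <= 4 ^+ k + Csub * (kappa ^+ k * excess (child Q j)) /\
    controls L (child Q j).
  have [||L L1 L2] := IH (child Q j); last by exists L.
  - by rewrite divr_gt0.
  - exact: pfinite_child.
have /choice[L HL] := Hk.
exists (flatten [seq L k | k <- kids]); last first.
  by apply: kids_controls => j; have [] := HL j.
rewrite size_kids.
apply: (@le_trans _ _ (\sum_(j <- kids) (4 ^+ k + Csub * (kappa ^+ k * excess (child Q j))))).
  by apply: ler_sum => j _; have [] := HL j.
rewrite big_split /= -big_distrr /= -big_distrr /= ek.
have -> : \sum_(j <- kids) 4 ^+ k = 4 ^+ k.+1 :> R.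
  by rewrite /kids !big_cons big_nil exprS; ring.
by rewrite [kappa ^+ k.+1]exprSr !mulrA.
Qed.

Definition Csize : R := 1 + Csub * 4 `^ (p - 1).

Lemma Csize_gt0 : 0 < Csize.
Proof. by rewrite ltr_wpDr// mulr_ge0 ?powR_ge0// ltW// Csub_gt0. Qed.

(** With [4^k] close to [t = excess Q ^ (1/p)], both terms of
    [subdivide_uniform] are of order [t], because [kappa^k] is then of order
    [t^(1-p)]. *)
Lemma subdivide Q : 0 < sqs Q -> pfinite Q -> 1 < excess Q ->
  exists2 L, (size L)%:R <= Csize * excess Q `^ (1 / p) & controls L Q.
Proof.
move=> s0 fQ e1.
have p0 : 0 < p by exact: lt_trans p1.
set t := excess Q `^ (1 / p).
have t1 : 1 <= t.
  have := @ge0_ler_powR R (1 / p) (divr_ge0 ler01 (ltW p0)) 1 (excess Q).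
  by rewrite powR1; apply => //; rewrite ?nnegrE// ?excess_ge0// ltW.
have t0 : 0 < t by exact: lt_le_trans t1.
have et : excess Q = t `^ p.
  by rewrite /t -powRrM mul1r mulVf ?gt_eqF// powRr1// excess_ge0.
have [k [k1 k2]] : exists k, 4 ^+ k <= t /\ t < 4 ^+ k.+1.
  have ex : exists k, t < 4 ^+ k.
    have h4 : (1 : R) < 4 by lra.
    have [n nt] : exists n, t < n%:R.
      by exists (Num.bound t); exact: archi_boundP (ltW t0).
    exists n; apply: (lt_le_trans nt).
    by rewrite -natrX ler_nat ltnW// ltn_expl.
  pose k := ex_minn ex.
  have : k = ex_minn ex by [].
  case: ex_minnP => [[|m] Hm Hmin] _.
    by move: Hm; rewrite expr0 ltNge t1.
  exists m; split => //; rewrite leNgt; apply/negP => /Hmin.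
  by rewrite ltnn.
have [L L1 L2] := subdivide_uniform k s0 fQ.
exists L => //; apply: (le_trans L1); rewrite /Csize mulrDl mul1r lerD//.
rewrite -mulrA ler_wpM2l ?(ltW Csub_gt0)// et.
have p10 : 0 <= p - 1 by rewrite subr_ge0 ltW.
have -> : t `^ p = t `^ (p - 1) * t.
  by rewrite -{3}(powRr1 (ltW t0)) -powRD ?subrK// (gt_eqF t0) implybT.
rewrite mulrA ler_wpM2r ?(ltW t0)//.
have -> : kappa ^+ k = (4 ^- k) `^ (p - 1).
  rewrite /kappa -powR_mulrn ?powR_ge0// powRAC; congr (_ `^ _).
  by rewrite powR_mulrn// exprVn.
rewrite -powRM ?invr_ge0 ?exprn_ge0 ?(ltW t0)//.
apply: ge0_ler_powR => //; rewrite ?nnegrE// ?mulr_ge0 ?invr_ge0 ?exprn_ge0 ?(ltW t0)//.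
by rewrite ler_pdivrMl ?exprn_gt0// -exprSr ltW.
Qed.

End Subdivision.

(** * A discrete Hardy inequality with few constraints *)

Section Chain.
Context {R : realType} (t : nat -> R) (t0 : forall k, 0 <= t k).

(** A greedy rule: [run] accumulates [k * t k] and restarts from zero, marking
    the index, whenever it would exceed one. *)
Fixpoint run (n : nat) : R :=
  if n is m.+1 then
    let s := run m + n%:R * t n in if 1 < s then 0 else s
  else 0.

Definition marked (n : nat) : bool :=
  if n is m.+1 then 1 < run m + n%:R * t n else false.

Lemma run_itv n : 0 <= run n <= 1.
Proof.
elim: n => [|n /andP[r0 r1]] /=; first by rewrite lexx ler01.
case: ifPn => [_|]; first by rewrite lexx ler01.
by rewrite -leNgt => ->; rewrite andbT addr_ge0// mulr_ge0.
Qed.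

(** Every mark has used up more than one unit of the sum. *)
Lemma count_marked N :
  (count marked (iota 0 N.+1))%:R + run N <= \sum_(k < N.+1) k%:R * t k.
Proof.
elim: N => [|N IH]; first by rewrite /= big_ord_recr big_ord0 /= mul0r !addr0.
rewrite -[in iota _ _]addn1 iotaD count_cat natrD big_ord_recr /=.
move: IH; set c := count _ _; set S := \sum_(k < N.+1) _ => IH.
rewrite add0n; case: ifPn => [h|_] /=; rewrite ?addn0; lra.
Qed.

(** Let [m] vanish at the marked indices and at zero, and let [e] be the sum
    of the squared increments since the last mark. Then [m k ^ 2 <= k * e] by
    Cauchy-Schwarz, so that the terms since the last mark add up to at most
    [run * e <= e]. *)
Lemma chain M : (forall N, \sum_(k < N) k%:R * t k <= M) ->
  exists2 Z : seq nat, (size Z)%:R <= M &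
  forall m : nat -> R, m 0%N = 0 -> {in Z, forall k, m k = 0} ->
  forall N, \sum_(k < N.+1) t k * m k ^+ 2 <= \sum_(k < N) (m k.+1 - m k) ^+ 2.
Proof.
move=> HM.
have cM N : (count marked (iota 0 N))%:R <= M.
  case: N => [|N]; first by apply: le_trans (HM 0%N); rewrite big_ord0.
  apply: le_trans (HM N.+1); apply: le_trans (count_marked N).
  by rewrite lerDl; have /andP[] := run_itv N.
pose P c := `[< exists N, count marked (iota 0 N) = c >].
have exP : exists c, P c by exists 0%N; apply/asboolP; exists 0%N.
have boundP c : P c -> (c <= Num.bound M)%N.
  move=> /asboolP[N <-]; rewrite -(ler_nat R).
  have M0 : 0 <= M by apply: le_trans (cM 0%N).
  by apply: (le_trans (cM N)); apply/ltW/archi_boundP.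
(* The number of marks below any index is bounded, so that all marks lie below
   some [N0]. *)
case: (ex_maxnP exP boundP) => c /asboolP[N0 cN0] cmax.
have last k : marked k -> (k < N0)%N.
  move=> mk; rewrite ltnNge; apply/negP => N0k.
  have : (count marked (iota 0 k.+1) <= c)%N by apply: cmax; apply/asboolP; exists k.+1.
  rewrite -addn1 iotaD count_cat /= add0n mk -{1}(subnKC N0k) iotaD count_cat cN0.
  by rewrite -addnA -[X in (_ <= X)%N]addn0 leq_add2l leqn0 addn_eq0 andbF.
exists [seq k <- iota 0 N0 | marked k]; first by rewrite size_filter.
move=> m m0 mZ.
have mz k : marked k -> m k = 0.
  by move=> mk; apply: mZ; rewrite mem_filter mk mem_iota add0n last.
move=> N; pose S n := \sum_(k < n) (m k.+1 - m k) ^+ 2.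
(* [e] is the energy since the last mark; it restarts from zero at each mark,
   like [run]. *)
have [e [e0 e1 e2 e3]] : exists e, [/\ 0 <= e, e <= S N, m N ^+ 2 <= N%:R * e &
    \sum_(k < N.+1) t k * m k ^+ 2 <= S N - e + run N * e].
  elim: N => [|N [e [e0 e1 e2 e3]]].
    exists 0; rewrite /S !big_ord_recr !big_ord0 m0 /=.
    by split; rewrite ?expr0n ?mulr0 ?addr0 ?subrr.
  have SN : S N.+1 = S N + (m N.+1 - m N) ^+ 2 by rewrite /S big_ord_recr.
  set d := m N.+1 - m N in SN *.
  have d0 : 0 <= d ^+ 2 by rewrite sqr_ge0.
  have /andP[r0 r1] := run_itv N.
  have r1e : run N * e <= e by rewrite ler_piMl.
  have [mk|nmk] := boolP (marked N.+1).
    exists 0; split => //; first by rewrite SN; lra.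
      by rewrite mz// expr0n mulr0.
    rewrite big_ord_recr /= (mz _ mk) expr0n mulr0 addr0 subr0 mulr0 addr0 SN.
    by apply: (le_trans e3); lra.
  exists (e + d ^+ 2).
  have NR : 0 <= N%:R :> R by [].
  have mE : m N.+1 = m N + d by rewrite /d; ring.
  have H : m N.+1 ^+ 2 <= N.+1%:R * (e + d ^+ 2).
    rewrite mE -natr1; set n := N%:R in NR e2 *.
    have [n0|n0] := eqVneq n 0.
      have -> : m N = 0.
        by apply/eqP; rewrite -sqrf_eq0 eq_le sqr_ge0 andbT; move: e2; rewrite n0 mul0r.
      by rewrite n0 !add0r mul1r lerDr.
    have n0' : 0 < n by rewrite lt_neqAle eq_sym n0.
    have : 0 <= n^-1 * (m N - n * d) ^+ 2 + n^-1 * (n * e - m N ^+ 2).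
      by rewrite addr_ge0// mulr_ge0 ?invr_ge0 ?sqr_ge0 ?subr_ge0.
    have -> : n^-1 * (m N - n * d) ^+ 2 + n^-1 * (n * e - m N ^+ 2) =
      e + n * d ^+ 2 - 2 * m N * d by field.
    by lra.
  split => //; [by rewrite addr_ge0|by rewrite SN; lra|].
  rewrite big_ord_recr /= SN.
  move: nmk; rewrite /marked -leNgt => h.
  rewrite ltNge h /=.
  have H1 : t N.+1 * m N.+1 ^+ 2 <= t N.+1 * (N.+1%:R * (e + d ^+ 2)).
    by rewrite ler_wpM2l.
  have H2 : run N * e <= run N * (e + d ^+ 2) by rewrite ler_wpM2l// lerDl.
  apply: (le_trans (lerD e3 H1)); lra.
apply: (le_trans e3).
have /andP[r0 r1] := run_itv N.
have r1e : run N * e <= e by rewrite ler_piMl.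
by rewrite -/(S N); lra.
Qed.

End Chain.

(** * Square annuli *)

Section Annuli.
Context {R : realType}.
Local Notation plane := (measurableTypeR R * measurableTypeR R)%type.
Local Notation mu := (@leb2 R).
Local Notation square := (@square R).
Implicit Types (Q : square) (r : R) (c : int * int).

(** The square of side [r] whose lower left corner has coordinates [c] in
    units of [r]. *)
Definition cell r c : square := Sq (c.1%:~R * r) (c.2%:~R * r) r.

(** The cells of an annulus in the order in which one walks around it, so that
    consecutive ones are adjacent. *)
Definition ring12 : seq (int * int) :=
  [:: (1, 0); (1, 1); (0, 1); (- 1, 1); (- 2, 1); (- 2, 0); (- 2, - 1);
      (- 2, - 2); (- 1, - 2); (0, - 2); (1, - 2); (1, - 1)]%Z.

Definition box r : set plane := [set x | (- r <= x.1 < r) && (- r <= x.2 < r)].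

Lemma measurable_box r : measurable (box r).
Proof.
rewrite (_ : box r = (`[- r, r[%classic : set (measurableTypeR R)) `*`
                     (`[- r, r[%classic : set (measurableTypeR R))).
  by apply: measurableX; exact: measurable_itv.
by apply/seteqP; split => x; rewrite /box /= !in_itv/= => /andP.
Qed.

Lemma box_sub r s : r <= s -> box r `<=` box s.
Proof.
move=> rs x /=; rewrite /box /= => /andP[/andP[? ?] /andP[? ?]].
by apply/andP; split; apply/andP; split; lra.
Qed.

Lemma cell_interval r (i : int) (y : R) : 0 < r ->
  i%:~R * r <= y < i%:~R * r + r -> i = Num.floor (y / r).
Proof.
move=> r0 /andP[h1 h2]; apply/esym/eqP; rewrite Num.Theory.floor_eq.
by rewrite ler_pdivlMr// h1 ltr_pdivrMr// intrD mulrDl mul1r.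
Qed.

Lemma trivIset_cell r : 0 < r -> trivIset [set` ring12] (fun c => sset (cell r c)).
Proof.
move=> r0 [i j] [i' j'] _ _ [x []]; rewrite /sset /cell /=.
move=> /andP[/(cell_interval r0) -> /(cell_interval r0) ->].
by move=> /andP[/(cell_interval r0) -> /(cell_interval r0) ->].
Qed.

Lemma annulus_cells r : 0 < r ->
  box (2 * r) `\` box r = \big[setU/set0]_(c <- ring12) sset (cell r c).
Proof.
move=> r0; rewrite -bigcup_seq; apply/seteqP; split => x.
  move=> [b2 b1].
  suff [c cr xc] : exists2 c, c \in ring12 & sset (cell r c) x by exists c.
  move: b2 b1; rewrite /box /= => /andP[/andP[x1 x2] /andP[y1 y2]] /negP.
  have i1 (z : R) : - (2 * r) <= z -> z < 2 * r -> exists2 i : int,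
      i \in [:: -2; -1; 0; 1]%Z & (i%:~R * r <= z < i%:~R * r + r).
    move=> z1 z2; have [h1|h1] := ltP z (- r).
      by exists (- 2)%Z => //; apply/andP; split; rewrite ?intrN; lra.
    have [h2|h2] := ltP z 0.
      by exists (- 1)%Z => //; apply/andP; split; rewrite ?intrN; lra.
    have [h3|h3] := ltP z r.
      by exists 0%Z => //; apply/andP; split; lra.
    by exists 1%Z => //; apply/andP; split; lra.
  have [i iI xi] := i1 _ x1 x2; have [j jI yj] := i1 _ y1 y2.
  move=> nb; exists (i, j); last by rewrite /sset /cell /= xi yj.
  move: iI jI xi yj nb; rewrite !inE.
  move=> /or4P[] /eqP -> /or4P[] /eqP -> //= /andP[? ?] /andP[? ?] nb;
   exfalso; apply: (negP nb); apply/andP; split; apply/andP; split; lra.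
move=> [c cr]; rewrite /sset /cell /box /=.
move: cr; rewrite /ring12 /= !inE.
do 11! (move=> /orP[/eqP -> /= /andP[/andP[? ?] /andP[? ?]]|];
  first (split; [apply/andP; split; apply/andP; split; lra|
     by move=> /andP[/andP[? ?] /andP[? ?]]; lra])).
move=> /eqP -> /= /andP[/andP[? ?] /andP[? ?]].
by split; [apply/andP; split; apply/andP; split; lra|
     move=> /andP[/andP[? ?] /andP[? ?]]; lra].
Qed.

Lemma integral_annulus r (h : plane -> R) : 0 < r -> measurable_fun setT h ->
  (\int[mu]_(x in box (2 * r) `\` box r) (h x)%:E =
   \sum_(c <- ring12) \int[mu]_(x in sset (cell r c)) (h x)%:E)%E.
Proof.
move=> r0 mh; rewrite annulus_cells//.
apply: (@integral_bigsetU_EFin _ _ _ mu _ (fun c => sset (cell r c))) => //.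
- by move=> c; exact: measurable_sset.
- exact: trivIset_cell.
by apply/measurable_EFinP; exact: (@measurable_funS _ _ _ _ setT).
Qed.

Lemma integral_boxD (a b c : R) (h : plane -> R) : a <= b -> b <= c ->
  measurable_fun setT h ->
  (\int[mu]_(x in box c `\` box a) (h x)%:E =
   \int[mu]_(x in box b `\` box a) (h x)%:E +
   \int[mu]_(x in box c `\` box b) (h x)%:E)%E.
Proof.
move=> ab bc mh.
have -> : box c `\` box a = (box b `\` box a) `|` (box c `\` box b).
  apply/seteqP; split => x.
    by move=> [cx nax]; have [bx|nbx] := pselect (box b x); [left|right].
  move=> [[bx nax]|[cx nbx]]; split => //; first exact: box_sub bx.
  by move=> ax; apply: nbx; exact: box_sub ax.
have mb a' b' : measurable (box a' `\` box b').
  by apply: measurableD; exact: measurable_box.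
apply: (integral_setU_EFin mu (mb _ _) (mb _ _)).
  by apply: (@measurable_funS _ _ _ _ setT).
by apply/disj_setPS => x [[bx _] [_ nbx]].
Qed.

Lemma integral_up N (h : plane -> R) : measurable_fun setT h ->
  (\int[mu]_(x in box (2 ^+ N) `\` box 1) (h x)%:E =
   \sum_(k < N) \sum_(c <- ring12) \int[mu]_(x in sset (cell (2 ^+ k) c)) (h x)%:E)%E.
Proof.
move=> mh; elim: N => [|N IH].
  by rewrite expr0 setDv integral_set0 big_ord0.
have h1 : 1 <= 2 ^+ N :> R by rewrite exprn_ege1// ler1n.
rewrite (@integral_boxD 1 (2 ^+ N))//; last by rewrite exprS; lra.
by rewrite IH big_ord_recr /= exprS integral_annulus// exprn_gt0.
Qed.

Lemma integral_down N (h : plane -> R) : measurable_fun setT h ->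
  (\int[mu]_(x in box 1 `\` box (2 ^- N)) (h x)%:E =
   \sum_(k < N) \sum_(c <- ring12) \int[mu]_(x in sset (cell (2 ^- k.+1) c)) (h x)%:E)%E.
Proof.
move=> mh; elim: N => [|N IH].
  by rewrite expr0 invr1 setDv integral_set0 big_ord0.
have p0 : 0 < 2 ^- N :> R by rewrite invr_gt0 exprn_gt0.
have h1 : 2 ^- N <= 1 :> R by rewrite invf_le1 ?exprn_gt0// exprn_ege1// ler1n.
have h2 : 2 ^- N = 2 * 2 ^- N.+1 :> R by rewrite exprS invfM mulrA mulfV// mul1r.
rewrite (@integral_boxD _ (2 ^- N))//; last by lra.
by rewrite IH big_ord_recr /= addeC {1}h2 integral_annulus.
Qed.

(** The annuli exhaust the plane up to the origin, which is a null set. *)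
Lemma integral_plane_le (h : plane -> R) (B1 B2 : R) : measurable_fun setT h ->
  (forall x, 0 <= h x) ->
  (forall N, (\int[mu]_(x in box (2 ^+ N) `\` box 1) (h x)%:E <= B1%:E)%E) ->
  (forall N, (\int[mu]_(x in box 1 `\` box (2 ^- N)) (h x)%:E <= B2%:E)%E) ->
  (\int[mu]_x (h x)%:E <= (B1 + B2)%:E)%E.
Proof.
move=> mh h0 HB1 HB2.
pose F N := box (2 ^+ N) `\` box (2 ^- N).
have mF N : measurable (F N) by apply: measurableD; exact: measurable_box.
have p2 N : 1 <= 2 ^+ N :> R by rewrite exprn_ege1// ler1n.
have q2 N : 2 ^- N <= 1 :> R by rewrite invf_le1 ?exprn_gt0.
have ndF : nondecreasing_seq F.
  move=> m n mn.
  have mn2 : 2 ^+ m <= 2 ^+ n :> R by apply: ler_weXn2l => //; rewrite ler1n.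
  apply/subsetPset => x [x1 x2]; split.
    exact: box_sub x1.
  apply: contra_not x2; apply: box_sub.
  by rewrite lef_pV2 ?posrE ?exprn_gt0.
have hF N : (\int[mu]_(x in F N) (h x)%:E <= (B1 + B2)%:E)%E.
  rewrite /F (@integral_boxD _ 1)// EFinD addeC.
  by apply: leeD.
have cv := @ge0_nondecreasing_set_cvg_integral _ plane R F (fun x => (h x)%:E) mu ndF mF.
have sE : [set (0, 0) : plane] =
    ([set 0] : set (measurableTypeR R)) `*` ([set 0] : set (measurableTypeR R)).
  by apply/seteqP; split => [_ ->//|[a b] /= [-> ->]].
have m0 : measurable [set (0, 0) : plane].
  by rewrite sE; apply: measurableX; exact: measurable_set1.
have gtpow (y : R) : 0 <= y -> exists n, forall m, (n <= m)%N -> y < 2 ^+ m.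
  move=> y0; exists (Num.bound y) => m nm.
  apply: (lt_le_trans (archi_boundP y0)).
  by rewrite -natrX ler_nat (leq_trans nm)// ltnW// ltn_expl.
have cover : \bigcup_N F N = setT `\` [set (0, 0) : plane].
  apply/seteqP; split => x.
    move=> [N _ [_ nx]]; split => // x0; apply: nx; rewrite x0 /box /=.
    by rewrite oppr_le0 invr_ge0 exprn_ge0//= invr_gt0 exprn_gt0.
  move=> [_ nx].
  pose y := `|x.1| + `|x.2|.
  have y0 : 0 < y.
    have [e1|e1] := eqVneq x.1 0; last by rewrite ltr_pwDl// normr_gt0.
    have [e2|e2] := eqVneq x.2 0; last by rewrite ltr_wpDl// normr_gt0.
    by exfalso; apply: nx; case: x e1 e2 {y} => /= ? ? -> ->.
  have [n1 H1] := gtpow y (ltW y0).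
  have [|n2 H2] := gtpow (y^-1 * 2); first by rewrite mulr_ge0// invr_ge0 ltW.
  pose N := (n1 + n2)%N; exists N => //.
  have {}H1 : y < 2 ^+ N by apply: H1; exact: leq_addr.
  have {}H2 : y^-1 * 2 < 2 ^+ N by apply: H2; exact: leq_addl.
  have a1 := ler_norm x.1; have a2 := ler_norm x.2.
  have a3 := ler_norm (- x.1); have a4 := ler_norm (- x.2).
  have a5 := normr_ge0 x.1; have a6 := normr_ge0 x.2.
  rewrite !normrN in a3 a4.
  split.
    by rewrite /box /=; apply/andP; split; apply/andP; split; rewrite /y in H1; lra.
  rewrite /box /= => /andP[/andP[b1 b2] /andP[b3 b4]].
  have H3 : 2 * 2 ^- N < y.
    by move: H2; rewrite -ltr_pdivlMl ?invr_gt0// invrK -ltr_pdivrMr ?exprn_gt0// mulrC.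
  have c1 : `|x.1| <= 2 ^- N by rewrite ler_norml b1 ltW.
  have c2 : `|x.2| <= 2 ^- N by rewrite ler_norml b3 ltW.
  have : y <= 2 * 2 ^- N by rewrite /y; lra.
  by rewrite leNgt H3.
have E : (\int[mu]_x (h x)%:E = \int[mu]_(x in \bigcup_N F N) (h x)%:E)%E.
  rewrite cover; apply: ge0_negligible_integral => //.
  - exact/measurable_EFinP.
  - by move=> x _; rewrite lee_fin.
  - rewrite sE leb2X; [|exact: measurable_set1..].
    by rewrite lebesgue_measure_set1 mul0e.
rewrite E.
have {}cv : (\int[mu]_(x in F N) (h x)%:E @[N --> \oo] --> \int[mu]_(x in \bigcup_N F N) (h x)%:E)%E.
  apply: cv => [N|N x _]; last by rewrite lee_fin.
  by apply/measurable_EFinP; exact: (@measurable_funS _ _ _ _ setT).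
rewrite -(cvg_lim _ cv)//; apply: lime_le; first by apply/cvg_ex; eexists; exact: cv.
exact: nearW.
Qed.

End Annuli.

(** * Averages over the cells of an annulus *)

Section RingAverages.
Context {R : realType}.
Local Notation plane := (measurableTypeR R * measurableTypeR R)%type.
Local Notation mu := (@leb2 R).
Local Notation square := (@square R).
Implicit Types (Q : square) (r : R) (j : int * int).

Definition rmass (G : plane -> R) r : R := \sum_(j <- ring12) mass G (cell r j).

(** The cell whose average stands for the mean of [f] over the annulus. *)
Definition base (f : plane -> R) r : R := avg f (cell r (1, 0)).

Section Pair.
Context (f G : plane -> R) (fG : sobolev_pair f G).

Lemma telescope_sqr (a : nat -> R) n :
  (a n - a 0%N) ^+ 2 <= n%:R * \sum_(k < n) (a k.+1 - a k) ^+ 2.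
Proof.
have C (m : nat -> R) N : (\sum_(k < N) m k) ^+ 2 <= N%:R * \sum_(k < N) m k ^+ 2.
  elim: N => [|N IH]; first by rewrite !big_ord0 expr0n mulr0.
  rewrite !big_ord_recr /= -natr1; set n' := N%:R in IH *.
  set S := \sum_(i < N) m i in IH *; set T := \sum_(i < N) m i ^+ 2 in IH *.
  have : 0 <= \sum_(i < N) (m i - m N) ^+ 2 by rewrite sumr_ge0// => i _; exact: sqr_ge0.
  have -> : \sum_(i < N) (m i - m N) ^+ 2 = T - 2 * m N * S + n' * m N ^+ 2.
    rewrite /T /S /n' big_distrr /= -[in RHS]sumrB.
    have -> : N%:R * m N ^+ 2 = \sum_(i < N) m N ^+ 2.
      by rewrite sumr_const card_ord mulr_natl.
    by rewrite -big_split /=; apply: eq_bigr => i _; ring.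
  by lra.
have <- : \sum_(k < n) (a k.+1 - a k) = a n - a 0%N.
  by rewrite -(big_mkord xpredT (fun k => a k.+1 - a k)) telescope_sumr.
exact: (C (fun k => a k.+1 - a k) n).
Qed.

Lemma mass_le_rmass r j : j \in ring12 -> mass G (cell r j) <= rmass G r.
Proof.
move=> jr; rewrite /rmass (big_rem j)//= lerDl sumr_ge0// => i _.
exact: (mass_ge0 fG).
Qed.

Lemma rmass_ge0 r : 0 <= rmass G r.
Proof. by apply: sumr_ge0 => i _; exact: (mass_ge0 fG). Qed.

Lemma ring_adjacent r n : (n < 11)%N -> exists i,
  cell r (nth (0, 0)%Z ring12 n.+1) = shiftq i (cell r (nth (0, 0)%Z ring12 n)) \/
  cell r (nth (0, 0)%Z ring12 n) = shiftq i (cell r (nth (0, 0)%Z ring12 n.+1)).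
Proof.
have E (x y x' y' : R) : x = x' -> y = y' -> Sq x y r = Sq x' y' r by move=> -> ->.
case: n => [|[|[|[|[|[|[|[|[|[|[|//]]]]]]]]]]] _.
- by exists 1; left; rewrite /shiftq /cell /=; apply: E; ring.
- by exists 0; right; rewrite /shiftq /cell /=; apply: E; ring.
- by exists 0; right; rewrite /shiftq /cell /=; apply: E; ring.
- by exists 0; right; rewrite /shiftq /cell /=; apply: E; ring.
- by exists 1; right; rewrite /shiftq /cell /=; apply: E; ring.
- by exists 1; right; rewrite /shiftq /cell /=; apply: E; ring.
- by exists 1; right; rewrite /shiftq /cell /=; apply: E; ring.
- by exists 0; left; rewrite /shiftq /cell /=; apply: E; ring.
- by exists 0; left; rewrite /shiftq /cell /=; apply: E; ring.
- by exists 0; left; rewrite /shiftq /cell /=; apply: E; ring.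
- by exists 1; left; rewrite /shiftq /cell /=; apply: E; ring.
Qed.

(** At most eleven steps lead around the annulus from the reference cell, and
    each squared step is at most [4 * rmass G r]; the constant is [11 * 11 *
    4]. *)
Lemma ring_avg r j : 0 < r -> j \in ring12 ->
  (avg f (cell r j) - base f r) ^+ 2 <= 484 * rmass G r.
Proof.
move=> r0 jr.
pose a n := avg f (cell r (nth (0, 0)%Z ring12 n)).
have an : avg f (cell r j) = a (index j ring12) by rewrite /a nth_index.
have a0 : base f r = a 0%N by [].
have n12 : (index j ring12 < 12)%N by rewrite -[12%N]/(size ring12) index_mem.
rewrite an a0; apply: (le_trans (telescope_sqr a _)).
set n := index j ring12 in n12 *.
have m0 := rmass_ge0 r.
have step k : (k < 11)%N -> (a k.+1 - a k) ^+ 2 <= 4 * rmass G r.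
  move=> k11; have [i H] := ring_adjacent r k11.
  have k1 : nth (0, 0)%Z ring12 k \in ring12 by apply: mem_nth; rewrite /= ltnS ltnW.
  have k2 : nth (0, 0)%Z ring12 k.+1 \in ring12 by apply: mem_nth; rewrite /= ltnS.
  have h1 := mass_le_rmass r k1; have h2 := mass_le_rmass r k2.
  case: H => H.
    have := @sp_adj _ _ _ fG i (cell r (nth (0, 0)%Z ring12 k)) r0.
    by rewrite -H -/(a k) -/(a k.+1) -sqrrN opprB; lra.
  have := @sp_adj _ _ _ fG i (cell r (nth (0, 0)%Z ring12 k.+1)) r0.
  by rewrite -H -/(a k) -/(a k.+1); lra.
have S1 : \sum_(k < n) (a k.+1 - a k) ^+ 2 <= 11 * (4 * rmass G r).
  apply: (@le_trans _ _ (\sum_(k < n) 4 * rmass G r)).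
    by apply: ler_sum => k _; apply: step; rewrite (leq_trans (ltn_ord k)).
  rewrite sumr_const card_ord -[X in X <= _]mulr_natl ler_wpM2r ?mulr_ge0//.
  by rewrite ler_nat.
apply: (@le_trans _ _ (11 * (11 * (4 * rmass G r)))); last by lra.
apply: ler_pM => //; last by rewrite ler_nat.
by apply: sumr_ge0 => k _; exact: sqr_ge0.
Qed.

(** The lower left child of the reference cell of radius [2 r] is the right
    neighbour of the one of radius [r]. *)
Lemma base_link r : 0 < r ->
  (base f r - base f (2 * r)) ^+ 2 <= 20 * (rmass G r + rmass G (2 * r)).
Proof.
move=> r0.
have r20 : 0 < 2 * r by rewrite mulr_gt0.
pose P := cell (2 * r) (1, 0)%Z.
pose C := child P (false, false).
have CE : C = shiftq 0 (cell r (1, 0)%Z).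
  have E (x y s x' y' s' : R) : x = x' -> y = y' -> s = s' -> Sq x y s = Sq x' y' s'.
    by move=> -> -> ->.
  by rewrite /C /P /child /shiftq /cell /=; apply: E; field.
have h1 := @sp_adj _ _ _ fG 0 (cell r (1, 0)%Z) r0.
rewrite -CE -/(base f r) in h1.
have h2 := child_avg fG (false, false) (r20 : 0 < sqs P).
rewrite -/C -/(base f (2 * r)) in h2.
have h3 : mass G C <= mass G P.
  rewrite (mass_kids fG P) /kids big_cons lerDl.
  by apply: sumr_ge0 => k _; exact: (mass_ge0 fG).
have h4 : mass G P <= rmass G (2 * r) by exact: mass_le_rmass.
have h5 : mass G (cell r (1, 0)%Z) <= rmass G r by exact: mass_le_rmass.
have h6 := rmass_ge0 r; have h7 := rmass_ge0 (2 * r).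
have -> : base f r - base f (2 * r) = (base f r - avg f C) + (avg f C - base f (2 * r)).
  by ring.
have := sqr_ge0 ((base f r - avg f C) - (avg f C - base f (2 * r))).
move: h1 h2; set u := base f r - avg f C; set v := avg f C - base f (2 * r).
by move=> h1 h2 h; have : (u + v) ^+ 2 <= 2 * u ^+ 2 + 2 * v ^+ 2; lra.
Qed.

Lemma massE Q : (\int[mu]_(x in sset Q) (G x)%:E = (mass G Q)%:E)%E.
Proof.
rewrite /mass /Rintegral fineK//; apply: integrable_fin_num.
  exact: measurable_sset.
exact: (integrable_mass fG).
Qed.

Lemma sum_rmass_le (r : nat -> R) N (A : set plane) : measurable A ->
  (\int[mu]_(x in A) (G x)%:E =
    \sum_(k < N) \sum_(j <- ring12) \int[mu]_(x in sset (cell (r k) j)) (G x)%:E)%E ->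
  \sum_(k < N) rmass G (r k) <= \int[mu]_x G x.
Proof.
move=> mA E; rewrite -lee_fin /Rintegral fineK; last first.
  exact: integrable_fin_num (sp_iG fG).
apply: (@le_trans _ _ (\int[mu]_(x in A) (G x)%:E)%E); last first.
  apply: ge0_subset_integral => //.
    by apply/measurable_EFinP; exact: (sp_mG fG).
  by move=> x _; rewrite lee_fin; exact: (sp_G0 fG).
rewrite E -sumEFin; apply: lee_sum => k _; rewrite /rmass -sumEFin.
by apply: lee_sum => j _; rewrite massE.
Qed.

Lemma sum_rmass_up N : \sum_(k < N) rmass G (2 ^+ k) <= \int[mu]_x G x.
Proof.
apply: (@sum_rmass_le (fun k => 2 ^+ k) _ (box (2 ^+ N) `\` box 1)).
  by apply: measurableD; exact: measurable_box.
by apply: integral_up; exact: (sp_mG fG).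
Qed.

Lemma sum_rmass_down N : \sum_(k < N) rmass G (2 ^- k.+1) <= \int[mu]_x G x.
Proof.
apply: (@sum_rmass_le (fun k => 2 ^- k.+1) _ (box 1 `\` box (2 ^- N))).
  by apply: measurableD; exact: measurable_box.
by apply: integral_down; exact: (sp_mG fG).
Qed.

End Pair.
End RingAverages.

(** * Controlling the potential energy on the plane *)

Section GlobalControl.
Context {R : realType}.
Local Notation plane := (measurableTypeR R * measurableTypeR R)%type.
Local Notation mu := (@leb2 R).
Local Notation square := (@square R).
Implicit Types (Q : square) (r : R) (j : int * int).
Context (V : plane -> R) (p c : R) (p1 : 1 < p) (c0 : 0 < c).
Context (mV : measurable_fun setT V) (V0 : forall x, 0 <= V x).

Local Notation exc := (excess V p c).

Definition tring r : R := \sum_(j <- ring12) exc (cell r j) `^ (1 / p).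

Definition Cring : R := 4 * Ktree (expo p) + (96 * 484).

Let p0 : 0 < p. Proof. exact: lt_trans p1. Qed.
Let K0 : 0 < Ktree (expo p). Proof. exact/Ktree_gt0/expo_gt0. Qed.
Let e0 Q : 0 <= exc Q. Proof. exact: (excess_ge0 V p c Q). Qed.

Lemma tring_ge0 r : 0 <= tring r.
Proof. by apply: sumr_ge0 => j _; exact: powR_ge0. Qed.

Lemma root_gt1 x : 1 < x -> 1 < x `^ (1 / p).
Proof.
move=> x1; have ip : 0 < 1 / p by rewrite divr_gt0.
have := @gt0_ltr_powR R (1 / p) ip 1 x.
by rewrite powR1; apply; rewrite ?nnegrE// ltW// (lt_trans _ x1).
Qed.

Lemma root_le1 x : 0 <= x -> x <= 1 -> x `^ (1 / p) <= 1.
Proof.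
move=> x0 x1; have ip : 0 <= 1 / p by rewrite divr_ge0// ltW.
by have := @ge0_ler_powR R (1 / p) ip x 1; rewrite powR1; apply; rewrite ?nnegrE.
Qed.

(** A cell of excess larger than one is subdivided, and constraints on its
    subsquares leave nothing but the gradient. Otherwise no constraint is
    imposed, and the average of [f] over the cell is compared with the one
    over the reference cell, at the price of a term in [base f r]. *)
Lemma cell_controls r j : 0 < r -> j \in ring12 -> pfinite V p (cell r j) ->
  exists L, [/\ (size L)%:R <= Csize p * exc (cell r j) `^ (1 / p),
    (exc (cell r j) <= 1 -> L = [::]) &
    forall f G : plane -> R, sobolev_pair f G ->
    (forall Q', List.In Q' L -> avg f Q' = 0) ->
    (\int[mu]_(x in sset (cell r j)) (V x * f x ^+ 2)%:E <=
      (c * (4 * Ktree (expo p) * mass G (cell r j) + (8 * 484) * rmass G r +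
        8 * exc (cell r j) `^ (1 / p) * base f r ^+ 2))%:E)%E].
Proof.
move=> r0 jr fQ; set Q := cell r j.
have s0 : 0 < sqs Q by [].
have [e1|e1] := leP (exc Q) 1; last first.
  have [L L1 L2] := subdivide p1 c0 mV V0 s0 fQ e1.
  exists L; split; [exact: L1|by []|move=> f G fG fL].
  apply: (le_trans (L2 f G fG fL)); rewrite lee_fin.
  have -> : 2 * Ktree (expo p) * c * mass G Q = c * (2 * Ktree (expo p) * mass G Q).
    by ring.
  rewrite ler_wpM2l ?(ltW c0)//.
  have h1 : 0 <= Ktree (expo p) * mass G Q.
    by rewrite mulr_ge0 ?(mass_ge0 fG)// ltW.
  have h2 := rmass_ge0 fG r.
  have h3 : 0 <= 8 * exc Q `^ (1 / p) * base f r ^+ 2.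
    by rewrite mulr_ge0 ?sqr_ge0// mulr_ge0// powR_ge0.
  by lra.
exists [::]; split => //; first by rewrite mulr_ge0 ?powR_ge0// ltW// Csize_gt0.
move=> f G fG _.
have mQ := measurable_sset Q.
have mS := @measurable_EFin_sset R Q.
have mf := sp_mf fG.
set a := avg f Q; set b := base f r; set e := exc Q `^ (1 / p).
have HV : (\int[mu]_(x in sset Q) (V x)%:E <= (2 * c * e)%:E)%E.
  have pm : (\int[mu]_(x in sset Q) (V x `^ p)%:E <= (pmass V p Q)%:E)%E.
    by rewrite pmassE.
  have := square_holder p1 mV V0 s0 (pmass_ge0 V p Q) pm.
  by rewrite -[2 * (1 - 1 / p)]/(expo p) -mulrA (scale_excess V p1 c0)// -/e mulrA.
have HP := excess_le1_poincare p1 c0 mV V0 s0 fQ e1 fG.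
have mh : measurable_fun (sset Q) (fun x => (V x * (f x - a) ^+ 2)%:E).
  by apply: mS; apply: measurable_funM => //; apply: measurable_funX; exact: measurable_funB.
have mVS : measurable_fun (sset Q) (fun x => (V x)%:E) by exact: mS.
apply: (@le_trans _ _ (\int[mu]_(x in sset Q)
   (2%:E * (V x * (f x - a) ^+ 2)%:E + (2 * a ^+ 2)%:E * (V x)%:E))%E).
  apply: ge0_le_integral => //.
  - by move=> x _; rewrite lee_fin mulr_ge0 ?sqr_ge0.
  - by apply: mS; apply: measurable_funM => //; exact: measurable_funX.
  - by apply: emeasurable_funD; exact: measurable_funeM.
  - move=> x _; rewrite -!EFinM -EFinD lee_fin.
    have := mulr_ge0 (V0 x) (sqr_ge0 (f x - a - a)); lra.
have n1 x : (0 <= (V x * (f x - a) ^+ 2)%:E)%E by rewrite lee_fin mulr_ge0 ?sqr_ge0.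
have n2 x : (0 <= (V x)%:E)%E by rewrite lee_fin.
have a20 : 0 <= 2 * a ^+ 2 by rewrite mulr_ge0// sqr_ge0.
rewrite ge0_integralD//; last first.
- exact: measurable_funeM.
- by move=> x _; rewrite mule_ge0.
- exact: measurable_funeM.
- by move=> x _; rewrite mule_ge0.
rewrite !ge0_integralZl//.
apply: (@le_trans _ _ (2%:E * (2 * Ktree (expo p) * c * mass G Q)%:E +
   (2 * a ^+ 2)%:E * (2 * c * e)%:E)%E).
  by apply: leeD; apply: lee_pmul => //; exact: integral_ge0.
rewrite -!EFinM -EFinD lee_fin.
have ha : a ^+ 2 <= (2 * 484) * rmass G r + 2 * b ^+ 2.
  have := ring_avg fG r0 jr; rewrite -/Q -/a -/b.
  by have := sqr_ge0 (a - b - b); lra.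
have e00 : 0 <= e by exact: powR_ge0.
have e11 : e <= 1 by exact: root_le1.
have h2 := rmass_ge0 fG r.
have hm : a ^+ 2 * e <= (2 * 484) * rmass G r + 2 * e * b ^+ 2.
  apply: (le_trans (ler_wpM2r e00 ha)).
  have : rmass G r * e <= rmass G r by rewrite ler_piMr.
  lra.
have -> : 2 * (2 * Ktree (expo p) * c * mass G Q) + 2 * a ^+ 2 * (2 * c * e) =
   c * (4 * Ktree (expo p) * mass G Q + 4 * (a ^+ 2 * e)) by ring.
rewrite ler_wpM2l ?(ltW c0)//; lra.
Qed.

Lemma In_flatten_map (T U : Type) (F : T -> seq U) (s : seq T) t u :
  List.In t s -> List.In u (F t) -> List.In u (flatten (map F s)).
Proof.
elim: s => //= t' s IH [->|ts] uF; apply/List.in_or_app; first by left.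
by right; exact: IH.
Qed.

Lemma In_mem (T : eqType) (s : seq T) x : x \in s -> List.In x s.
Proof.
elim: s => //= y s IH; rewrite inE => /orP[/eqP ->|xs]; first by left.
by right; exact: IH.
Qed.

(** If [tring r <= 1] then every cell has excess at most one. This matters for
    finiteness: only finitely many annuli contribute squares. *)
Lemma annulus_controls r : 0 < r ->
  (forall j, j \in ring12 -> pfinite V p (cell r j)) ->
  exists L, [/\ (size L)%:R <= Csize p * tring r, (tring r <= 1 -> L = [::]) &
    forall f G : plane -> R, sobolev_pair f G ->
    (forall Q', List.In Q' L -> avg f Q' = 0) ->
    (\sum_(j <- ring12) \int[mu]_(x in sset (cell r j)) (V x * f x ^+ 2)%:E <=
      (c * (Cring * rmass G r + 8 * tring r * base f r ^+ 2))%:E)%E].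
Proof.
move=> r0 fin.
have Hj j : exists L, j \in ring12 -> [/\ (size L)%:R <= Csize p * exc (cell r j) `^ (1 / p),
    (exc (cell r j) <= 1 -> L = [::]) &
    forall f G : plane -> R, sobolev_pair f G ->
    (forall Q', List.In Q' L -> avg f Q' = 0) ->
    (\int[mu]_(x in sset (cell r j)) (V x * f x ^+ 2)%:E <=
      (c * (4 * Ktree (expo p) * mass G (cell r j) + (8 * 484) * rmass G r +
        8 * exc (cell r j) `^ (1 / p) * base f r ^+ 2))%:E)%E].
  have [jr|jr] := boolP (j \in ring12); last by exists [::].
  by have [L HL] := cell_controls r0 jr (fin j jr); exists L.
have /choice[L HL] := Hj.
exists (flatten [seq L j | j <- ring12]); split.
- rewrite size_flatten /shape -map_comp sumnE big_map natr_sum /tring big_distrr /=.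
  rewrite big_seq [leRHS]big_seq; apply: ler_sum => j jr /=.
  by have [] := HL j jr.
- move=> t1; have E : forall j, j \in ring12 -> L j = [::].
    move=> j jr; have [_ H _] := HL j jr; apply: H.
    rewrite leNgt; apply/negP => /root_gt1; rewrite ltNge => /negP; apply.
    apply: le_trans t1; rewrite /tring (big_rem j)//= lerDl sumr_ge0// => i _.
    exact: powR_ge0.
  by rewrite (_ : [seq L j | j <- ring12] = [seq [::] | j <- ring12])//; apply/eq_in_map.
- move=> f G fG fL.
  apply: (@le_trans _ _ (\sum_(j <- ring12) (c * (4 * Ktree (expo p) * mass G (cell r j) +
      (8 * 484) * rmass G r + 8 * exc (cell r j) `^ (1 / p) * base f r ^+ 2))%:E)%E).
    rewrite big_seq [leRHS]big_seq; apply: lee_sum => j jr.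
    have [_ _ H] := HL j jr; apply: H => // Q' Q'L; apply: fL.
    apply: (In_flatten_map (t := j)) => //.
    exact: In_mem.
  rewrite sumEFin lee_fin -big_distrr /= ler_wpM2l ?(ltW c0)//.
  have E1 : \sum_(j <- ring12) 4 * Ktree (expo p) * mass G (cell r j) =
      4 * Ktree (expo p) * rmass G r by rewrite /rmass big_distrr.
  have E2 : \sum_(j <- ring12) 8 * 484 * rmass G r = 96 * 484 * rmass G r.
    by rewrite /ring12 !big_cons big_nil; ring.
  have E3 : \sum_(j <- ring12) 8 * exc (cell r j) `^ (1 / p) * base f r ^+ 2 =
      8 * tring r * base f r ^+ 2 by rewrite /tring big_distrr big_distrl.
  rewrite big_split big_split /= E1 E2 E3.
  by rewrite /Cring; lra.
Qed.

Definition Cdir : R := 2 * Cring + 640.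

(** One of the two directions, towards infinity or towards the origin. The
    averages [base f (r k)] are constrained at the marked places of [chain],
    which bounds [\sum tring (r k) * base f (r k) ^ 2] by the sum of the
    squared increments of [base f (r k)], and these by the gradient. As [tring
    (r k)] tends to zero, the list of squares is finite. *)
Lemma direction_controls (r : nat -> R) (M : R) :
  (forall k, 0 < r k) ->
  (forall k j, j \in ring12 -> pfinite V p (cell (r k) j)) ->
  (forall N, \sum_(k < N) (1 + k%:R) * tring (r k) <= M) ->
  exists2 L, (size L)%:R <= (1 + Csize p) * M &
  forall f G : plane -> R, sobolev_pair f G ->
    (forall k, (base f (r k.+1) - base f (r k)) ^+ 2 <=
       20 * (rmass G (r k) + rmass G (r k.+1))) ->
    (forall N, \sum_(k < N) rmass G (r k) <= 2 * \int[mu]_x G x) ->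
    base f (r 0%N) = 0 ->
    (forall Q', List.In Q' L -> avg f Q' = 0) ->
    forall N, (\sum_(k < N) \sum_(j <- ring12)
      \int[mu]_(x in sset (cell (r k) j)) (V x * f x ^+ 2)%:E <=
      (c * Cdir * \int[mu]_x G x)%:E)%E.
Proof.
move=> r0 fin HM.
have t0 k := tring_ge0 (r k).
have HMk N : \sum_(k < N) k%:R * tring (r k) <= M.
  apply: le_trans (HM N); apply: ler_sum => k _.
  by rewrite ler_wpM2r// lerDr.
have HMt N : \sum_(k < N) tring (r k) <= M.
  apply: le_trans (HM N); apply: ler_sum => k _.
  by rewrite -{1}[tring _]mul1r ler_wpM2r// lerDl.
have [Z sZ HZ] := chain t0 HMk.
have /choice[L HL] := fun k => annulus_controls (r0 k) (fin k).
have [N0 HN0] : exists N0, forall k, (N0 <= k)%N -> tring (r k) <= 1.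
  have cs : cvgn (series (fun k => tring (r k))).
    apply: nondecreasing_is_cvgn.
      by apply: nondecreasing_series => k _ _; exact: t0.
    by exists M => _ [n _ <-]; rewrite /series /= big_mkord.
  have /cvgr0Pnorm_le /(_ _ ltr01) [N0 _ H] := cvg_series_cvg_0 cs.
  by exists N0 => k /H; apply: le_trans; exact: ler_norm.
exists ([seq cell (r k) (1, 0)%Z | k <- Z] ++ flatten [seq L k | k <- iota 0 N0]).
  rewrite size_cat size_map natrD mulrDl mul1r lerD//.
  rewrite size_flatten /shape -map_comp sumnE big_map natr_sum.
  apply: (@le_trans _ _ (\sum_(k <- iota 0 N0) Csize p * tring (r k))).
    by apply: ler_sum => k _; have [] := HL k.
  rewrite -big_distrr /= ler_wpM2l ?(ltW (Csize_gt0 p1))//.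
  by rewrite -{1}[N0]subn0 -/(index_iota 0 N0) big_mkord.
move=> f G fG link sumD b0 fL N.
set D := \int[mu]_x G x in sumD *.
have fLk k Q' : List.In Q' (L k) -> avg f Q' = 0.
  move=> Q'L; have [kN|kN] := ltnP k N0.
    apply: fL; apply/List.in_or_app; right.
    by apply: (In_flatten_map (t := k)) => //; apply: In_mem; rewrite mem_iota add0n.
  by have [_ E _] := HL k; move: Q'L; rewrite E// HN0.
have fZ : {in Z, forall k, base f (r k) = 0}.
  move=> k kZ; apply: fL; apply/List.in_or_app; left.
  exact: (List.in_map (fun k => cell (r k) (1, 0)%Z) Z k (In_mem kZ)).
have ch := HZ (fun k => base f (r k)) b0 fZ.
apply: (@le_trans _ _ (\sum_(k < N)
   (c * (Cring * rmass G (r k) + 8 * tring (r k) * base f (r k) ^+ 2))%:E)%E).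
  by apply: lee_sum => k _; have [_ _ H] := HL k; apply: H => // Q'; exact: fLk.
rewrite sumEFin lee_fin -big_distrr /= -mulrA ler_wpM2l ?(ltW c0)//.
rewrite big_split /= -big_distrr /=.
have -> : \sum_(k < N) 8 * tring (r k) * base f (r k) ^+ 2 =
    8 * \sum_(k < N) tring (r k) * base f (r k) ^+ 2.
  by rewrite big_distrr /=; apply: eq_bigr => k _; rewrite mulrA.
have CR0 : 0 <= Cring by rewrite /Cring; have := K0; lra.
have H1 : Cring * \sum_(k < N) rmass G (r k) <= Cring * (2 * D) by rewrite ler_wpM2l.
have H2 : \sum_(k < N) tring (r k) * base f (r k) ^+ 2 <= 80 * D.
  apply: (@le_trans _ _ (\sum_(k < N.+1) tring (r k) * base f (r k) ^+ 2)).
    by rewrite big_ord_recr /= lerDl mulr_ge0// sqr_ge0.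
  apply: (le_trans (ch N)).
  apply: (@le_trans _ _ (\sum_(k < N) 20 * (rmass G (r k) + rmass G (r k.+1)))).
    by apply: ler_sum => k _; exact: link.
  rewrite -big_distrr /= big_split /=.
  have S1 := sumD N.
  have S2 : \sum_(k < N) rmass G (r k.+1) <= 2 * D.
    apply: le_trans (sumD N.+1); rewrite big_ord_recl /= lerDr.
    exact: (rmass_ge0 fG).
  by lra.
by rewrite /Cdir; lra.
Qed.

(** The first square of the list, the reference cell of radius one, is the
    starting point of both directions. *)
Lemma global_controls (M : R) :
  (forall k j, j \in ring12 -> pfinite V p (cell (2 ^+ k) j)) ->
  (forall k j, j \in ring12 -> pfinite V p (cell (2 ^- k) j)) ->
  (forall N, \sum_(k < N) (1 + k%:R) * tring (2 ^+ k) <= M) ->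
  (forall N, \sum_(k < N) (1 + k%:R) * tring (2 ^- k) <= M) ->
  exists2 L, (size L)%:R <= 1 + 2 * (1 + Csize p) * M &
  forall f G : plane -> R, sobolev_pair f G ->
    (forall Q', List.In Q' L -> avg f Q' = 0) ->
    base f 1 = 0 /\
    (\int[mu]_x (V x * f x ^+ 2)%:E <= (2 * c * Cdir * \int[mu]_x G x)%:E)%E.
Proof.
move=> fin1 fin2 M1 M2.
have r1 k : 0 < 2 ^+ k :> R by rewrite exprn_gt0.
have r2 k : 0 < 2 ^- k :> R by rewrite invr_gt0.
have [L1 sL1 HL1] := direction_controls r1 fin1 M1.
have [L2 sL2 HL2] := direction_controls r2 fin2 M2.
exists (cell 1 (1, 0)%Z :: L1 ++ L2).
  by rewrite /= -natr1 size_cat natrD; lra.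
move=> f G fG fL.
have b1 : base f 1 = 0 by apply: fL; left.
split => //.
have fL1 Q' : List.In Q' L1 -> avg f Q' = 0.
  by move=> H; apply: fL; right; apply/List.in_or_app; left.
have fL2 Q' : List.In Q' L2 -> avg f Q' = 0.
  by move=> H; apply: fL; right; apply/List.in_or_app; right.
set D := \int[mu]_x G x.
have D0 : 0 <= D by apply: Rintegral_ge0 => x _; exact: (sp_G0 fG).
have mf := sp_mf fG.
have mVf : measurable_fun setT (fun x => V x * f x ^+ 2).
  by apply: measurable_funM => //; exact: measurable_funX.
have -> : 2 * c * Cdir * D = c * Cdir * D + c * Cdir * D by ring.
apply: integral_plane_le => //.
- by move=> x; rewrite mulr_ge0 ?sqr_ge0.
- move=> N; rewrite integral_up//; apply: (HL1 f G fG _ _ _ fL1).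
  + by move=> k; have := base_link fG (r1 k); rewrite -[2 * _]exprS -sqrrN opprB.
  + by move=> n; apply: (le_trans (sum_rmass_up fG n)); rewrite -/D; lra.
  + by rewrite expr0.
- move=> N; rewrite integral_down//.
  have H : (\sum_(k < N.+1) \sum_(j <- ring12)
      \int[mu]_(x in sset (cell (2 ^- k) j)) (V x * f x ^+ 2)%:E <=
      (c * Cdir * D)%:E)%E.
    apply: (HL2 f G fG _ _ _ fL2).
    + move=> k; have E : 2 ^- k = 2 * 2 ^- k.+1 :> R.
        by rewrite exprS invfM mulrA mulfV// mul1r.
      by have := base_link fG (r2 k.+1); rewrite -E [rmass _ _ + _]addrC.
    + case=> [|n]; first by rewrite big_ord0 mulr_ge0.
      rewrite big_ord_recl /= expr0 invr1.
      have h1 := sum_rmass_up fG 1; rewrite big_ord_recl big_ord0 /= addr0 expr0 in h1.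
      have h2 := sum_rmass_down fG n.
      by apply: (le_trans (lerD h1 h2)); rewrite -/D; lra.
    + by rewrite expr0 invr1.
  apply: le_trans H; rewrite big_ord_recl /= leeDr//.
  apply: sume_ge0 => j _; apply: integral_ge0 => x _.
  by rewrite lee_fin mulr_ge0 ?sqr_ge0.
Qed.

End GlobalControl.

(** * Functions with zero gradient *)

Section ZeroEnergy.
Context {R : realType}.
Local Notation plane := (measurableTypeR R * measurableTypeR R)%type.
Local Notation mu := (@leb2 R).

(** If the gradient vanishes, adjacent averages are equal, so that the
    reference averages of all annuli, and then the averages over all cells,
    are zero; the Poincare inequality with constant weight concludes. *)
Lemma zero_energy (f G : plane -> R) : sobolev_pair f G ->
  \int[mu]_x G x = 0 -> base f 1 = 0 -> {ae mu, forall x, f x = 0}.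
Proof.
move=> fG D0 b1.
have m0 Q : mass G Q = 0.
  have DE : (\int[mu]_x (G x)%:E = 0%:E)%E.
    by rewrite -D0 /Rintegral fineK// integrable_fin_num// (sp_iG fG).
  apply/eqP; rewrite eq_le (mass_ge0 fG) andbT -lee_fin -(massE fG) -DE.
  apply: ge0_subset_integral => //; first exact: measurable_sset.
    by apply/measurable_EFinP; exact: (sp_mG fG).
  by move=> x _; rewrite lee_fin; exact: (sp_G0 fG).
have rm0 r : rmass G r = 0 by rewrite /rmass big1.
have sq0 (y : R) : y ^+ 2 <= 0 -> y = 0.
  by move=> h; apply/eqP; rewrite -sqrf_eq0 eq_le h sqr_ge0.
have link r : 0 < r -> base f r = base f (2 * r).
  move=> r0; apply/eqP; rewrite -subr_eq0; apply/eqP; apply: sq0.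
  by have := base_link fG r0; rewrite !rm0 addr0 mulr0.
have cell0 r j : 0 < r -> base f r = 0 -> j \in ring12 ->
    (\int[mu]_(x in sset (cell r j)) (f x ^+ 2)%:E <= 0%:E)%E.
  move=> r0 b0 jr.
  have a0 : avg f (cell r j) = 0.
    by apply: sq0; have := ring_avg fG r0 jr; rewrite b0 subr0 rm0 mulr0.
  have := @square_poincare R f G (cst 1) 2 1 (cell r j) fG (measurable_cst _)
    (fun _ => ler01) (ltr0n _ 2) ler01 r0.
  rewrite m0 mulr0 a0 => H.
  rewrite (eq_integral (fun x => (cst 1 x * (f x - 0) ^+ 2)%:E)) => [|x _]; last first.
    by rewrite subr0 mul1r.
  apply: H => Q' _ s'0; rewrite (eq_integral (cst 1%:E))// integral_cst; last first.
    exact: measurable_sset.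
  by rewrite mul1e leb2_sset ?(ltW s'0)// mul1r powR_mulrn// ltW.
have bu k : base f (2 ^+ k) = 0.
  elim: k => [|k IH]; first by rewrite expr0.
  by rewrite exprS -link ?exprn_gt0.
have bd k : base f (2 ^- k) = 0.
  elim: k => [|k IH]; first by rewrite expr0 invr1.
  rewrite link ?invr_gt0 ?exprn_gt0//.
  by rewrite [2 ^+ k.+1]exprS invfM mulrA mulfV// mul1r.
have mf := sp_mf fG.
have mf2 : measurable_fun setT (fun x => f x ^+ 2) by exact: measurable_funX.
have H : (\int[mu]_x (f x ^+ 2)%:E <= (0 + 0)%:E)%E.
  apply: integral_plane_le => //.
  - by move=> x; exact: sqr_ge0.
  - move=> N; rewrite integral_up//; apply: sume_le0 => k _.
    rewrite big_seq; apply: sume_le0 => j jr.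
    by apply: cell0 => //; rewrite exprn_gt0.
  - move=> N; rewrite integral_down//; apply: sume_le0 => k _.
    rewrite big_seq; apply: sume_le0 => j jr.
    by apply: cell0 => //; rewrite invr_gt0 exprn_gt0.
have E0 : (\int[mu]_x `|(f x ^+ 2)%:E| = 0)%E.
  apply/eqP; rewrite eq_le integral_ge0 ?andbT//.
  under eq_integral do rewrite gee0_abs ?lee_fin ?sqr_ge0//.
  by rewrite addr0 in H.
have mE : measurable_fun setT (fun x => (f x ^+ 2)%:E) by exact/measurable_EFinP.
have := (ae_eq_integral_abs mu measurableT mE).1 E0.
apply: negligibleS => x; apply: contra_not => /= /(_ Logic.I) [] /eqP.
by rewrite sqrf_eq0 => /eqP.
Qed.

End ZeroEnergy.

(** * The integral condition on dyadic annuli *)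

Section Weight.
Context {R : realType} (p : R) (W : R -> R).
Context (p1 : 1 < p) (W0 : forall r : R, 0 < r -> 0 < W r)
  (Wi : forall r s : R, 0 < r -> r <= s -> W r <= W s).
Local Notation leb := (@lebesgue_measure R).

(** A nondecreasing extension to the line; monotonicity is what makes the
    weight measurable. *)
Definition Wpos (r : R) : R := if 0 < r then W r else 0.

Lemma Wpos_nd : nondecreasing_fun Wpos.
Proof.
move=> r s rs; rewrite /Wpos; case: ifPn => r0.
  by rewrite (lt_le_trans r0 rs) Wi.
by case: ifPn => // s0; exact/ltW/W0.
Qed.

Lemma measurable_Wpos (D : set R) : measurable D -> measurable_fun D Wpos.
Proof. by move=> mD; exact: nondecreasing_measurable mD Wpos_nd. Qed.

Definition qexp : R := p / (p - 1).
Definition sexp : R := 1 / (p - 1).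
Definition Wint (r : R) : R := r * `|ln r| `^ qexp / W r `^ sexp.

Let p10 : 0 < p - 1. Proof. by rewrite subr_gt0. Qed.
Let p0 : 0 < p. Proof. exact: lt_trans p1. Qed.

Lemma Wint_ge0 r : 0 < r -> 0 <= Wint r.
Proof. by move=> r0; rewrite /Wint divr_ge0 ?powR_ge0// mulr_ge0 ?powR_ge0// ltW. Qed.

Lemma measurable_Wint : measurable_fun (`]0%R, +oo[ : set R) Wint.
Proof.
have mD : measurable (`]0%R, +oo[%classic : set R) by exact: measurable_itv.
have H : measurable_fun (`]0%R, +oo[ : set R)
    (fun r => r * `|ln r| `^ qexp * Wpos r `^ (- sexp)).
  apply: measurable_funM.
    apply: measurable_funM => //.
    apply: (measurableT_comp (measurable_powR qexp)).
    apply: measurableT_comp => //.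
    by apply: (@measurable_funS _ _ _ _ setT) => //; exact: measurable_ln.
  apply: (measurableT_comp (measurable_powR (- sexp))); exact: measurable_Wpos.
apply: eq_measurable_fun H => r /set_mem /=; rewrite in_itv/= andbT => r0.
by rewrite /Wint /Wpos r0 powRN.
Qed.

(** On a dyadic block [r] and [W r] are bounds for the variable and for the
    weight. *)
Lemma Wint_block (r L : R) : 0 < r -> 0 <= L ->
  (forall x : R, r / 2 < x -> x <= r -> L <= `|ln x|) ->
  ((r ^+ 2 / 4 * L `^ qexp / W r `^ sexp)%:E <=
   \int[leb]_(x in `](r / 2)%R, r]) (Wint x)%:E)%E.
Proof.
move=> r0 L0 HL.
have r20 : 0 < r / 2 by rewrite divr_gt0.
have mI : measurable (`]r / 2, r]%classic : set R) by exact: measurable_itv.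
set C := (r / 2) * L `^ qexp / W r `^ sexp.
have C0 : 0 <= C by rewrite divr_ge0 ?powR_ge0// mulr_ge0 ?powR_ge0// ltW.
have q0 : 0 <= qexp by rewrite divr_ge0 ?ltW.
have s0 : 0 <= sexp by rewrite divr_ge0 ?ltW.
have E : (\int[leb]_(x in `](r / 2)%R, r]) C%:E = (r ^+ 2 / 4 * L `^ qexp / W r `^ sexp)%:E)%E.
  have ml : leb (`](r / 2)%R, r]%classic : set R) = (r / 2)%:E.
    rewrite lebesgue_measure_itv /= lte_fin ltr_pdivrMr//.
    have -> : r < r * 2 by rewrite mulr_natr mulr2n ltrDl.
    by rewrite -EFinB; congr EFin; lra.
  rewrite integral_cst// [X in (_ * X)%E]ml -EFinM; congr EFin; rewrite /C; field.
  by rewrite gt_eqF// powR_gt0// W0.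
rewrite -E; apply: ge0_le_integral => //.
- apply/measurable_EFinP; apply: measurable_funS measurable_Wint => // x /=.
  by rewrite !in_itv/= andbT => /andP[h _]; exact: lt_trans h.
- move=> x /=; rewrite in_itv/= => /andP[x1 x2]; rewrite lee_fin /C /Wint.
  have x0 : 0 < x by exact: lt_trans x1.
  apply: ler_pM.
  - by apply: mulr_ge0; [exact: ltW|exact: powR_ge0].
  - by rewrite invr_ge0 powR_ge0.
  - apply: ler_pM; [exact: ltW|exact: powR_ge0|exact: ltW|].
    by apply: ge0_ler_powR; rewrite ?nnegrE//; exact: HL.
  - rewrite lef_pV2 ?posrE ?powR_gt0 ?W0//.
    by apply: ge0_ler_powR; rewrite ?nnegrE ?(ltW (W0 _))//; exact: Wi.
Qed.

(** A dyadic counterpart of the integral over the block below [r], when the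
    logarithm is there of order [1 + k]. *)
Definition Aterm (k : nat) (r : R) : R := r ^+ 2 * (1 + k%:R) `^ qexp / W r `^ sexp.

Lemma Aterm_ge0 k r : 0 <= Aterm k r.
Proof. by rewrite divr_ge0 ?powR_ge0// mulr_ge0 ?powR_ge0// sqr_ge0. Qed.

(** On the block below [2^k] one has [|ln x| >= (k - 1) ln 2], which is at
    least [(1 + k) ell] for [k >= 2]. *)
Definition ell : R := ln 2 / 3.

Lemma ln2_gt0 : 0 < ln 2 :> R. Proof. by rewrite ln_gt0// ltr1n. Qed.

Lemma Aterm_block k (r : R) : 0 < r ->
  (forall x : R, r / 2 < x -> x <= r -> (1 + k%:R) * ell <= `|ln x|) ->
  ((Aterm k r)%:E <= (4 / ell `^ qexp)%:E * \int[leb]_(x in `](r / 2)%R, r]) (Wint x)%:E)%E.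
Proof.
move=> r0 H.
have l0 : 0 < ell by rewrite divr_gt0// ln2_gt0.
have k0 : 0 <= 1 + k%:R :> R by rewrite addr_ge0.
have L0 : 0 <= (1 + k%:R) * ell by rewrite mulr_ge0// ltW.
have := Wint_block r0 L0 H.
have lq : 0 < ell `^ qexp by rewrite powR_gt0.
have c0 : (0 <= (4 / ell `^ qexp)%:E)%E by rewrite lee_fin divr_ge0// ltW.
move=> /(lee_wpmul2l c0); apply: le_trans.
rewrite -EFinM lee_fin le_eqVlt; apply/orP; left; apply/eqP.
rewrite /Aterm powRM ?(ltW l0)//; field.
by rewrite !gt_eqF// powR_gt0// W0.
Qed.

Lemma sum_block_le (u v : nat -> R) N : (forall k, 0 <= u k) ->
  (forall k l (x : R), (k < l)%N -> u k < x <= v k -> u l < x <= v l -> False) ->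
  (\sum_(k < N) \int[leb]_(x in `]u k, v k]) (Wint x)%:E <=
   \int[leb]_(x in `]0%R, +oo[) (Wint x)%:E)%E.
Proof.
move=> u0 disj.
pose F k : set R := `]u k, v k]%classic.
have mF k : measurable (F k) by exact: measurable_itv.
have F0 k x : F k x -> 0 < x.
  by rewrite /F /= in_itv/= => /andP[h _]; exact: le_lt_trans (u0 k) h.
have tF : trivIset [set` index_iota 0 N] F.
  move=> k l _ _ [x []]; rewrite /F /= !in_itv/= => xk xl.
  have [kl|lk|//] := ltngtP k l; first by exfalso; exact: (disj k l x).
  by exfalso; exact: (disj l k x).
have sub : \big[setU/set0]_(k <- index_iota 0 N) F k `<=` `]0%R, +oo[%classic.
  by rewrite -bigcup_seq => x [k _ /F0 x0]; rewrite /= in_itv/= x0.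
have mB : measurable (\big[setU/set0]_(k <- index_iota 0 N) F k).
  by apply: bigsetU_measurable => k _.
have mD : measurable (`]0%R, +oo[%classic : set R) by exact: measurable_itv.
have mW : measurable_fun (`]0%R, +oo[ : set R) (fun x => (Wint x)%:E).
  by apply/measurable_EFinP; exact: measurable_Wint.
apply: (@le_trans _ _ (\int[leb]_(x in \big[setU/set0]_(k <- index_iota 0 N) F k) (Wint x)%:E)%E); last first.
  apply: ge0_subset_integral => // x /=; rewrite in_itv/= andbT => x0.
  by rewrite lee_fin Wint_ge0.
rewrite ge0_integral_bigsetU//.
- by rewrite big_mkord.
- exact: iota_uniq.
- exact: measurable_funS mW.
- by move=> x /sub /=; rewrite in_itv/= andbT => x0; rewrite lee_fin Wint_ge0.
Qed.

(** The dyadic blocks are disjoint, and all but the terms close to radius one,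
    where the logarithm vanishes, are bounded by the integral over their
    block. *)
Lemma Aterm_sum : (\int[leb]_(x in `]0%R, +oo[) (Wint x)%:E < +oo)%E ->
  exists2 S : R, 0 < S &
    (forall N, \sum_(k < N) Aterm k (2 ^+ k) <= S) /\
    (forall N, \sum_(k < N) Aterm k (2 ^- k) <= S).
Proof.
move=> Wfin.
pose Y := fine (\int[leb]_(x in `]0%R, +oo[) (Wint x)%:E)%E.
have Yge : (0 <= \int[leb]_(x in `]0%R, +oo[) (Wint x)%:E)%E.
  by apply: integral_ge0 => x /=; rewrite in_itv/= andbT => x0; rewrite lee_fin Wint_ge0.
have YE : (\int[leb]_(x in `]0%R, +oo[) (Wint x)%:E)%E = Y%:E.
  by rewrite /Y fineK// ge0_fin_numE.
have Y0 : 0 <= Y by rewrite fine_ge0.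
have l0 : 0 < ell by rewrite divr_gt0// ln2_gt0.
pose c := 4 / ell `^ qexp.
have c0 : 0 <= c by rewrite divr_ge0// powR_ge0.
have l2 := ln2_gt0.
have lnX k : ln (2 ^+ k) = k%:R * ln 2 :> R by rewrite lnXn// mulr_natl.
have blocks (u v : nat -> R) (r : nat -> R) (a : nat -> nat) N :
  (forall k, 0 < r k) ->
  (forall k (x : R), r k / 2 < x -> x <= r k -> (1 + (a k)%:R) * ell <= `|ln x|) ->
  (forall k l (x : R), (k < l)%N -> r k / 2 < x <= r k -> r l / 2 < x <= r l -> False) ->
  \sum_(k < N) Aterm (a k) (r k) <= c * Y.
  move=> r0 Hl Hd; rewrite -lee_fin -sumEFin EFinM -YE.
  have uk k : 0 <= r k / 2 by rewrite divr_ge0// ltW.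
  have H := @sum_block_le (fun k => r k / 2) r N uk Hd.
  have cE : (0 <= c%:E)%E by rewrite lee_fin.
  refine (le_trans _ (lee_wpmul2l cE H)).
  rewrite ge0_sume_distrr => [|k _]; last first.
    apply: integral_ge0 => x /=; rewrite in_itv/= => /andP[x0 _].
    by rewrite lee_fin Wint_ge0// (le_lt_trans (uk k)).
  by apply: lee_sum => k _; exact: Aterm_block (r0 k) (Hl k).
have up N : \sum_(k < N) Aterm k.+2 (2 ^+ k.+2) <= c * Y.
  apply: (blocks _ _ (fun k => 2 ^+ k.+2) (fun k => k.+2)) => //.
  - move=> k x /= x1 _; have x1' : 2 ^+ k.+1 < x.
      by apply: le_lt_trans x1; rewrite [2 ^+ k.+2]exprS mulrC mulKf.
    have x0 : 0 < x by apply: lt_trans x1'; rewrite exprn_gt0.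
    apply: le_trans (ler_norm _).
    have : ln (2 ^+ k.+1) <= ln x by rewrite ler_ln ?posrE ?exprn_gt0// ltW.
    rewrite lnX; apply: le_trans; rewrite /ell -[k.+2]addn2 -[k.+1]addn1 !natrD.
    have k0 : 0 <= k%:R * ln 2 :> R := mulr_ge0 (ler0n _ _) (ltW l2).
    lra.
  - move=> k l x /= kl /andP[_ x1] /andP[x2 _].
    have : x < x; last by rewrite ltxx.
    apply: (le_lt_trans x1); apply: le_lt_trans x2.
    rewrite [2 ^+ l.+2]exprS [leRHS]mulrC mulKf//.
    by apply: ler_weXn2l => //; rewrite ler1n.
have down N : \sum_(k < N) Aterm k.+1 (2 ^- k.+1) <= c * Y.
  apply: (blocks _ _ (fun k => 2 ^- k.+1) (fun k => k.+1)) => //.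
  - move=> k x /= x1 x2; have x0 : 0 < x.
      by apply: lt_trans x1; rewrite divr_gt0// invr_gt0 exprn_gt0.
    rewrite -normrN; apply: le_trans (ler_norm _).
    have : ln x <= ln (2 ^- k.+1) by rewrite ler_ln ?posrE ?invr_gt0 ?exprn_gt0.
    rewrite lnV ?posrE ?exprn_gt0// lnX lerNr; apply: le_trans; rewrite /ell -[k.+1]addn1 !natrD.
    have k0 : 0 <= k%:R * ln 2 :> R := mulr_ge0 (ler0n _ _) (ltW l2).
    lra.
  - move=> k l x /= kl /andP[x2 _] /andP[_ x1].
    have : x < x; last by rewrite ltxx.
    apply: (le_lt_trans x1); apply: le_lt_trans x2.
    rewrite -invfM -exprSr lef_pV2 ?posrE ?exprn_gt0//.
    by apply: ler_weXn2l => //; rewrite ler1n.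
have cY0 : 0 <= c * Y by rewrite mulr_ge0.
have A0 := Aterm_ge0.
exists (1 + (Aterm 0 1 + Aterm 1 2 + c * Y)); last split.
- by rewrite ltr_pwDl// !addr_ge0.
- case=> [|[|N]]; first by rewrite big_ord0 !addr_ge0.
    rewrite big_ord_recl big_ord0 /= expr0; have := A0 1%N 2; lra.
  rewrite !big_ord_recl /= expr0 expr1; have := up N; lra.
- case=> [|N]; first by rewrite big_ord0 !addr_ge0.
  rewrite !big_ord_recl /= expr0 invr1; have := down N; have := A0 1%N 2; lra.
Qed.

End Weight.

(** * Summing over annuli with the weight *)

Section WeightedPotential.
Context {R : realType} (p : R) (W : R -> R).
Local Notation plane := (measurableTypeR R * measurableTypeR R)%type.
Local Notation mu := (@leb2 R).
Context (p1 : 1 < p) (W0 : forall r : R, 0 < r -> 0 < W r)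
  (Wi : forall r s : R, 0 < r -> r <= s -> W r <= W s).

Let p0 : 0 < p. Proof. exact: lt_trans p1. Qed.
Let p10 : 0 < p - 1. Proof. by rewrite subr_gt0. Qed.

(** The factors [1 / p] and [1 / q] of Young's inequality are at most one, and
    are dropped. *)
Lemma young_le (a b : R) : 0 <= a -> 0 <= b -> a * b <= a `^ qexp p + b `^ p.
Proof.
move=> a0 b0.
have q1 : 1 <= qexp p by rewrite /qexp ler_pdivlMr// mul1r gerBl.
have q0 : 0 < qexp p by exact: lt_le_trans q1.
have pq : (qexp p)^-1 + p^-1 = 1 by rewrite /qexp; field; rewrite !gt_eqF.
apply: (le_trans (conjugate_powR a0 b0 q0 p0 pq)); apply: lerD.
  by rewrite ler_piMr ?powR_ge0// invf_le1.
by rewrite ler_piMr ?powR_ge0// invf_le1// ltW.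
Qed.

(** Young's inequality applied to the left side divided by [J], with [W r ^
    (1/p)] shifted from one factor to the other; the two exponents make the
    first power [Aterm] and the second linear in [X]. *)
Lemma holder_term k (r X J : R) : 0 < r -> 0 <= X -> 0 < J ->
  (1 + k%:R) * (X `^ (1 / p) * r `^ expo p) <=
  J * Aterm p W k r + W r * X / J `^ (p - 1).
Proof.
move=> r0 X0 J0.
have w0 := W0 r0; set w := W r in w0 *.
have k0 : 0 <= 1 + k%:R :> R by rewrite addr_ge0.
have p'0 : p != 0 by rewrite gt_eqF.
have p'1 : p - 1 != 0 by rewrite gt_eqF.
pose a := (1 + k%:R) * r `^ expo p * w `^ (- (1 / p)).
pose b := w `^ (1 / p) * X `^ (1 / p) / J.
have re0 := powR_ge0 r (expo p); have wn0 := powR_ge0 w (- (1 / p)).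
have wp0 := powR_ge0 w (1 / p); have Xp0 := powR_ge0 X (1 / p).
have a0 : 0 <= a by rewrite /a !mulr_ge0.
have b0 : 0 <= b by rewrite /b divr_ge0 ?(ltW J0)// mulr_ge0.
have ww : w `^ (- (1 / p)) * w `^ (1 / p) = 1.
  by rewrite -powRD ?addNr ?powRr0// (gt_eqF w0) implybT.
have E : (1 + k%:R) * (X `^ (1 / p) * r `^ expo p) = J * (a * b).
  rewrite /a /b.
  transitivity ((1 + k%:R) * (X `^ (1 / p) * r `^ expo p) * (w `^ (- (1 / p)) * w `^ (1 / p))).
    by rewrite ww mulr1.
  by field; rewrite gt_eqF.
rewrite E.
have H := ler_wpM2l (ltW J0) (young_le a0 b0).
apply: (le_trans H).
rewrite mulrDr; apply: lerD.
  rewrite le_eqVlt; apply/orP; left; apply/eqP; congr (_ * _).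
  rewrite /a /Aterm powRM ?mulr_ge0// powRM// -!powRrM.
  have -> : expo p * qexp p = 2 by rewrite /expo /qexp; field; rewrite p'0 p'1.
  have -> : - (1 / p) * qexp p = - sexp p by rewrite /qexp /sexp; field; rewrite p'0 p'1.
  by rewrite powRN powR_mulrn ?(ltW r0)//; ring.
rewrite le_eqVlt; apply/orP; left; apply/eqP.
rewrite /b powRM ?mulr_ge0 ?invr_ge0 ?(ltW J0)// powRM// -!powRrM.
have -> : 1 / p * p = 1 by field.
rewrite !powRr1 ?(ltW w0)//.
have -> : J^-1 `^ p = (J `^ p)^-1.
  by rewrite -powR_inv1 ?(ltW J0)// -powRrM mulN1r powRN.
have -> : J `^ p = J * J `^ (p - 1) by rewrite mulr_powRB1 ?(ltW J0).
by field; rewrite !gt_eqF// powR_gt0.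
Qed.

Lemma enorm_ring r j (x : R * R) : 0 < r -> j \in ring12 -> sset (cell r j) x ->
  r <= enorm x.
Proof.
move=> r0 jr xc.
have [_ nb] : (box (2 * r) `\` box r) x.
  by rewrite annulus_cells// -bigcup_seq; exists j.
have rr : r = Num.sqrt (r ^+ 2) by rewrite sqrtr_sqr ger0_norm// ltW.
rewrite {1}rr /enorm ler_wsqrtr//.
rewrite leNgt; apply/negP => H; apply: nb; rewrite /box /=.
have h1 : `|x.1| < r.
  rewrite -(ltr_pXn2r (n := 2))// ?nnegrE ?(ltW r0)// real_normK ?num_real//.
  by apply: le_lt_trans H; rewrite lerDl sqr_ge0.
have h2 : `|x.2| < r.
  rewrite -(ltr_pXn2r (n := 2))// ?nnegrE ?(ltW r0)// real_normK ?num_real//.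
  by apply: le_lt_trans H; rewrite lerDr sqr_ge0.
by move: h1 h2; rewrite !ltr_norml => /andP[/ltW -> ->] /andP[/ltW -> ->].
Qed.

Lemma measurable_enorm : measurable_fun setT (@enorm R : plane -> R).
Proof.
have ms : measurable_fun setT (@Num.sqrt R).
  by apply: continuous_measurable_fun; exact: sqrt_continuous.
apply: (measurableT_comp ms); apply: measurable_funD; apply: measurable_funX.
  exact: measurable_fst.
exact: measurable_snd.
Qed.

Section Potential.
Context (V : plane -> R) (mV : measurable_fun setT V).

Definition wpot (x : plane) : R := V x `^ p * Wpos W (enorm x).

Lemma measurable_wpot : measurable_fun setT wpot.
Proof.
apply: measurable_funM; first exact: (measurableT_comp (measurable_powR p)).
by apply: measurableT_comp; [exact: measurable_Wpos|exact: measurable_enorm].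
Qed.

Lemma Wpos_ge0 r : 0 <= Wpos W r.
Proof. by rewrite /Wpos; case: ifPn => // r0; exact/ltW/W0. Qed.

Lemma wpot_ge0 x : 0 <= wpot x.
Proof. by rewrite mulr_ge0 ?powR_ge0// Wpos_ge0. Qed.

Context (J : R) (J0 : 0 < J) (VJ : (\int[mu]_x (wpot x)%:E <= (J `^ p)%:E)%E).

(** All points of an annulus have norm at least its inner radius, where [W] is
    smallest. *)
Lemma cell_wpot r j : 0 < r -> j \in ring12 ->
  ((W r)%:E * \int[mu]_(x in sset (cell r j)) (V x `^ p)%:E <=
   \int[mu]_(x in sset (cell r j)) (wpot x)%:E)%E.
Proof.
move=> r0 jr.
have mQ := measurable_sset (cell r j).
have mVp : measurable_fun (sset (cell r j)) (fun x => (V x `^ p)%:E).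
  apply: measurable_EFin_sset.
  exact: (measurableT_comp (measurable_powR p)).
have Vp0 x : (0 <= (V x `^ p)%:E)%E by rewrite lee_fin powR_ge0.
have w0 := W0 r0.
rewrite -ge0_integralZl//; last by rewrite lee_fin ltW.
apply: ge0_le_integral => //.
- by move=> x _; rewrite mule_ge0// lee_fin ltW.
- exact: measurable_funeM.
- apply: measurable_EFin_sset.
  exact: measurable_wpot.
- move=> x xc; rewrite -EFinM lee_fin /wpot mulrC ler_wpM2l ?powR_ge0//.
  have rx := enorm_ring r0 jr xc.
  by rewrite /Wpos (lt_le_trans r0 rx) Wi.
Qed.

Lemma cell_pfinite r j : 0 < r -> j \in ring12 -> pfinite V p (cell r j).
Proof.
move=> r0 jr; have w0 := W0 r0.
have H : ((W r)%:E * \int[mu]_(x in sset (cell r j)) (V x `^ p)%:E <= (J `^ p)%:E)%E.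
  apply: (le_trans (cell_wpot r0 jr)); apply: le_trans VJ.
  apply: ge0_subset_integral => //; first exact: measurable_sset.
    by apply/measurable_EFinP; exact: measurable_wpot.
  by move=> x _; rewrite lee_fin wpot_ge0.
rewrite /pfinite ltNge; apply/negP; rewrite leye_eq => /eqP E.
by move: H; rewrite E gt0_muley ?lte_fin// leye_eq.
Qed.

Lemma sum_wpot_le (r : nat -> R) N (A : set plane) : (forall k, 0 < r k) -> measurable A ->
  (\int[mu]_(x in A) (wpot x)%:E =
    \sum_(k < N) \sum_(j <- ring12) \int[mu]_(x in sset (cell (r k) j)) (wpot x)%:E)%E ->
  \sum_(k < N) W (r k) * \sum_(j <- ring12) pmass V p (cell (r k) j) <= J `^ p.
Proof.
move=> r0 mA E; rewrite -lee_fin; apply: le_trans VJ.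
apply: (@le_trans _ _ (\int[mu]_(x in A) (wpot x)%:E)%E); last first.
  apply: ge0_subset_integral => //.
    by apply/measurable_EFinP; exact: measurable_wpot.
  by move=> x _; rewrite lee_fin wpot_ge0.
rewrite E -sumEFin; apply: lee_sum => k _; rewrite big_distrr /= -sumEFin.
rewrite big_seq [leRHS]big_seq; apply: lee_sum => j jr.
have := cell_wpot (r0 k) jr.
by rewrite (pmassE (cell_pfinite (r0 k) jr)) -EFinM.
Qed.

Lemma tring_term c k r : 0 < c -> 0 < r ->
  c * ((1 + k%:R) * tring V p c r) <=
  12 * (J * Aterm p W k r) +
  W r * (\sum_(j <- ring12) pmass V p (cell r j)) / J `^ (p - 1).
Proof.
move=> c0 r0.
have -> : c * ((1 + k%:R) * tring V p c r) =
   \sum_(j <- ring12) (1 + k%:R) * (pmass V p (cell r j) `^ (1 / p) * r `^ expo p).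
  rewrite /tring !big_distrr /=; apply: eq_bigr => j _.
  by rewrite (scale_excess V p1 c0 (r0 : 0 < sqs (cell r j))); ring.
apply: (@le_trans _ _ (\sum_(j <- ring12)
   (J * Aterm p W k r + W r * pmass V p (cell r j) / J `^ (p - 1)))).
  by apply: ler_sum => j _; apply: holder_term => //; exact: pmass_ge0.
rewrite big_split /= lerD//.
  by rewrite /ring12 !big_cons big_nil; lra.
by rewrite -big_distrl /= -big_distrr.
Qed.

(** Summing [holder_term]: the first terms add up to [12 J S], one [Aterm] for
    each of the twelve cells, and the second ones to [2 J^p / J^(p-1) = 2 J].
    *)
Lemma tring_sum c S (r : nat -> R) N : 0 < c -> (forall k, 0 < r k) ->
  \sum_(k < N) Aterm p W k (r k) <= S ->
  \sum_(k < N) W (r k) * \sum_(j <- ring12) pmass V p (cell (r k) j) <= 2 * J `^ p ->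
  \sum_(k < N) (1 + k%:R) * tring V p c (r k) <= c^-1 * (12 * S + 2) * J.
Proof.
move=> c0 r0 HA HW.
have H : c * \sum_(k < N) (1 + k%:R) * tring V p c (r k) <=
    12 * (J * S) + (2 * J `^ p) / J `^ (p - 1).
  rewrite big_distrr /=.
  apply: (@le_trans _ _ (\sum_(k < N) (12 * (J * Aterm p W k (r k)) +
      W (r k) * (\sum_(j <- ring12) pmass V p (cell (r k) j)) / J `^ (p - 1)))).
    by apply: ler_sum => k _; exact: tring_term.
  rewrite big_split /= lerD//.
    by rewrite -big_distrr /= ler_wpM2l// -big_distrr /= ler_wpM2l// ltW.
  by rewrite -big_distrl /= ler_wpM2r// invr_ge0 powR_ge0.
rewrite -[leRHS]mulrA ler_pdivlMl//; apply: (le_trans H).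
have -> : 2 * J `^ p / J `^ (p - 1) = 2 * J.
  by rewrite -[J `^ p]mulr_powRB1 ?(ltW J0)//; field; rewrite gt_eqF// powR_gt0.
lra.
Qed.

Lemma tring_sum_up c S N : 0 < c ->
  (forall n, \sum_(k < n) Aterm p W k (2 ^+ k) <= S) ->
  \sum_(k < N) (1 + k%:R) * tring V p c (2 ^+ k) <= c^-1 * (12 * S + 2) * J.
Proof.
move=> c0 HS.
have r0 k : 0 < 2 ^+ k :> R by rewrite exprn_gt0.
apply: (tring_sum c0 r0 (HS N)).
have := @sum_wpot_le _ N (box (2 ^+ N) `\` box 1) r0.
have mA : measurable (box (2 ^+ N) `\` box (1 : R) : set plane).
  by apply: measurableD; exact: measurable_box.
move=> /(_ mA (integral_up N measurable_wpot)) H.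
by have := powR_ge0 J p; lra.
Qed.

Lemma tring_sum_down c S N : 0 < c ->
  (forall n, \sum_(k < n) Aterm p W k (2 ^- k) <= S) ->
  \sum_(k < N) (1 + k%:R) * tring V p c (2 ^- k) <= c^-1 * (12 * S + 2) * J.
Proof.
move=> c0 HS.
have r0 k : 0 < 2 ^- k :> R by rewrite invr_gt0 exprn_gt0.
apply: (tring_sum c0 r0 (HS N)).
(* The annulus of radius one lies outside the unit box, and is added
   separately to those which fill it; this is where the factor 2 comes from.
   *)
case: N => [|N]; first by rewrite big_ord0 mulr_ge0 ?powR_ge0.
rewrite big_ord_recl /= expr0 invr1.
have u0 k : 0 < 2 ^+ k :> R by rewrite exprn_gt0.
have mA n : measurable (box (2 ^+ n) `\` box (1 : R) : set plane).
  by apply: measurableD; exact: measurable_box.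
have mB n : measurable (box (1 : R) `\` box (2 ^- n) : set plane).
  by apply: measurableD; exact: measurable_box.
have H1 := sum_wpot_le u0 (mA 1%N) (integral_up 1 measurable_wpot).
rewrite big_ord_recl big_ord0 /= addr0 expr0 in H1.
have H2 := sum_wpot_le (fun k => r0 k.+1) (mB N) (integral_down N measurable_wpot).
by apply: (le_trans (lerD H1 H2)); lra.
Qed.

End Potential.
End WeightedPotential.

(** * Counting dimensions *)

Section LinearAlgebra.
Context {R : realType}.
Local Notation plane := (measurableTypeR R * measurableTypeR R)%type.
Local Notation mu := (@leb2 R).
Local Notation square := (@square R).

Lemma sset_empty (Q : square) : sqs Q < 0 -> sset Q = set0.
Proof.
move=> s0; apply/seteqP; split => // x; rewrite /sset /= => /andP[/andP[h1 h2] _].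
by have := le_lt_trans h1 h2; rewrite ltrDl ltNge (ltW s0).
Qed.

Lemma avg_lin n (u : 'I_n -> plane -> R) (v : 'I_n -> R) (Q : square) :
  (forall i Q', 0 <= sqs Q' -> mu.-integrable (sset Q') (EFin \o u i)) ->
  avg (fun x => \sum_(i < n) v i * u i x) Q = \sum_(i < n) v i * avg (u i) Q.
Proof.
move=> iu; have mQ := measurable_sset Q.
have iQ i : mu.-integrable (sset Q) (EFin \o u i).
  have [s0|s0] := leP 0 (sqs Q); first exact: iu.
  by rewrite (sset_empty s0); exact: integrable_set0.
rewrite /avg.
have -> : \int[mu]_(x in sset Q) (\sum_(i < n) v i * u i x) =
    \sum_(i < n) v i * \int[mu]_(x in sset Q) u i x.
  have ivu i : mu.-integrable (sset Q) (fun x => (v i * u i x)%:E).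
    exact: (integrableZl mQ (v i) (iQ i)).
  rewrite /Rintegral.
  under eq_integral do rewrite -sumEFin.
  rewrite integral_sum// -sum_fine => [|i _]; last exact: integrable_fin_num.
  by apply: eq_bigr => i _; rewrite -RintegralZl.
by rewrite big_distrr /=; apply: eq_bigr => i _; rewrite mulrCA.
Qed.

(** More unknowns than linear equations. *)
Lemma kill_averages n (u : 'I_n -> plane -> R) (L : seq square) :
  (size L < n)%N ->
  (forall i Q', 0 <= sqs Q' -> mu.-integrable (sset Q') (EFin \o u i)) ->
  exists v : 'I_n -> R, (exists i, v i != 0) /\
    forall Q, List.In Q L -> avg (fun x => \sum_(i < n) v i * u i x) Q = 0.
Proof.
move=> Ln iu.
pose Q0 : square := Sq 0 0 0.
pose A : 'M[R]_(n, size L) := \matrix_(i, j) avg (u i) (nth Q0 L j).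
have K0 : kermx A != 0.
  rewrite -mxrank_eq0 mxrank_ker subn_eq0 -ltnNge.
  exact: leq_ltn_trans (rank_leq_col A) Ln.
have [v vK vn0] := rowV0Pn K0.
exists (fun i => v 0 i); split.
  by have /rV0Pn := vn0.
have vA : v *m A = 0 by apply/eqP; rewrite -sub_kermx.
move=> Q QL.
have [j jL Qj] : exists2 j, (j < size L)%N & Q = nth Q0 L j.
  elim: L QL {Ln A K0 v vK vn0 vA} => //= Q' L IH [->|/IH [j jL ->]].
    by exists 0%N.
  by exists j.+1.
rewrite avg_lin//; have /matrixP /(_ 0 (Ordinal jL)) := vA.
rewrite !mxE => /(etrans _); apply; apply: eq_bigr => i _; by rewrite !mxE Qj.
Qed.

Lemma subspace_lin (S : set (R * R -> R)) n (u : 'I_n -> R * R -> R) (v : 'I_n -> R) :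
  is_subspace S -> (forall i, S (u i)) -> S (fun x => \sum_(i < n) v i * u i x).
Proof.
move=> [S0 SD] Su.
have -> : (fun x => \sum_(i < n) v i * u i x) = \sum_(i < n) v i *: u i.
  by apply/funext => x; rewrite fct_sumE; apply: eq_bigr => i _.
by elim/big_rec : _ => // i f _ Sf; exact: SD.
Qed.

End LinearAlgebra.

Theorem corollary1p3 (R : realType) (p : R) (W : R -> R)
  (p_gt1 : 1 < p)
  (W_gt0 : forall r : R, 0 < r -> 0 < W r)
  (W_incr : forall r s : R, 0 < r -> r <= s -> W r <= W s)
  (W_int : (\int[lebesgue_measure]_(r in `]0%R, +oo[)
     (r * `|ln r| `^ (p / (p - 1)) / W r `^ (1 / (p - 1)))%:E < +oo)%E) :
  exists C : R, 0 < C /\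
    forall V : R * R -> R, potential [set: R * R] V ->
      (Neg V [set: R * R] <=
       1 + C%:E * (\int[leb2]_x (V x `^ p * W (enorm x))%:E) `^ (1 / p))%E.
Proof.
have p_gt0 : 0 < p by exact: lt_trans p_gt1.
have [S S0 [Sup Sdown]] := Aterm_sum p_gt1 W_gt0 W_incr W_int.
have K0 : 0 < Ktree (expo p) by exact/Ktree_gt0/expo_gt0.
have Cd0 : 0 < Cdir p by rewrite /Cdir /Cring; lra.
(* Makes the constant [2 * c * Cdir p] of [global_controls] one half. *)
pose c := (4 * Cdir p)^-1.
have c0 : 0 < c by rewrite invr_gt0 mulr_gt0.
have Cs0 := Csize_gt0 p_gt1.
pose T := c^-1 * (12 * S + 2).
have T0 : 0 < T by rewrite mulr_gt0 ?invr_gt0//; lra.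
pose C := 2 * (1 + Csize p) * T.
have C0 : 0 < C by rewrite mulr_gt0// mulr_gt0//; lra.
exists C; split => // V [[mV0 _] Vae].
(* A potential is nonnegative almost everywhere only; its positive part is
   nonnegative everywhere. *)
pose V1 : measurableTypeR R * measurableTypeR R -> R := fun x => Num.max (V x) 0.
have mV1 : measurable_fun setT V1 by apply: measurable_maxr.
have V10 x : 0 <= V1 x by rewrite /V1 le_max lexx orbT.
have VV1 : {ae leb2, forall x, V x = V1 x}.
  apply: negligibleS Vae => x; apply: contra_not => /= H.
  by rewrite /V1; apply/esym/max_idPl; exact: H.
have IE : (\int[leb2]_x (V x `^ p * W (enorm x))%:E = \int[leb2]_x (wpot p W V1 x)%:E)%E.
  have mWe : measurable_fun setT (fun x : measurableTypeR R * measurableTypeR R => W (enorm x)).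
    have mW : measurable_fun setT (fun x : measurableTypeR R * measurableTypeR R =>
        if 0 < enorm x then Wpos W (enorm x) else W 0).
      apply: measurable_fun_ifT => //.
        by apply: measurable_fun_ltr => //; exact: measurable_enorm.
      apply: measurableT_comp; last exact: measurable_enorm.
      exact: measurable_Wpos.
    apply: eq_measurable_fun mW => x _.
    by rewrite /Wpos; case: ifPn => [-> //|]; rewrite lt_neqAle sqrtr_ge0 andbT negbK => /eqP <-.
  have mp (X : measurableTypeR R * measurableTypeR R -> R) :
      measurable_fun setT X -> measurable_fun setT (fun x => X x `^ p).
    exact: (measurableT_comp (measurable_powR p)).
  apply: ae_eq_integral => //.
  - by apply/measurable_EFinP; apply: measurable_funM => //; exact: mp.
  - by apply/measurable_EFinP; exact: measurable_wpot.
  - have N0 : leb2.-negligible [set x : measurableTypeR R * measurableTypeR R | x.1 = 0].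
      apply/negligibleP; last exact: null_line0.
      rewrite (_ : mkset _ = ([set 0] : set (measurableTypeR R)) `*` setT).
        by apply: measurableX.
      by apply/seteqP; split=> x //= [].
    apply: negligibleS (negligibleU VV1 N0) => x /= H.
    have [x1|x1] := eqVneq x.1 0; [by right|left => VE; apply: H => _].
    rewrite /wpot /Wpos VE ifT// sqrtr_gt0 ltr_wpDr ?sqr_ge0//.
    by rewrite exprn_even_gt0.
rewrite IE.
set I := (\int[leb2]_x (wpot p W V1 x)%:E)%E.
have I0 : (0 <= I)%E.
  by apply: integral_ge0 => x _; rewrite lee_fin; exact: wpot_ge0.
have [->|Ify] := eqVneq I +oo%E.
  rewrite poweRyr ?gt_eqF ?divr_gt0// gt0_muley ?lte_fin// addey ?leey//.
have Ifin : I \is a fin_num by rewrite ge0_fin_numE// lt_neqAle Ify leey.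
pose J := fine I `^ (1 / p).
have J0 : 0 <= J by exact: powR_ge0.
have IJ : I = (J `^ p)%:E.
  rewrite /J -powRrM mul1r mulVf ?gt_eqF// powRr1 ?fine_ge0// fineK//.
rewrite -(fineK Ifin) poweR_EFin -/J.
have -> : (1 + C%:E * J%:E = (1 + C * J)%:E)%E by [].
(* The bound is proved for every [J'] larger than [J], as [J] itself may be
   zero and [tring_sum] divides by it. *)
apply: ge_ereal_sup => _ [U [Usub Udom Uen] <-].
apply: ge_ereal_sup => _ [n [u [uU uind]] <-].
rewrite lee_fin; apply/ler_addgt0Pr => eps eps0.
pose J' := J + eps / C.
have J'0 : 0 < J' by rewrite ltr_wpDl// divr_gt0.
have VJ : (\int[leb2]_x (wpot p W V1 x)%:E <= (J' `^ p)%:E)%E.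
  rewrite -/I IJ lee_fin; apply: ge0_ler_powR; rewrite ?nnegrE ?(ltW p_gt0) ?(ltW J'0)//.
  by rewrite lerDl divr_ge0 ?ltW.
have fin1 k j : j \in ring12 -> pfinite V1 p (cell (2 ^+ k) j).
  by apply: (cell_pfinite W_gt0 W_incr mV1 VJ); rewrite exprn_gt0.
have fin2 k j : j \in ring12 -> pfinite V1 p (cell (2 ^- k) j).
  by apply: (cell_pfinite W_gt0 W_incr mV1 VJ); rewrite invr_gt0 exprn_gt0.
have M1 N : \sum_(k < N) (1 + k%:R) * tring V1 p c (2 ^+ k) <= T * J'.
  exact: (tring_sum_up p_gt1 W_gt0 W_incr mV1 J'0 VJ N c0 Sup).
have M2 N : \sum_(k < N) (1 + k%:R) * tring V1 p c (2 ^- k) <= T * J'.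
  exact: (tring_sum_down p_gt1 W_gt0 W_incr mV1 J'0 VJ N c0 Sdown).
have [L sL HL] := global_controls p_gt1 c0 mV1 V10 fin1 fin2 M1 M2.
have sLC : (size L)%:R <= 1 + C * J + eps.
  apply: (le_trans sL); rewrite le_eqVlt; apply/orP; left; apply/eqP.
  rewrite -/T /J'; have -> : 2 * (1 + Csize p) * (T * (J + eps / C)) = C * (J + eps / C).
    by rewrite /C mulrA.
  by rewrite mulrDr addrA mulrCA mulfV ?mulr1// gt_eqF.
apply: le_trans sLC; rewrite ler_nat leqNgt; apply/negP => Ln.
have pu i := form_domain_sobolev_pair (Udom _ (uU i)).
have iu i Q' : 0 <= sqs Q' -> leb2.-integrable (sset Q') (EFin \o u i).
  by move=> s0; exact: (sp_if (pu i) s0).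
have [v [[i vi] Hv]] := kill_averages Ln iu.
pose f x := \sum_(i < n) v i * u i x.
have Uf : U f by exact: subspace_lin.
have fG := form_domain_sobolev_pair (Udom _ Uf).
set G := fun _ => _ in fG.
have [b1 Hf] := HL f G fG Hv.
have D0 : \int[leb2]_x G x = 0.
  have DE : dirichlet setT f = (\int[leb2]_x G x)%:E.
    by rewrite /Rintegral fineK// integrable_fin_num// (sp_iG fG).
  have mf := sp_mf fG.
  have PE : potential_energy V setT f = (\int[leb2]_x (V1 x * f x ^+ 2)%:E)%E.
    apply: ae_eq_integral => //.
    - by apply/measurable_EFinP/measurable_funM => //; exact: measurable_funX.
    - by apply/measurable_EFinP/measurable_funM => //; exact: measurable_funX.
    - by apply: negligibleS VV1 => x; apply: contra_not => /= -> .
  have := Uen f Uf; rewrite /energy DE PE => En.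
  have D0 : 0 <= \int[leb2]_x G x.
    by apply: Rintegral_ge0 => x _; exact: (sp_G0 fG).
  move: En Hf; case: (\int[leb2]_x (V1 x * f x ^+ 2)%:E)%E => [P||] //=.
  rewrite -EFinB !lee_fin => En Hf; apply/eqP; rewrite eq_le D0 andbT.
  move: Hf; have -> : 2 * c * Cdir p = 2^-1.
    by rewrite /c; field; rewrite gt_eqF.
  by lra.
have f0 := zero_energy fG D0 b1.
have /uind /(_ i) v0 : {ae leb2, forall x, [set: R * R] x -> \sum_(i < n) v i * u i x = 0}.
  by apply: negligibleS f0 => x; apply: contra_not => fx _.
by rewrite v0 eqxx in vi.
Qed.
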